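(* Let $1\le s\le M$ and $1\le t\le N$. The denominator of the $\mathrm{End}(V_s^+\otimes V_t^-)$-valued rational function $R^{s|t}_{a,b}|_{V_s^+\otimes V_t^-}$ of $a,b$ is $bq^2-aq^{-2s}$ (up to multiplication by a non-zero complex number).
   Context: Fix integers $M,N\ge 1$ and $q\in\mathbb{C}^\times$ not a root of unity. Put $\kappa=M+N$, $I=\{1,\dots,\kappa\}$; for $i\le M$ set $|i|=\bar 0,\ d_i=1$; for $i>M$ set $|i|=\bar 1,\ d_i=-1$; $q_i=q^{d_i}$. All vector spaces, algebras and modules are $\mathbb{Z}_2$-graded over $\mathbb{C}$, and tensor products of algebras and of maps obey the Koszul sign rule. $U_q(\mathfrak{g})$, $\mathfrak g=\mathfrak{gl}(M,N)$: Let $\mathbf V=\bigoplus_{i\in I}\mathbb{C}v_i$ with $|v_i|=|i|$, $E_{ij}\in\mathrm{End}(\mathbf V)$, $E_{ij}v_k=\delta_{jk}v_i$, and $$R(z,w)=\sum_{i}(zq_i-wq_i^{-1})E_{ii}\otimes E_{ii}+(z-w)\sum_{i\ne j}E_{ii}\otimes E_{jj}+z\sum_{i<j}(q_i-q_i^{-1})E_{ji}\otimes E_{ij}+w\sum_{i<j}(q_j-q_j^{-1})E_{ij}\otimes E_{ji}.$$ The quantum affine superalgebra $U_q(\widehat{\mathfrak g})$ is generated by $s_{ij}^{(n)},t_{ij}^{(n)}$ ($i,j\in I$, $n\ge0$) of parity $|i|+|j|$ with relations, for $s_{ij}(z)=\sum_n s_{ij}^{(n)}z^n$, $t_{ij}(z)=\sum_n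 t_{ij}^{(n)}z^{-n}$, $S(z)=\sum s_{ij}(z)\otimes E_{ij}$, $T(z)=\sum t_{ij}(z)\otimes E_{ij}$: $R_{23}(z,w)A_{12}(z)B_{13}(w)=B_{13}(w)A_{12}(z)R_{23}(z,w)$ for $(A,B)\in\{(T,T),(S,S),(T,S)\}$, $t_{ij}^{(0)}=s_{ji}^{(0)}=0$ for $i<j$, $t_{ii}^{(0)}s_{ii}^{(0)}=1=s_{ii}^{(0)}t_{ii}^{(0)}$. It is a Hopf superalgebra with $\Delta(s_{ij}^{(n)})=\sum_{m=0}^n\sum_{k}(-1)^{(|i|+|k|)(|k|+|j|)}s_{ik}^{(m)}\otimes s_{kj}^{(n-m)}$ and the same formula for $t$. $U_q(\mathfrak g)$ is the sub-Hopf-superalgebra generated by $s_{ij}:=s_{ij}^{(0)}$, $t_{ij}:=t_{ij}^{(0)}$. Modules: $\mathbf V$ is a $U_q(\mathfrak g)$-module via $s_{ii}\mapsto q_iE_{ii}+\sum_{j\ne i}E_{jj}$, $t_{ii}\mapsto$ its inverse, and for $i<j$: $s_{ij}\mapsto(q_i-q_i^{-1})E_{ij}$, $t_{ji}\mapsto-(q_i-q_i^{-1})E_{ji}$. $\mathbf W=\bigoplus_{i\in I}\mathbb{C}w_i$ ($|w_i|=|i|$) is the pull-back of $\mathbf V$ (with $w_i$ corresponding to $v_i$) by the algebra automorphism $\Psi: s_{ij}\mapsto\varepsilon_{ji}t_{ji},\ t_{ij}\mapsto\varepsilon_{ji}s_{ji}$, where $\varepsilon_{ij}=(-1)^{|i|+|i||j|}$.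 $V_s^+$ is the sub-$U_q(\mathfrak g)$-module of $\mathbf V^{\otimes s}$ generated by $v_\kappa^{\otimes s}$, and $V_t^-$ is the sub-$U_q(\mathfrak g)$-module of $\mathbf W^{\otimes t}$ generated by $w_1^{\otimes t}$. $R$-matrix: denote also by $E_{ij}\in\mathrm{End}(\mathbf W)$ the map $w_k\mapsto\delta_{jk}w_i$. Define in $\mathrm{End}(\mathbf V\otimes\mathbf W)$ $$R^{+-}_{a,b}=\sum_{i\ne j}E_{ii}\otimes E_{jj}+\sum_i\tfrac{bq_i-aq_i^{-1}}{b-a}E_{ii}\otimes E_{ii}+\sum_{i<j}\tfrac{a(q_j-q_j^{-1})}{b-a}E_{ji}\otimes E_{ji}+\sum_{i>j}\tfrac{b(q_i-q_i^{-1})}{b-a}E_{ji}\otimes E_{ji}.$$ Put $R^{s|t}_{a,b}=F_tF_{t-1}\cdots F_1\in\mathrm{End}(\mathbf V^{\otimes s}\otimes\mathbf W^{\otimes t})$, where $F_j=(R^{+-}_{aq^{-2},bq^{2j}})_{1,s+j}(R^{+-}_{aq^{-4},bq^{2j}})_{2,s+j}\cdots(R^{+-}_{aq^{-2s},bq^{2j}})_{s,s+j}$; the subscripts $i,s+j$ indicate the tensor factors acted on. This operator preserves $V_s^+\otimes V_t^-$, so it restricts to an $\mathrm{End}(V_s^+\otimes V_t^-)$-valued rational function of $a,b$. Denominator: the denominator of such an operator-valued function $R(a,b)$ is a homogeneous polynomial $D(a,b)$ of minimal degree such that $D(a,b)R(a,b)$ is polynomial in $a,b$; it is well-defined up to a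 non-zero scalar. *)

(* Defs.v *)
From mathcomp Require Import all_boot all_order all_algebra.
From mathcomp Require Import reals complex mxtens mpoly.

Set Implicit Arguments.
Unset Strict Implicit.
Unset Printing Implicit Defensive.

Import GRing.Theory.
Local Open Scope ring_scope.

(* A finite-dimensional superspace with a homogeneous basis (e_i) indexed by
   'I_(sdim X). An element A of End(X) is the usual matrix acting on columns,
   A e_j = \sum_i A i j e_i, so that composition is *m. Vectors and subspaces
   are however stored as row vectors and row spaces, so that they fit mxalgebra;
   A thus sends the row vector v to v *m A^T. *)
Record superspace := Superspace { sdim : nat ; parity : 'I_sdim -> bool }.

Definition stens (X Y : superspace) : superspace :=
  @Superspace (sdim X * sdim Y)
    (fun k => parity (mxtens_unindex k).1 (+) parity (mxtens_unindex k).2).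

Definition sunit : superspace := @Superspace 1 (fun=> false).

Fixpoint spow (X : superspace) (n : nat) : superspace :=
  if n is n'.+1 then stens X (spow X n') else sunit.

Section SuperOperators.
Variable F : fieldType.
Implicit Types X Y : superspace.

(* (A ⊗ B)(x ⊗ y) = (-1)^(|B||x|) A x ⊗ B y for homogeneous B and x, extended
   bilinearly: the entry B k2 l2 is the coefficient of a matrix unit of parity
   |k2| + |l2|. *)
Definition sotens X Y (A : 'M[F]_(sdim X)) (B : 'M[F]_(sdim Y)) :
    'M[F]_(sdim (stens X Y)) :=
  \matrix_(k, l)
    let: (k1, k2) := mxtens_unindex k in
    let: (l1, l2) := mxtens_unindex l in
    (-1) ^+ ((parity k2 (+) parity l2) && parity l1) * A k1 l1 * B k2 l2.

(* 1 ⊗ ... ⊗ 1 ⊗ A ⊗ 1 ⊗ ... ⊗ 1, with A in the k-th of n tensor factors,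
   counted from 0; the value for k >= n is irrelevant. *)
Fixpoint at_factor X (n k : nat) (A : 'M[F]_(sdim X)) :
    'M[F]_(sdim (spow X n)) :=
  match n return 'M[F]_(sdim (spow X n)) with
  | 0 => 1%:M
  | n'.+1 => if k is k'.+1 then sotens 1%:M (at_factor n' k' A)
             else sotens A 1%:M
  end.

Fixpoint vpow X (v : 'rV[F]_(sdim X)) (n : nat) : 'rV[F]_(sdim (spow X n)) :=
  match n return 'rV[F]_(sdim (spow X n)) with
  | 0 => 1%:M
  | n'.+1 => (tensmx v (vpow v n') : 'M_(1 * 1, _))
  end.

End SuperOperators.

(* I = {1, ..., M + N} is 'I_(M + N), so that i <= M becomes i < M. *)
Definition ipar (M N : nat) (i : 'I_(M + N)) : bool := (M <= i)%N.
Arguments ipar {M N} i.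

Definition qi (F : fieldType) (M N : nat) (q : F) (i : 'I_(M + N)) : F :=
  if ipar i then q^-1 else q.

(* V and W have the same underlying superspace. *)
Definition spaceV (M N : nat) : superspace := Superspace (@ipar M N).

(* The Hopf superalgebra U_q(gl(M,N)) is generated by the s_ij and t_ij: a
   module is given by two families of operators, the actions of the s_ij and of
   the t_ij. *)
Definition family (F : fieldType) (M N : nat) (X : superspace) :=
  'I_(M + N) -> 'I_(M + N) -> 'M[F]_(sdim X).

Section Modules.
Variables (F : fieldType) (M N : nat).
Local Notation I := 'I_(M + N).
Local Notation family := (family F M N).

Definition coprod X Y (x : family X) (y : family Y) : family (stens X Y) :=
  fun i j => \sum_(k : I)
    (-1) ^+ ((ipar i (+) ipar k) && (ipar k (+) ipar j)) *:
    sotens (x i k) (y k j).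

(* The iterated coproduct; for n = 0 this is the counit. *)
Fixpoint powfam X (x : family X) (n : nat) : family (spow X n) :=
  match n return family (spow X n) with
  | 0 => fun i j => (i == j)%:R%:M
  | n'.+1 => coprod x (powfam x n')
  end.

(* The submodule generated by v: saturate the line spanned by v under all the
   s_ij and t_ij. The dimension of the ambient space bounds the number of steps
   that are needed; see submodP. *)
Definition submod_step X (s t : family X) (U : 'M[F]_(sdim X)) :
    'M[F]_(sdim X) :=
  (U + \sum_(i : I) \sum_(j : I) (U *m (s i j)^T + U *m (t i j)^T))%MS.

Definition submod X (s t : family X) (v : 'rV[F]_(sdim X)) : 'M[F]_(sdim X) :=
  iter (sdim X) (submod_step s t) <<v>>%MS.

Definition is_submodule X (s t : family X) m (U : 'M[F]_(m, sdim X)) : Prop :=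
  forall i j, stablemx U (s i j)^T /\ stablemx U (t i j)^T.

Lemma submod_step_ge X (s t : family X) U : (U <= submod_step s t U)%MS.
Proof. exact: addsmxSl. Qed.

Lemma submod_step_le X (s t : family X) U m (W : 'M[F]_(m, sdim X)) :
  (submod_step s t U <= W)%MS <->
  (U <= W)%MS /\
  forall i j, (U *m (s i j)^T <= W)%MS /\ (U *m (t i j)^T <= W)%MS.
Proof.
rewrite /submod_step addsmx_sub; split.
  case/andP=> -> /sumsmx_subP UW; split=> // i j.
  have /sumsmx_subP/(_ j isT) := UW i isT.
  by rewrite addsmx_sub => /andP.
case=> -> UW; apply/sumsmx_subP=> i _; apply/sumsmx_subP=> j _.
by rewrite addsmx_sub; have [-> ->] := UW i j.
Qed.

Lemma submodP X (s t : family X) (v : 'rV[F]_(sdim X)) :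
  [/\ (v <= submod s t v)%MS,
      is_submodule s t (submod s t v)
    & forall m (W : 'M[F]_(m, sdim X)),
        is_submodule s t W -> (v <= W)%MS -> (submod s t v <= W)%MS].
Proof.
pose step := submod_step s t; pose U n := iter n step <<v>>%MS.
have US n : (U n <= U n.+1)%MS by exact: submod_step_ge.
have U0 n : (v <= U n)%MS.
  elim: n => [|n /submx_trans]; first by rewrite /= genmxE.
  by apply; exact: US.
split; first exact: U0; last first.
  move=> m W Wst vW; suff UW n : (U n <= W)%MS by exact: UW.
  elim: n => [|n IHn]; first by rewrite /= genmxE.
  apply/submod_step_le; split=> // i j; have [Ws Wt] := Wst i j.
  by split; [move: Ws | move: Wt]; apply: submx_trans; exact: submxMr.
have stab n : (U n.+1 <= U n)%MS -> (U n.+2 <= U n.+1)%MS.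
  move=> le_n; apply/submod_step_le; split=> // i j.
  have /submod_step_le[_ /(_ i j)[As At]] := submx_refl (U n.+1).
  by split; [move: As | move: At]; apply: submx_trans; exact: submxMr.
have fix_U : (U (sdim X).+1 <= U (sdim X))%MS.
  apply/negPn/negP => nfix.
  have rk n : (n <= (sdim X).+1)%N -> (n <= \rank (U n))%N.
    elim: n => // n IHn lt_n; apply: leq_ltn_trans (IHn (ltnW lt_n)) _.
    apply: rank_ltmx; rewrite ltmxE US /=; apply: contra nfix => le_n.
    suff stabk k : (U (k + n).+1 <= U (k + n)%N)%MS.
      by have := stabk (sdim X - n)%N; rewrite subnK.
    by elim: k => // k; exact: stab.
  by have := leq_trans (rk _ (leqnn _)) (rank_leq_col _); rewrite ltnn.
by have /submod_step_le[_] := fix_U.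
Qed.

Variable q : F.

Definition sV : family (spaceV M N) := fun i j =>
  if (i < j)%N then (qi q i - (qi q i)^-1) *: delta_mx i j
  else if i == j then
    qi q i *: delta_mx i i + \sum_(k : I | k != i) delta_mx k k
  else 0.

Definition tV : family (spaceV M N) := fun i j =>
  if (j < i)%N then - (qi q j - (qi q j)^-1) *: delta_mx i j
  else if i == j then invmx (sV i i)
  else 0.

Definition eps (i j : I) : F := (-1) ^+ (ipar i + ipar i * ipar j).

(* The pull-back of V by s_ij |-> eps_ji t_ji, t_ij |-> eps_ji s_ji. *)
Definition sW : family (spaceV M N) := fun i j => eps j i *: tV j i.
Definition tW : family (spaceV M N) := fun i j => eps j i *: sV j i.

Definition v_last : 'rV[F]_(sdim (spaceV M N)) := \row_j (j.+1 == M + N)%:R.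
Definition w_first : 'rV[F]_(sdim (spaceV M N)) := \row_j (j == 0 :> nat)%:R.

(* V_s^+ in the s-th tensor power of V, V_t^- in the t-th tensor power of W *)
Definition Vplus (s : nat) : 'M[F]_(sdim (spow (spaceV M N) s)) :=
  submod (powfam sV s) (powfam tV s) (vpow v_last s).
Definition Vminus (t : nat) : 'M[F]_(sdim (spow (spaceV M N) t)) :=
  submod (powfam sW t) (powfam tW t) (vpow w_first t).

(* The operator R^{+-}_{a,b} acting on two tensor factors of some space of
   dimension d: x i j and y i j are E_ij acting on the factor V, resp. W. *)
Definition Rpm d (a b : F) (x y : I -> I -> 'M[F]_d) : 'M[F]_d :=
  \sum_(i : I) \sum_(j : I | i != j) x i i *m y j j
  + \sum_(i : I) ((b * qi q i - a * (qi q i)^-1) / (b - a)) *: (x i i *m y i i)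
  + \sum_(i : I) \sum_(j : I | (i < j)%N)
      (a * (qi q j - (qi q j)^-1) / (b - a)) *: (x j i *m y j i)
  + \sum_(i : I) \sum_(j : I | (j < i)%N)
      (b * (qi q i - (qi q i)^-1) / (b - a)) *: (x j i *m y j i).

Definition powVW (s t : nat) : superspace :=
  stens (spow (spaceV M N) s) (spow (spaceV M N) t).

Definition EV s t (l : nat) (i j : I) : 'M[F]_(sdim (powVW s t)) :=
  sotens (at_factor s l (delta_mx i j : 'M_(sdim (spaceV M N)))) 1%:M.
Definition EW s t (l : nat) (i j : I) : 'M[F]_(sdim (powVW s t)) :=
  sotens 1%:M (at_factor t l (delta_mx i j : 'M_(sdim (spaceV M N)))).

(* F_{j+1} with the numbering of factors from 0 *)
Definition Rfactor s t (a b : F) (j : nat) : 'M[F]_(sdim (powVW s t)) :=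
  \prod_(l < s)
    Rpm (a * q ^- (2 * l.+1)) (b * q ^+ (2 * j.+1)) (EV s t l) (EW s t j).

(* F_t F_{t-1} ... F_1 *)
Definition Rst s t (a b : F) : 'M[F]_(sdim (powVW s t)) :=
  \prod_(j < t) Rfactor s t a b (rev_ord j).

End Modules.

(* Rational functions of two variables: 'X_0 is a and 'X_1 is b. *)
Section Rational.
Variable C : fieldType.
Local Notation K := {fraction {mpoly C[2]}}.

Definition va : {mpoly C[2]} := 'X_(0 : 'I_2).
Definition vb : {mpoly C[2]} := 'X_(1 : 'I_2).

Definition cst (c : C) : K := tofrac (c%:MP_[2]).

(* The matrix, in the basis row_base U of the C-subspace U, of the restriction
   to U of an operator A with rational coefficients that preserves U. *)
Definition restr n (U : 'M[C]_n) (A : 'M[K]_n) : 'M[K]_(\rank U) :=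
  (conjmx (map_mx cst (row_base U)) A^T)^T.

Definition clears m n (D : {mpoly C[2]}) (A : 'M[K]_(m, n)) : Prop :=
  exists P : 'M[{mpoly C[2]}]_(m, n), tofrac D *: A = map_mx (@tofrac _) P.

Definition admissible m n (A : 'M[K]_(m, n)) (D : {mpoly C[2]}) : Prop :=
  [/\ D != 0, (exists d, D \is d.-homog) & clears D A].

(* msize is one plus the total degree on nonzero polynomials. *)
Definition is_denominator m n (A : 'M[K]_(m, n)) (D : {mpoly C[2]}) : Prop :=
  admissible A D /\
  forall D', admissible A D' -> (msize D <= msize D')%N.

(* R^{s|t}_{a,b} restricted to V_s^+ ⊗ V_t^- *)
Definition Rst_restr (M N : nat) (q : C) (s t : nat) :=
  restr (tensmx (Vplus M N q s) (Vminus M N q t))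
        (Rst M N (cst q) s t (tofrac va) (tofrac vb)).

End Rational.

(* Main.v *)
Require Import Defs.
From mathcomp Require Import all_boot all_order all_algebra.
From mathcomp Require Import reals complex mxtens mpoly ring zify.
Set Implicit Arguments.
Unset Strict Implicit.
Unset Printing Implicit Defensive.
Import GRing.Theory.
Local Open Scope ring_scope.

(** Why the theorem holds. Put z = a / b and r = q^-2, and number the tensor
    factors from 0. The operator R^{s|t} is a product over the grid of pairs
    (l, j), with l < s and j < t, of operators R^{+-} in the l-th factor V and
    the j-th factor W, and the factor at (l, j) has a simple pole where
    z r^(l+j+2) = 1. On V_s^+ ⊗ V_t^- fusion removes all of these
    poles but one.

    Up to a scalar, R^{+-} contracts the pencil s_ij - z t_ij, evaluated on V,
    against the matrix units of W ([Rpm_V]); it also contracts the pencil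
    t_ij - z s_ij, evaluated on W, against the matrix units of V ([Rpm_W]).
    Such contractions turn coproducts into products ([Phi_coprodV],
    [Phi_coprodW]), so a column of the grid (fixed j) is the contraction of an
    iterated coproduct of pencils with parameters in geometric progression, a
    [tower]; a row (fixed l) is another one.

    Fusion computes a tower on the generated submodules. In their first two
    factors the elements of V_{n+2}^+ lie in one eigenspace of the Hecke operator
    ([submod_slots]), and the coproduct of two pencils with a well-chosen ratio
    of parameters vanishes there ([act2_kill]). An induction on the number of
    factors then shows that on V_s^+ the tower of a column equals a scalar times
    the single pencil of the s-th coproduct powers; the scalar cancels all
    denominators of the column but the last, l = s - 1 ([Vplus_fusion],
    [Vplus_tens_column]). On V_t^- the tower of a row retains only the
    denominator of j = 0 ([Vminus_fusion], [tens_Vminus_row]).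

    The product may be taken column by column or row by row, because factors in
    different rows and different columns commute ([prod_exchange]). Hence on
    V_s^+ ⊗ V_t^- the poles of R^{s|t} are among those with l = s - 1 and
    also among those with j = 0. As q is not a root of unity, the two lists share
    only (s - 1, 0), where z r^(s+1) = 1, that is b q^2 = a q^(-2s), and this
    pole is at most simple ([entry_poly]).

    The pole is there: between the row vector v_kappa^s ⊗ v_kappa ⊗ w_1^(t-1)
    and a vector of V_s^+ ⊗ V_t^-, all columns but the first act trivially
    and the first telescopes, which gives a nonzero multiple of
    (1 - z r) / (1 - z r^(s+1)) ([covec_Rst], [covec_wvec]). A polynomial that
    clears the denominators therefore vanishes at a point of the line
    b q^2 = a q^(-2s) other than the origin ([clears_vanish]); so its degree is
    at least 1, and a form of degree 1 with this zero is a multiple of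
    b q^2 - a q^(-2s). *)

(** * Signed tensor products of operators *)

Section SuperOperators.
Variable F : fieldType.
Implicit Types X Y : superspace.

Lemma sum_mxtens_index m n (f : 'I_(m * n) -> F) :
  \sum_k f k = \sum_i \sum_j f (mxtens_index (i, j)).
Proof.
rewrite pair_big (reindex (@mxtens_index m n)) /=.
  by apply: eq_bigr => -[].
exists (@mxtens_unindex m n) => k _; rewrite ?mxtens_indexK //.
exact: mxtens_unindexK.
Qed.

Lemma parity_stens X Y (i : 'I_(sdim X)) (j : 'I_(sdim Y)) :
  @parity (stens X Y) (mxtens_index (i, j)) = parity i (+) parity j.
Proof. by rewrite -[LHS]/(parity _ (+) parity _) mxtens_indexK. Qed.

(** Homogeneity of operators is used entrywise, so that 0 is homogeneous of both
    parities. *)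
Definition has_parity X (p : bool) (A : 'M[F]_(sdim X)) : Prop :=
  forall k l, A k l != 0 -> parity k (+) parity l = p.

(** The operator x |-> (-1)^(p |x|) x, which carries all Koszul signs. *)
Definition parity_mx X (p : bool) : 'M[F]_(sdim X) :=
  diag_mx (\row_k (-1) ^+ (p && parity k)).

Lemma has_parity0 X p : has_parity p (0 : 'M[F]_(sdim X)).
Proof. by move=> k l; rewrite mxE eqxx. Qed.

Lemma has_parity1 X : has_parity false (1%:M : 'M[F]_(sdim X)).
Proof. by move=> k l; rewrite mxE; case: (k =P l) => [-> _|_];
  rewrite ?addbb //= mulr0n eqxx. Qed.

Lemma has_parityD X p (A B : 'M[F]_(sdim X)) :
  has_parity p A -> has_parity p B -> has_parity p (A + B).
Proof.
move=> hA hB k l; rewrite mxE; have [->|/hA //] := eqVneq (A k l) 0.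
by rewrite add0r => /hB.
Qed.

Lemma has_parityZ X p c (A : 'M[F]_(sdim X)) : has_parity p A -> has_parity p (c *: A).
Proof.
move=> hA k l; rewrite mxE; have [->|/hA //] := eqVneq (A k l) 0.
by rewrite mulr0 eqxx.
Qed.

Lemma has_parity_sum X p (I : Type) (r : seq I) (P : pred I)
    (A : I -> 'M[F]_(sdim X)) :
  (forall i, P i -> has_parity p (A i)) -> has_parity p (\sum_(i <- r | P i) A i).
Proof.
by move=> hA; apply: big_ind => //; [exact: has_parity0 | exact: has_parityD].
Qed.

Lemma has_parity_delta X (i j : 'I_(sdim X)) :
  has_parity (parity i (+) parity j) (delta_mx i j : 'M[F]_(sdim X)).
Proof.
move=> k l; rewrite mxE.
by case: (k =P i) => [->|_]; case: (l =P j) => [->|_] //=; rewrite mulr0n eqxx.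
Qed.

Lemma parity_mxK X p : parity_mx X p *m parity_mx X p = 1%:M.
Proof.
rewrite mulmx_diag; apply/matrixP=> i j; rewrite !mxE.
by case: eqP => // _; rewrite -expr2 sqrr_sign.
Qed.

Lemma parity_mx0 X : parity_mx X false = 1%:M.
Proof. by apply/matrixP=> i j; rewrite !mxE. Qed.

Lemma tr_parity_mx X p : (parity_mx X p)^T = parity_mx X p.
Proof. by rewrite tr_diag_mx. Qed.

Lemma parity_mxC X p p' (A : 'M[F]_(sdim X)) : has_parity p' A ->
  parity_mx X p *m A = (-1) ^+ (p && p') *: (A *m parity_mx X p).
Proof.
move=> hA; apply/matrixP=> i j; rewrite mul_diag_mx mxE mul_mx_diag !mxE.
have [->|/hA <-] := eqVneq (A i j) 0; first by rewrite !(mulr0, mul0r).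
by rewrite [A i j * _]mulrC mulrA -signr_addb; case: p (parity i) (parity j) => [] [] [].
Qed.

(** The sign produced by moving B across the first factor depends only on the
    parity of the vector there, so it is an operator on the first factor; signed
    tensor products thereby reduce to unsigned ones. *)
Lemma sotensE X Y p (A : 'M[F]_(sdim X)) (B : 'M[F]_(sdim Y)) : has_parity p B ->
  sotens A B = tensmx (A *m parity_mx X p) B.
Proof.
move=> hB; apply/matrixP=> i j; rewrite [LHS]mxE mxE mul_mx_diag !mxE.
case: (mxtens_indexP i) => i1 i2; case: (mxtens_indexP j) => j1 j2.
rewrite !mxtens_indexK /=; have [->|/hB <-] := eqVneq (B i2 j2) 0.
  by rewrite !mulr0.
by congr (_ * _); rewrite mulrC.
Qed.

Lemma sotens_mul X Y p p' (A A' : 'M[F]_(sdim X)) (B B' : 'M[F]_(sdim Y)) :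
  has_parity p B -> has_parity p' A' ->
  sotens A B *m sotens A' B' = (-1) ^+ (p && p') *: sotens (A *m A') (B *m B').
Proof.
move=> hB hA'; apply/matrixP=> i j.
case: (mxtens_indexP i) => i1 i2; case: (mxtens_indexP j) => j1 j2.
rewrite (sotensE A hB) !mxE !mxtens_indexK.
transitivity (\sum_l \sum_m (A *m parity_mx X p) i1 l * B i2 m *
    ((-1) ^+ ((parity m (+) parity j2) && parity j1) * A' l j1 * B' m j2)).
  rewrite (@sum_mxtens_index (sdim X) (sdim Y)).
  by apply: eq_bigr => l _; apply: eq_bigr => m _;
    rewrite tensmxE [sotens _ _ _ _]mxE !mxtens_indexK.
transitivity (\sum_l \sum_m ((A i1 l * A' l j1) * (B i2 m * B' m j2) *
   (-1) ^+ ((p && p') (+) (parity i2 (+) parity j2) && parity j1))); last first.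
  rewrite !mxE !mulrA -signr_addb -mulrA mulrC.
  rewrite mulr_suml mulr_suml; apply: eq_bigr => l _.
  by rewrite mulr_sumr mulr_suml.
apply: eq_bigr => l _; apply: eq_bigr => m _; rewrite mul_mx_diag !mxE.
have [->|/hB hp] := eqVneq (B i2 m) 0; first by rewrite !(mulr0, mul0r).
have [->|/hA' hp'] := eqVneq (A' l j1) 0; first by rewrite !(mulr0, mul0r).
have -> : (-1) ^+ ((p && p') (+) (parity i2 (+) parity j2) && parity j1) =
  (-1) ^+ (p && parity l) * (-1) ^+ ((parity m (+) parity j2) && parity j1) :> F.
  rewrite -signr_addb -hp -hp'.
  by case: (parity l) (parity j1) (parity m) (parity j2) (parity i2) => [] [] [] [] [].
ring.
Qed.

Lemma has_parity_sotens X Y p p' (A : 'M[F]_(sdim X)) (B : 'M[F]_(sdim Y)) :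
  has_parity p A -> has_parity p' B -> @has_parity (stens X Y) (p (+) p') (sotens A B).
Proof.
move=> hA hB i j; rewrite (sotensE A hB).
case: (mxtens_indexP i) => i1 i2; case: (mxtens_indexP j) => j1 j2.
rewrite tensmxE mul_mx_diag !mxE !parity_stens.
have [->|/hA <-] := eqVneq (A i1 j1) 0; first by rewrite !mul0r eqxx.
have [->|/hB <- _] := eqVneq (B i2 j2) 0; first by rewrite mulr0 eqxx.
by rewrite addbACA.
Qed.

Lemma sotensDl X Y (A A' : 'M[F]_(sdim X)) (B : 'M[F]_(sdim Y)) :
  sotens (A + A') B = sotens A B + sotens A' B.
Proof.
apply/matrixP=> i j; rewrite !mxE.
case: (mxtens_unindex i) (mxtens_unindex j) => ? ? [] ? ?.
by rewrite mxE mulrDr mulrDl.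
Qed.

Lemma sotensDr X Y (A : 'M[F]_(sdim X)) (B B' : 'M[F]_(sdim Y)) :
  sotens A (B + B') = sotens A B + sotens A B'.
Proof.
apply/matrixP=> i j; rewrite !mxE.
case: (mxtens_unindex i) (mxtens_unindex j) => ? ? [] ? ?.
by rewrite mxE mulrDr.
Qed.

Lemma sotensZl X Y c (A : 'M[F]_(sdim X)) (B : 'M[F]_(sdim Y)) :
  sotens (c *: A) B = c *: sotens A B.
Proof.
apply/matrixP=> i j; rewrite !mxE.
case: (mxtens_unindex i) (mxtens_unindex j) => ? ? [] ? ?.
by rewrite mxE; ring.
Qed.

Lemma sotensZr X Y c (A : 'M[F]_(sdim X)) (B : 'M[F]_(sdim Y)) :
  sotens A (c *: B) = c *: sotens A B.
Proof.
apply/matrixP=> i j; rewrite !mxE.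
case: (mxtens_unindex i) (mxtens_unindex j) => ? ? [] ? ?.
by rewrite mxE; ring.
Qed.

Lemma sotens0l X Y (B : 'M[F]_(sdim Y)) : sotens (0 : 'M_(sdim X)) B = 0.
Proof. by rewrite -(scale0r 0) sotensZl scale0r. Qed.

Lemma sotens0r X Y (A : 'M[F]_(sdim X)) : sotens A (0 : 'M_(sdim Y)) = 0.
Proof. by rewrite -(scale0r 0) sotensZr scale0r. Qed.

Lemma sotens_suml X Y (I : Type) (r : seq I) (P : pred I)
    (A : I -> 'M[F]_(sdim X)) (B : 'M[F]_(sdim Y)) :
  sotens (\sum_(i <- r | P i) A i) B = \sum_(i <- r | P i) sotens (A i) B.
Proof.
by apply: (big_morph (fun A => sotens A B)) => [A1 A2|];
  rewrite ?sotensDl ?sotens0l.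
Qed.

Lemma sotens_sumr X Y (I : Type) (r : seq I) (P : pred I)
    (A : 'M[F]_(sdim X)) (B : I -> 'M[F]_(sdim Y)) :
  sotens A (\sum_(i <- r | P i) B i) = \sum_(i <- r | P i) sotens A (B i).
Proof.
by apply: (big_morph (sotens A)) => [B1 B2|]; rewrite ?sotensDr ?sotens0r.
Qed.

Lemma sotens11 X Y : sotens (1%:M : 'M[F]_(sdim X)) (1%:M : 'M_(sdim Y)) = 1%:M.
Proof.
rewrite (sotensE _ (@has_parity1 Y)) parity_mx0 mulmx1; apply/matrixP=> i j.
case: (mxtens_indexP i) => i1 i2; case: (mxtens_indexP j) => j1 j2.
rewrite tensmxE !mxE -natrM mulnb (can_eq (@mxtens_indexK _ _)).
by rewrite xpair_eqE.
Qed.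

Lemma has_parity_at_factor X n k p (A : 'M[F]_(sdim X)) :
  (k < n)%N -> has_parity p A -> has_parity p (at_factor n k A).
Proof.
move=> kn hA; elim: n k kn => [|n IHn] [|k] //= kn.
  by rewrite -[p]addbF; apply: has_parity_sotens => //; apply: has_parity1.
by rewrite -[p]addFb; apply: has_parity_sotens; [apply: has_parity1 | apply: IHn].
Qed.

Lemma at_factorD X n k (A B : 'M[F]_(sdim X)) : (k < n)%N ->
  at_factor n k (A + B) = at_factor n k A + at_factor n k B.
Proof.
elim: n k => [|n IHn] [|k] //= kn; first by rewrite sotensDl.
by rewrite IHn // sotensDr.
Qed.

Lemma at_factorZ X n k c (A : 'M[F]_(sdim X)) : (k < n)%N ->
  at_factor n k (c *: A) = c *: at_factor n k A.
Proof.
elim: n k => [|n IHn] [|k] //= kn; first by rewrite sotensZl.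
by rewrite IHn // sotensZr.
Qed.

Lemma at_factor_sum X n k (I : Type) (r : seq I) (P : pred I)
    (A : I -> 'M[F]_(sdim X)) : (k < n)%N ->
  at_factor n k (\sum_(i <- r | P i) A i) =
  \sum_(i <- r | P i) at_factor n k (A i).
Proof.
move=> kn; apply: (big_morph (at_factor n k)) => [B C|].
  exact: at_factorD.
by rewrite -(scale0r 0) at_factorZ // scale0r.
Qed.

Lemma at_factor1 X n k : at_factor n k (1%:M : 'M[F]_(sdim X)) = 1%:M.
Proof. by elim: n k => [|n IHn] [|k] //=; rewrite ?IHn sotens11. Qed.

(** With identities on the left the sign rule produces no sign, for inhomogeneous
    B as well: both sides are bilinear, and matrix units are homogeneous. *)
Lemma sotens1_mul X Y (B B' : 'M[F]_(sdim Y)) :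
  sotens (1%:M : 'M_(sdim X)) B *m sotens 1%:M B' = sotens 1%:M (B *m B').
Proof.
rewrite [B]matrix_sum_delta.
rewrite mulmx_suml !sotens_sumr mulmx_suml; apply: eq_bigr => i _.
rewrite mulmx_suml !sotens_sumr mulmx_suml; apply: eq_bigr => j _.
rewrite -scalemxAl !sotensZr -scalemxAl; congr (_ *: _).
by rewrite (sotens_mul _ _ (@has_parity_delta _ i j) (@has_parity1 X)) andbF
  scale1r mulmx1.
Qed.

Lemma sotens_mul1 X Y (A A' : 'M[F]_(sdim X)) :
  sotens A (1%:M : 'M_(sdim Y)) *m sotens A' 1%:M = sotens (A *m A') 1%:M.
Proof.
by rewrite !(sotensE _ (@has_parity1 Y)) tensmx_mul !parity_mx0 !mulmx1.
Qed.

Lemma at_factor_mul X n k (A B : 'M[F]_(sdim X)) :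
  at_factor n k (A *m B) = at_factor n k A *m at_factor n k B.
Proof.
elim: n k => [|n IHn] [|k] //=; rewrite ?mulmx1 //; first by rewrite sotens_mul1.
by rewrite IHn sotens1_mul.
Qed.

Lemma at_factor_comm X n k l p p' (A B : 'M[F]_(sdim X)) :
  (k < n)%N -> (l < n)%N -> k != l -> has_parity p A -> has_parity p' B ->
  at_factor n k A *m at_factor n l B =
  (-1) ^+ (p && p') *: (at_factor n l B *m at_factor n k A).
Proof.
move=> + + + hA hB; elim: n k l => [|n IHn] [|k] [|l] //= kn ln kl.
- rewrite (sotens_mul _ _ (@has_parity1 _) (@has_parity1 _)).
  rewrite (sotens_mul _ _ (@has_parity_at_factor _ n l _ _ ln hB) hA).
  rewrite !mul1mx !mulmx1 scalerA andbC.
  by rewrite -signr_addb addbb.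
- rewrite (sotens_mul _ _ (@has_parity_at_factor _ n k _ _ kn hA) hB).
  rewrite (sotens_mul _ _ (@has_parity1 _) (@has_parity1 _)).
  by rewrite !mul1mx !mulmx1 scale1r.
- by rewrite !sotens1_mul IHn // sotensZr.
Qed.

(** Subspaces are row spaces and operators act on rows through transposes, so the
    parity operator comes before A^T here and after A in [tens_sotens]. *)
Lemma tens_row_sotens X Y m m' p (U : 'M[F]_(m, sdim X)) (W : 'M[F]_(m', sdim Y))
    (A : 'M[F]_(sdim X)) (B : 'M[F]_(sdim Y)) : has_parity p B ->
  tensmx U W *m (sotens A B)^T =
  tensmx (U *m parity_mx X p *m A^T) (W *m B^T).
Proof.
by move=> hB; rewrite (sotensE _ hB) trmx_tens tensmx_mul trmx_mul tr_parity_mx mulmxA.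
Qed.

Lemma tens_sotens X Y m m' p (U : 'M[F]_(m, sdim X)) (W : 'M[F]_(m', sdim Y))
    (A : 'M[F]_(sdim X)) (B : 'M[F]_(sdim Y)) : has_parity p B ->
  tensmx U W *m sotens A B = tensmx (U *m A *m parity_mx X p) (W *m B).
Proof. by move=> hB; rewrite (sotensE _ hB) tensmx_mul mulmxA. Qed.

End SuperOperators.

(** * Fusion of pencils *)

Section Families.
Variables (F : fieldType) (M N : nat).
Local Notation I := 'I_(M + N).
Local Notation V := (spaceV M N).
Local Notation family := (Defs.family F M N).
Implicit Types X Y : superspace.

Definition has_parity_fam X (x : family X) : Prop :=
  forall i j, has_parity (ipar i (+) ipar j) (x i j).

(** Evaluated on V, the pencil of the families s and t is the L-operator of the
    quantum affine superalgebra with spectral parameter z. *)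
Definition pencil X (z : F) (x y : family X) : family X :=
  fun i j => x i j - z *: y i j.

Definition counit : family sunit := fun i j => (i == j)%:R%:M.

Lemma has_parity_pencil X z (x y : family X) :
  has_parity_fam x -> has_parity_fam y -> has_parity_fam (pencil z x y).
Proof.
by move=> hx hy i j; apply: has_parityD => //; rewrite -scaleNr; apply: has_parityZ.
Qed.

Lemma has_parity_coprod X Y (x : family X) (y : family Y) :
  has_parity_fam x -> has_parity_fam y -> has_parity_fam (coprod x y).
Proof.
move=> hx hy i j; apply: has_parity_sum => k _; apply: has_parityZ.
have -> : ipar i (+) ipar j = (ipar i (+) ipar k) (+) (ipar k (+) ipar j).
  by rewrite addbA addbK.
exact: has_parity_sotens.
Qed.

Lemma has_parity_counit : has_parity_fam counit.
Proof.
move=> i j; rewrite /counit; have [->|_] := eqVneq i j.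
  by rewrite addbb; apply: has_parity1.
by rewrite mulr0n raddf0; apply: has_parity0.
Qed.

Lemma has_parity_powfam X (x : family X) n :
  has_parity_fam x -> has_parity_fam (powfam x n).
Proof.
move=> hx; elim: n => [|n IHn]; first exact: has_parity_counit.
exact: has_parity_coprod.
Qed.

Lemma coprod_pencill X Y z (x y : family X) (w : family Y) i j :
  coprod (pencil z x y) w i j = coprod x w i j - z *: coprod y w i j.
Proof.
rewrite /coprod scaler_sumr -sumrB; apply: eq_bigr => k _.
by rewrite /pencil sotensDl -scaleNr sotensZl scalerDr !scalerA mulrN scaleNr mulrC.
Qed.

Lemma coprod_pencilr X Y z (x y : family Y) (w : family X) i j :
  coprod w (pencil z x y) i j = coprod w x i j - z *: coprod w y i j.
Proof.
rewrite /coprod scaler_sumr -sumrB; apply: eq_bigr => k _.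
by rewrite /pencil sotensDr -scaleNr sotensZr scalerDr !scalerA mulrN scaleNr mulrC.
Qed.

(** The second tensor factor of a coproduct can be modified off the subspace on
    which it acts; this is how a tower is simplified from its right end. *)
Lemma coprod_congr X Y m (U : 'M[F]_(m, sdim Y)) (x : family X) (w w' : family Y) :
  has_parity_fam w -> has_parity_fam w' ->
  (forall k j, U *m (w k j)^T = U *m (w' k j)^T) ->
  forall i j, tensmx (1%:M : 'M_(sdim X)) U *m (coprod x w i j)^T =
              tensmx 1%:M U *m (coprod x w' i j)^T.
Proof.
move=> hw hw' ww' i j; rewrite /coprod !(raddf_sum trmx) !mulmx_sumr /=.
apply: eq_bigr => k _; rewrite ![(_ *: _)^T]linearZ /= -!scalemxAr; congr (_ *: _).
by rewrite (tens_row_sotens _ _ _ (hw k j)) (tens_row_sotens _ _ _ (hw' k j)) ww'.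
Qed.

(** The coefficients of a monodromy matrix: the iterated coproduct of the pencils
    with parameters z, z r, z r^2, and so on. *)
Fixpoint tower X (x y : family X) (r : F) n (z : F) : family (spow X n) :=
  match n return family (spow X n) with
  | 0 => counit
  | n'.+1 => coprod (pencil z x y) (tower x y r n' (z * r))
  end.

Lemma has_parity_tower X (x y : family X) r n z :
  has_parity_fam x -> has_parity_fam y -> has_parity_fam (tower x y r n z).
Proof.
move=> hx hy; elim: n z => [|n IHn] z; first exact: has_parity_counit.
by apply: has_parity_coprod => //; apply: has_parity_pencil.
Qed.

(** Two properties of a sequence U of subspaces of the tensor powers of X imply
    fusion. Each U_{n+1} lies in X ⊗ U_n, and in the first two factors the
    pencils with parameters al and be annihilate it. For the submodules at hand
    the powers of q^2 are such that al = 1 or be = 1. *)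
Section Fusion.
Variables (X : superspace) (x y : family X) (al be : F).
Variable U : forall n, 'M[F]_(sdim (spow X n)).
Hypothesis hx : has_parity_fam x.
Hypothesis hy : has_parity_fam y.
Hypothesis al_be : al != be.
Hypothesis slice : forall n, (U n.+1 <= tensmx (1%:M : 'M_(sdim X)) (U n))%MS.
Hypothesis slot : forall n (w : family (spow X n)), has_parity_fam w ->
  forall i j, U n.+2 *m
    (coprod (pencil al x y) (coprod (pencil be x y) w) i j)^T = 0.

Lemma coprod_congrS n (x0 : family X) (w w' : family (spow X n)) :
  has_parity_fam w -> has_parity_fam w' ->
  (forall k j, U n *m (w k j)^T = U n *m (w' k j)^T) ->
  forall i j, U n.+1 *m (coprod x0 w i j)^T = U n.+1 *m (coprod x0 w' i j)^T.
Proof.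
move=> hw hw' ww' i j; case/submxP: (slice n) => D ->.
by rewrite -!mulmxA (coprod_congr x0 hw hw' ww').
Qed.

(** The rank-two annihilation propagates to any number of factors. With E the pencil
    on the right, the induction hypothesis gives x ⊗ E = al y ⊗ E on U, and the
    hypothesis [slot] gives x ⊗ E = be y ⊗ E; hence y ⊗ E = 0, as al and be
    differ. *)
Lemma fusion_kill n i j :
  U n.+1 *m (coprod (pencil al x y)
               (pencil (be ^+ n) (powfam x n) (powfam y n)) i j)^T = 0.
Proof.
have hX k := @has_parity_powfam _ x k hx; have hY k := @has_parity_powfam _ y k hy.
elim: n i j => [|n IHn] i j.
  rewrite coprod_pencilr expr0 scale1r /=.
  by rewrite subrr trmx0 mulmx0.
set x0 := pencil al x y; pose E := pencil (be ^+ n) (powfam x n) (powfam y n).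
have hE : has_parity_fam E by exact: has_parity_pencil.
have hx0 : has_parity_fam x0 by exact: has_parity_pencil.
pose f w := U n.+2 *m (coprod x0 w i j)^T.
have fP z (w w' : family (spow X n.+1)) : f (pencil z w w') = f w - z *: f w'.
  by rewrite /f coprod_pencilr linearB linearZ /= mulmxBr -scalemxAr.
have f0 w : has_parity_fam w ->
    f (coprod (pencil be x y) w) = 0 by move=> hw; exact: slot.
have f1 : f (coprod x0 E) = 0.
  rewrite /f (@coprod_congrS _ _ _ (fun i j => 0)) ?IHn //.
  - rewrite (_ : coprod _ _ i j = 0) ?trmx0 ?mulmx0 //.
    by rewrite /coprod big1 // => k _; rewrite sotens0r scaler0.
  - exact: has_parity_coprod.
  - by move=> k l; apply: has_parity0.
  - by move=> k l; rewrite IHn trmx0 mulmx0.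
have fE z (w : family (spow X n)) : f (coprod (pencil z x y) w) =
    f (coprod x w) - z *: f (coprod y w).
  rewrite -fP /f; congr (_ *m _^T); apply: eq_bigr => k _; congr (_ *: sotens _ _).
  by rewrite coprod_pencill.
have xE : f (coprod x E) = be *: f (coprod y E).
  by apply/eqP; rewrite -subr_eq0 -fE f0.
have yE : f (coprod y E) = 0.
  move: f1; rewrite fE xE -scalerBl => /eqP; rewrite scaler_eq0 subr_eq0.
  by rewrite eq_sym (negPf al_be) => /eqP.
(* Up to terms killed by [slot], the pencil with parameter be^(n+1) splits as
   (x - be y) ⊗ x_n + be y ⊗ (x_n - be^n y_n). *)
have -> : U n.+2 *m (coprod x0 (pencil (be ^+ n.+1) (powfam x n.+1)
    (powfam y n.+1)) i j)^T = f (coprod (pencil be x y) (powfam x n)) +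
    be *: f (coprod y E).
  rewrite fE -[LHS]/(f _) fP /= exprS.
  have -> : f (coprod y E) = f (coprod y (powfam x n)) - be ^+ n *: f
    (coprod y (powfam y n)).
    rewrite -fP /f; congr (_ *m _^T); apply: eq_bigr => k _; congr (_ *: sotens _ _).
    by rewrite coprod_pencilr.
  by rewrite scalerBr scalerA addrA subrK.
by rewrite yE scaler0 addr0 f0.
Qed.

(** Each application of [fusion_kill] turns a product of two pencils into a single
    one times a scalar: with X, Y the coproduct powers and b = be^(n+1),
    (x - z y) ⊗ (X - z b Y) - (1 - z) (x ⊗ X - z b y ⊗ Y) =
    z (x - y) ⊗ (X - b Y). Of the parameters of the tower only the last one is
    left in the pencil. *)
Lemma fusion_last n z i j : al = 1 ->
  U n.+1 *m (tower x y be n.+1 z i j)^T =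
  \prod_(k < n) (1 - z * be ^+ k) *:
    (U n.+1 *m (pencil (z * be ^+ n) (powfam x n.+1) (powfam y n.+1) i j)^T).
Proof.
move=> al1; elim: n z i j => [|n IHn] z i j.
  by rewrite big_ord0 scale1r expr0 mulr1 /= coprod_pencill.
have hX k := @has_parity_powfam _ x k hx; have hY k := @has_parity_powfam _ y k hy.
pose c := \prod_(k < n) (1 - z * be * be ^+ k).
pose P := pencil (z * be * be ^+ n) (powfam x n.+1) (powfam y n.+1).
rewrite -[tower _ _ _ _ _]/(coprod (pencil z x y) (tower x y be n.+1 (z * be))).
rewrite (@coprod_congrS _ _ _ (fun i j => c *: P i j)); first last.
- by move=> k l; rewrite IHn linearZ /= -scalemxAr.
- by move=> k l; apply: has_parityZ; apply: has_parity_pencil.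
- exact: has_parity_tower.
have -> : coprod (pencil z x y) (fun i j => c *: P i j) i j =
    c *: coprod (pencil z x y) P i j.
  rewrite /coprod scaler_sumr; apply: eq_bigr => k _.
  by rewrite sotensZr !scalerA mulrC.
rewrite linearZ /= -scalemxAr big_ord_recl expr0 mulr1 mulrC -scalerA.
have -> : \prod_(k < n) (1 - z * be ^+ lift ord0 k) = c.
  by apply: eq_bigr => k _; rewrite lift0 exprS mulrA.
congr (_ *: _); have := fusion_kill n.+1 i j.
rewrite al1 /P !coprod_pencilr !coprod_pencill.
rewrite /pencil -mulrA -exprS scale1r.
set b := be ^+ n.+1; set A := coprod x (powfam x _) i j;
  set B := coprod x (powfam y _) i j.
set C := coprod y (powfam x _) i j; set D := coprod y (powfam y _) i j.
clearbody A B C D b; move=> h.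
apply/eqP; rewrite -subr_eq0; apply/eqP.
rewrite scalemxAr -mulmxBr -linearZ -linearB /=.
rewrite (_ : _ - _ = z *: (A - C - b *: (B - 1 *: D))).
  by rewrite linearZ /= -scalemxAr h scaler0.
by apply/matrixP=> ? ?; rewrite !mxE; ring.
Qed.

(** The mirror image of [fusion_last], from
    (x - z y) ⊗ (X - z r Y) - (1 - z r) (x ⊗ X - z y ⊗ Y) =
    z r (x - al y) ⊗ (X - Y): only the first parameter is left in the pencil. *)
Lemma fusion_first r n z i j : al * r = 1 -> be = 1 ->
  U n.+1 *m (tower x y r n.+1 z i j)^T =
  \prod_(k < n) (1 - z * r ^+ k.+1) *:
    (U n.+1 *m (pencil z (powfam x n.+1) (powfam y n.+1) i j)^T).
Proof.
move=> al1 be1; elim: n z i j => [|n IHn] z i j.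
  by rewrite big_ord0 scale1r /= coprod_pencill.
have hX k := @has_parity_powfam _ x k hx; have hY k := @has_parity_powfam _ y k hy.
pose c := \prod_(k < n) (1 - z * r * r ^+ k.+1).
pose P := pencil (z * r) (powfam x n.+1) (powfam y n.+1).
rewrite -[tower _ _ _ _ _]/(coprod (pencil z x y) (tower x y r n.+1 (z * r))).
rewrite (@coprod_congrS _ _ _ (fun i j => c *: P i j)); first last.
- by move=> k l; rewrite IHn linearZ /= -scalemxAr.
- by move=> k l; apply: has_parityZ; apply: has_parity_pencil.
- exact: has_parity_tower.
have -> : coprod (pencil z x y) (fun i j => c *: P i j) i j =
    c *: coprod (pencil z x y) P i j.
  rewrite /coprod scaler_sumr; apply: eq_bigr => k _.
  by rewrite sotensZr !scalerA mulrC.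
rewrite linearZ /= -scalemxAr big_ord_recl expr1 mulrC -scalerA.
have -> : \prod_(k < n) (1 - z * r ^+ (lift ord0 k).+1) = c.
  by apply: eq_bigr => k _; rewrite lift0 exprS mulrA.
congr (_ *: _); have := fusion_kill n.+1 i j.
rewrite be1 expr1n /P !coprod_pencilr !coprod_pencill.
rewrite /pencil !scale1r.
set A := coprod x (powfam x _) i j; set B := coprod x (powfam y _) i j.
set C := coprod y (powfam x _) i j; set D := coprod y (powfam y _) i j.
clearbody A B C D; move=> h.
apply/eqP; rewrite -subr_eq0; apply/eqP.
rewrite scalemxAr -mulmxBr -linearZ -linearB /=.
rewrite (_ : _ - _ = (z * r) *: (A - al *: C - (B - al *: D))).
  by rewrite linearZ /= -scalemxAr h scaler0.
apply/matrixP=> u v; rewrite !mxE.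
transitivity (z * r * A u v - al * r * z * C u v - z * r * B u v +
  al * r * z * D u v); last by ring.
by rewrite al1; ring.
Qed.

End Fusion.
End Families.

(** * The Hecke eigenspaces in V ⊗ V *)

Section TwoSlots.
Variables (F : fieldType) (M N : nat) (q : F).
Local Notation I := 'I_(M + N).
Local Notation V := (spaceV M N).
Local Notation family := (Defs.family F M N).
Hypothesis q0 : q != 0.

(** A common form for s, t and their pencils on V: diagonal operators for i = j,
    multiples of a matrix unit otherwise. *)
Definition tri_fam (D g : I -> I -> F) : family V := fun i j =>
  if i == j then diag_mx (\row_a D i a) else g i j *: delta_mx i j.

Lemma has_parity_tri_fam D g : has_parity_fam (tri_fam D g).
Proof.
move=> i j; rewrite /tri_fam; have [->|_] := eqVneq i j; last first.
  by apply: has_parityZ; exact: (@has_parity_delta F V).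
move=> a b; rewrite !mxE addbb; have [->|_] := eqVneq a b; first by rewrite addbb.
by rewrite mulr0n eqxx.
Qed.

Definition diag_s (i a : I) : F := if a == i then qi q i else 1.
Definition diag_t (i a : I) : F := if a == i then (qi q i)^-1 else 1.
Definition qdiff (i : I) : F := qi q i - (qi q i)^-1.
Definition off_s (i j : I) : F := if (i < j)%N then qdiff i else 0.
Definition off_t (i j : I) : F := if (j < i)%N then - qdiff j else 0.

Lemma qi_neq0 (i : I) : qi q i != 0.
Proof. by rewrite /qi; case: ifP; rewrite ?invr_eq0. Qed.

Lemma sVE i j : sV q i j = tri_fam diag_s off_s i j.
Proof.
rewrite /sV /tri_fam /off_s; have [->|ij] := eqVneq i j; last first.
  by case: ifP => // _; rewrite scale0r.
rewrite ltnn; apply/matrixP=> a b; rewrite !mxE summxE.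
rewrite (eq_bigr (fun k => (a == k)%:R * (b == k)%:R)); last first.
  by move=> k _; rewrite mxE -natrM mulnb.
have [->|nab] := eqVneq a b; last first.
  rewrite mulr0n big1 ?addr0.
    by case: (a =P j) nab => [->|]; rewrite ?andbF ?mulr0 // eq_sym => /negPf->;
      rewrite mulr0.
  by move=> k _; case: (a =P k) nab => [->|];
    rewrite ?mul0r // eq_sym => /negPf->; rewrite mulr0.
rewrite mulr1n /diag_s andbb; have [->|bj] := eqVneq b j.
  rewrite mulr1 big1 ?addr0 // => k /negPf; rewrite eq_sym => ->.
  by rewrite mul0r.
rewrite mulr0 add0r (bigD1 b) //= eqxx mulr1 big1 ?addr0 // => k /andP[_ /negPf].
by rewrite eq_sym => ->; rewrite mul0r.
Qed.

Lemma tVE i j : tV q i j = tri_fam diag_t off_t i j.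
Proof.
rewrite /tV /off_t /tri_fam; have [->|ij] := eqVneq i j; last first.
  by case: ifP => // _; rewrite scale0r.
rewrite ltnn sVE /tri_fam eqxx; set A := diag_mx _; set B := diag_mx _.
have AB : A *m B = 1%:M.
  rewrite mulmx_diag; apply/matrixP=> a b; rewrite !mxE /diag_s /diag_t.
  by case: (a == j); rewrite ?mulr1 // mulfV // qi_neq0.
by rewrite -[B]mul1mx -[in RHS](mulVmx (proj1 (mulmx1_unit AB))) -mulmxA AB mulmx1.
Qed.

(** The (i, j) entry of the coproduct of x and y acting on V ⊗ V, written on the
    coordinates tau a b of a tensor. *)
Definition act2 (x y : family V) (i j : I) (tau : I -> I -> F) (a b : I) : F :=
  \sum_k (-1) ^+ ((ipar i (+) ipar k) && (ipar k (+) ipar j)) *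
    \sum_a' x i k a a' * ((-1) ^+ ((ipar k (+) ipar j) && ipar a') *
      \sum_b' y k j b b' * tau a' b').

Lemma tri_fam_row D g i k a (f : I -> F) :
  \sum_a' tri_fam D g i k a a' * f a' =
  if i == k then D i a * f a else if a == i then g i k * f k else 0.
Proof.
rewrite /tri_fam; case: ifP => _.
  rewrite (bigD1 a) //= !mxE eqxx mulr1n big1 ?addr0 // => b /negPf ba.
  by rewrite !mxE eq_sym ba mulr0n mul0r.
rewrite (bigD1 k) //= !mxE eqxx andbT big1 ?addr0 => [|b /negPf bk].
  by case: ifP; rewrite ?mulr1 // mulr0 mul0r.
by rewrite !mxE bk andbF mulr0 mul0r.
Qed.

(** In the sum over the intermediate index k only k = i, k = j and k = b can
    contribute. *)
Lemma act2_offdiag D g D' g' i j tau a b : i != j ->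
  act2 (tri_fam D g) (tri_fam D' g') i j tau a b =
    (if b == i then (-1) ^+ ((ipar i (+) ipar j) && ipar a) * D i a * g' i j * tau a j
     else 0) +
    (if a == i then g i j * D' j b * tau j b +
       (if (b != i) && (b != j) then
         (-1) ^+ ((ipar b (+) ipar j) && ipar i) * g i b * g' b j * tau b j
        else 0)
     else 0).
Proof.
move=> ij; rewrite /act2.
under eq_bigr do under eq_bigr do rewrite tri_fam_row.
under eq_bigr do rewrite tri_fam_row.
rewrite (bigD1 i) //= eqxx addbb /= mul1r (negPf ij); congr (_ + _).
  by case: eqP => _; [ring | rewrite !mulr0].
have ji : j != i by rewrite eq_sym.
rewrite (bigD1 j) //= (negPf ij) addbb andbF /= eqxx mul1r.
have [->|ai] := eqVneq a i; last first.
  rewrite add0r big1 // => k /andP[/negPf ki _].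
  by rewrite eq_sym ki mulr0.
congr (_ + _); first by ring.
have [/andP[bi bj]|] := boolP (_ && _); last first.
  move=> h; rewrite big1 // => k /andP[ki kj]; rewrite eq_sym (negPf ki) (negPf kj).
  have -> : (b == k) = false by apply/negP=> /eqP bk; rewrite bk ki kj in h.
  by rewrite !mulr0.
rewrite (bigD1 b) ?bi //= eq_sym (negPf bi) (negPf bj) eqxx big1 =>
  [|k /andP[/andP[ki kj] kb]].
  rewrite addr0.
  by case: (ipar i) (ipar j) (ipar b) => [] [] [] /=; rewrite ?(expr0, expr1); ring.
by rewrite eq_sym (negPf ki) (negPf kj) eq_sym (negPf kb) !mulr0.
Qed.

Lemma act2_diag D g D' g' i tau a b :
  act2 (tri_fam D g) (tri_fam D' g') i i tau a b =
    D i a * D' i b * tau a b +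
    (if (a == i) && (b != i) then
       (-1) ^+ ((ipar b (+) ipar i) && ipar i) * g i b * g' b i * tau b i
     else 0).
Proof.
rewrite /act2.
under eq_bigr do under eq_bigr do rewrite tri_fam_row.
under eq_bigr do rewrite tri_fam_row.
rewrite (bigD1 i) //= eqxx addbb /= !mul1r mulrA; congr (_ + _).
have [->|ai] := eqVneq a i; last first.
  by rewrite big1 // => k /negPf ki; rewrite eq_sym ki mulr0.
have [bi|bi] := eqVneq b i => /=.
  rewrite big1 // => k ki; rewrite eq_sym (negPf ki) bi eq_sym (negPf ki).
  by rewrite !mulr0.
rewrite (bigD1 b) ?bi //= eq_sym (negPf bi) eqxx big1 => [|k /andP[ki kb]].
  rewrite addr0.
  by case: (ipar i) (ipar b) => [] [] /=; rewrite ?(expr0, expr1); ring.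
by rewrite eq_sym (negPf ki) eq_sym (negPf kb) !mulr0.
Qed.

(** The eigenspace for la of the operator T on V ⊗ V with
    T (e_a ⊗ e_b) = -(-1)^(|a||b|) e_b ⊗ e_a for a < b and
    (T - q) (T + q^-1) = 0. On e_a ⊗ e_a the operator T is q for odd a and
    -q^-1 for even a. The two values of la give the two q-analogues of symmetric and
    exterior squares. *)
Definition qrel (la : F) (tau : I -> I -> F) : Prop :=
  (forall a b : I, (a < b)%N ->
     tau b a = - (-1) ^+ (ipar a && ipar b) * la * tau a b) /\
  (forall a, ((if ipar a then q else - q^-1) - la) * tau a a = 0).

Variable la : F.
Hypothesis hla : (la == q) || (la == - q^-1).

Lemma ipar_lt (i j : I) : (i < j)%N -> ipar i -> ipar j.
Proof. by rewrite /ipar => ij /leq_trans; apply; exact: ltnW. Qed.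

Lemma qrel_ext (tau tau' : I -> I -> F) :
  (forall a b, tau a b = tau' a b) -> qrel la tau' -> qrel la tau.
Proof. by move=> e [R1 R2]; split=> [a b ab|a]; rewrite !e ?R2 ?(R1 a b). Qed.

Lemma qrel_parity (c : bool -> F) (tau : I -> I -> F) :
  qrel la tau -> qrel la (fun a b => c (ipar a (+) ipar b) * tau a b).
Proof.
case=> R1 R2; split=> [a b ab|a]; first by rewrite (R1 a b) // addbC mulrCA.
by rewrite mulrCA R2 mulr0.
Qed.

Lemma qrel_sum (K : Type) (r : seq K) (P : pred K) (tau : K -> I -> I -> F) :
  (forall k, P k -> qrel la (tau k)) ->
  qrel la (fun a b => \sum_(k <- r | P k) tau k a b).
Proof.
move=> h; split=> [a b ab|a]; rewrite mulr_sumr.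
  by apply: eq_bigr => k /h[R1 _]; rewrite (R1 a b).
by rewrite big1 // => k /h[_ R2].
Qed.

Lemma qrel_diag (D : I -> F) tau : qrel la tau ->
  qrel la (fun a b => D a * D b * tau a b).
Proof.
case=> R1 R2; split=> [a b ab|a]; last by rewrite mulrCA R2 mulr0.
by rewrite (R1 a b) // [D b * _]mulrC mulrCA.
Qed.

Lemma qrel0 : qrel la (fun _ _ => 0).
Proof. by split=> *; rewrite mulr0. Qed.

Lemma lin_cert (k z u v : F) : z = 0 -> u - v = k * z -> u = v.
Proof. by move=> -> /eqP; rewrite mulr0 subr_eq0 => /eqP. Qed.

Ltac parity_simp := rewrite ?(expr0, expr1, sqrrN, exprVn, invrK).
Ltac parity_field := parity_simp; first [by field | by ring].
(* Certificates for identities which hold modulo the diagonal relation h of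
   [qrel]: the cofactor of h is one of a few multiples of q - q^-1. *)
Ltac parity_cert h := parity_simp; first [by field | by ring
  | by apply: (lin_cert (k := q - q^-1) h); field
  | by apply: (lin_cert (k := (q - q^-1) * (q ^+ 2 - 1)) h); field
  | by apply: (lin_cert (k := - (q - q^-1) * (q ^+ 2 - 1)) h); field
  | by apply: (lin_cert (k := (q - q^-1) * (1 - q ^- 2)) h); field
  | by apply: (lin_cert (k := - (q - q^-1) * (1 - q ^- 2)) h); field
  | by apply: (lin_cert (k := - (q - q^-1)) h); field
  | by apply: (lin_cert (k := (q - q^-1) * q^-1) h); field
  | by apply: (lin_cert (k := - (q - q^-1) * q^-1) h); field
  | by apply: (lin_cert (k := (q - q^-1) * q) h); field
  | by apply: (lin_cert (k := - (q - q^-1) * q) h); field].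
(* Parities increase with the index, which excludes most sign patterns. *)
Ltac bad_parity := match goal with
  | h : is_true true -> is_true false |- _ => by have := h isT
  end.

(** The operator T commutes with the coproduct, so its eigenspaces are stable. Both
    sides of the relations have few terms, and the identities are checked for each
    order of the indices and each pattern of parities. *)
Lemma qrel_act2_s i j tau : qrel la tau -> qrel la
  (act2 (tri_fam diag_s off_s) (tri_fam diag_s off_s) i j tau).
Proof.
move=> R; have [<-|ij] := eqVneq i j.
  apply: qrel_ext (qrel_diag (diag_s i) R) => a b; rewrite act2_diag /off_s.
  by case: ifP => _; rewrite ?addr0 //; case: ltngtP; rewrite !(mulr0, mul0r) addr0.
case: (ltngtP i j) => [lij|lji|eij]; last first.
- by rewrite (ord_inj eij) eqxx in ij.
- apply: qrel_ext qrel0 => a b; rewrite act2_offdiag // /off_s.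
  rewrite [(i < j)%N]ltnNge (ltnW lji) /= !(mulr0, mul0r) if_same add0r.
  case: ifP => // _; rewrite add0r; case: ifP => // _.
  case: (ltnP i b) => [ib|]; last by rewrite !(mulr0, mul0r).
  by rewrite [(b < j)%N]ltnNge (ltnW (ltn_trans lji ib)) !(mulr0, mul0r).
case: R => R1 R2.
have pij : (ipar i ==> ipar j) by apply/implyP; exact: ipar_lt lij.
have qE k : qi q k = if ipar k then q^-1 else q by [].
have eF (k l : I) : (k < l)%N -> (k == l = false) * (l == k = false) *
  ((l < k)%N = false).
  move=> kl; have kl' : k == l = false by rewrite -val_eqE ltn_eqF.
  by rewrite [l == k]eq_sym kl' ltnNge (ltnW kl).
split=> [a b ab|a]; rewrite !act2_offdiag // /off_s /diag_s /qdiff !qE lij.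
  have [ai|ai] := eqVneq a i.
    subst a; rewrite ab (eF i b ab) /= addr0 add0r.
    have := ipar_lt ab.
    case: (ltngtP b j) => [lbj|ljb|ebj].
    - rewrite (R1 b j lbj) (eF b j lbj) /=; have := ipar_lt lbj.
      case: (ipar i) (ipar b) (ipar j) pij => [] [] [] //= _ h1 h2; try bad_parity;
      case/orP: hla => /eqP->; parity_field.
    - rewrite (R1 j b ljb) (eF j b ljb) /=; have := ipar_lt ljb.
      case: (ipar i) (ipar b) (ipar j) pij => [] [] [] //= _ h1 h2; try bad_parity;
      case/orP: hla => /eqP->; parity_field.
    - have {}ebj : b = j by apply: ord_inj.
      subst b; rewrite eqxx /= => h1.
      have := R2 j.
      case: (ipar i) (ipar j) pij h1 => [] [] //= _ h1; try bad_parity;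
      case/orP: hla => /eqP-> h; parity_cert h.
  have [bi|bi] := eqVneq b i; last by rewrite !addr0 mulr0.
  subst b; rewrite [(i < a)%N]ltnNge (ltnW ab) /= (eF a j (ltn_trans ab lij)).
  rewrite (R1 a j (ltn_trans ab lij)); have := ipar_lt ab.
  rewrite ?(mulr0, mul0r, addr0, add0r, if_same).
  case: (ipar i) (ipar a) (ipar j) pij => [] [] [] //= _ h1; try bad_parity;
  case/orP: hla => /eqP->; parity_field.
have [ai|] := eqVneq a i; last by rewrite addr0 mulr0.
subst a; rewrite /= addr0 (R1 i j lij) (eF i j lij).
case: (ipar i) (ipar j) pij => [] [] //= _; case/orP: hla => /eqP->; parity_field.
Qed.

Lemma qrel_act2_t i j tau : qrel la tau -> qrel la
  (act2 (tri_fam diag_t off_t) (tri_fam diag_t off_t) i j tau).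
Proof.
move=> R; have [<-|ij] := eqVneq i j.
  apply: qrel_ext (qrel_diag (diag_t i) R) => a b; rewrite act2_diag /off_t.
  by case: ifP => _; rewrite ?addr0 //; case: ltngtP; rewrite !(mulr0, mul0r) addr0.
case: (ltngtP j i) => [lji|lij|eij]; last first.
- by rewrite (ord_inj eij) eqxx in ij.
- apply: qrel_ext qrel0 => a b; rewrite act2_offdiag // /off_t.
  rewrite [(j < i)%N]ltnNge (ltnW lij) /= !(mulr0, mul0r) if_same add0r.
  case: ifP => // _; rewrite add0r; case: ifP => // _.
  case: (ltnP b i) => [ib|]; last by rewrite !(mulr0, mul0r).
  by rewrite [(j < b)%N]ltnNge (ltnW (ltn_trans ib lij)) !(mulr0, mul0r).
case: R => R1 R2.
have pij : (ipar j ==> ipar i) by apply/implyP; exact: ipar_lt lji.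
have qE k : qi q k = if ipar k then q^-1 else q by [].
have eF (k l : I) : (k < l)%N -> (k == l = false) * (l == k = false) *
  ((l < k)%N = false).
  move=> kl; have kl' : k == l = false by rewrite -val_eqE ltn_eqF.
  by rewrite [l == k]eq_sym kl' ltnNge (ltnW kl).
split=> [a b ab|a]; rewrite !act2_offdiag // /off_t /diag_t /qdiff !qE lji.
  have [bi|bi] := eqVneq b i.
    subst b; rewrite ab (eF a i ab) /= !addr0 ?add0r.
    have := ipar_lt ab.
    case: (ltngtP a j) => [laj|lja|eaj].
    - rewrite (R1 a j laj) (eF a j laj) /=; have := ipar_lt laj.
      case: (ipar i) (ipar a) (ipar j) pij => [] [] [] //= _ h1 h2; try bad_parity;
      case/orP: hla => /eqP->; parity_field.
    - rewrite (R1 j a lja) (eF j a lja) /=; have := ipar_lt lja.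
      case: (ipar i) (ipar a) (ipar j) pij => [] [] [] //= _ h1 h2; try bad_parity;
      case/orP: hla => /eqP->; parity_field.
    - have {}eaj : a = j by apply: ord_inj.
      subst a; rewrite eqxx /= => h1.
      have := R2 j.
      case: (ipar i) (ipar j) pij h1 => [] [] //= _ h1; try bad_parity;
      case/orP: hla => /eqP-> h; parity_cert h.
  have [ai|ai] := eqVneq a i; last by rewrite !addr0 mulr0.
  subst a; rewrite [(b < i)%N]ltnNge (ltnW ab) /= (eF j b (ltn_trans lji ab)).
  rewrite (R1 j b (ltn_trans lji ab)); have := ipar_lt ab.
  rewrite ?(mulr0, mul0r, addr0, add0r, if_same).
  case: (ipar i) (ipar b) (ipar j) pij => [] [] [] //= _ h1; try bad_parity;
  case/orP: hla => /eqP->; parity_field.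
have [ai|] := eqVneq a i; last by rewrite addr0 mulr0.
subst a; rewrite /= addr0 (R1 j i lji) (eF j i lji).
case: (ipar i) (ipar j) pij => [] [] //= _; case/orP: hla => /eqP->; parity_field.
Qed.

Lemma pencil_tri_fam z D g D' g' i j :
  pencil z (tri_fam D g) (tri_fam D' g') i j =
  tri_fam (fun i a => D i a - z * D' i a) (fun i j => g i j - z * g' i j) i j.
Proof.
rewrite /pencil /tri_fam; case: ifP => _.
  apply/matrixP=> a b; rewrite !mxE; case: (a == b); first by rewrite mulr1n.
  by rewrite !mulr0n mulr0 subr0.
by rewrite scalerA scalerBl.
Qed.

Lemma act2_ext (x x' y y' : family V) i j tau :
  (forall i j, x i j = x' i j) -> (forall i j, y i j = y' i j) ->
  forall a b, act2 x y i j tau a b = act2 x' y' i j tau a b.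
Proof.
move=> xx yy a b; rewrite /act2; apply: eq_bigr => k _.
by rewrite xx yy.
Qed.

(** Up to transposition in the auxiliary space, the pencil at z = 1 is a multiple of
    the graded permutation of that space with the first factor. So the coproduct of
    the two pencils is an R-matrix between both factors, followed by a permutation.
    At the ratio la^-2 of the parameters this R-matrix is proportional to T - la, up
    to another permutation, and kills the eigenspace of T for la. *)
Lemma act2_kill i j tau a b : qrel la tau ->
  act2 (pencil 1 (tri_fam diag_s off_s) (tri_fam diag_t off_t))
       (pencil (la ^- 2) (tri_fam diag_s off_s) (tri_fam diag_t off_t)) i j tau a b = 0.
Proof.
case=> R1 R2.
rewrite (act2_ext i j tau (pencil_tri_fam 1 diag_s off_s diag_t off_t)
  (pencil_tri_fam _ diag_s off_s diag_t off_t)).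
have qE k : qi q k = if ipar k then q^-1 else q by [].
have eF (k l : I) : (k < l)%N -> (k == l = false) * (l == k = false) *
  ((l < k)%N = false).
  move=> kl; have kl' : k == l = false by rewrite -val_eqE ltn_eqF.
  by rewrite [l == k]eq_sym kl' ltnNge (ltnW kl).
have la0 : la != 0 by case/orP: hla => /eqP->; rewrite ?oppr_eq0 ?invr_eq0.
have [ij|ij] := eqVneq i j.
  subst j; rewrite act2_diag /off_s /diag_s /off_t /diag_t /qdiff !qE.
  have [ai|_] := eqVneq a i; last by rewrite mul1r subrr !mul0r addr0.
  subst a; have [bi|bi] := eqVneq b i.
    subst b; have := R2 i; rewrite /= addr0.
    case: (ipar i); case/orP: hla => /eqP-> h;  parity_cert h.
  case: (ltngtP b i) => [lbi|lib|ebi]; last by rewrite (ord_inj ebi) eqxx in bi.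
    rewrite (R1 b i lbi) ?(eF b i lbi) /=; have := ipar_lt lbi.
    case: (ipar i) (ipar b) => [] [] //= h1; try bad_parity;
    case/orP: hla => /eqP->; parity_field.
  rewrite (R1 i b lib) ?(eF i b lib) /=; have := ipar_lt lib.
  case: (ipar i) (ipar b) => [] [] //= h1; try bad_parity;
  case/orP: hla => /eqP->; parity_field.
rewrite act2_offdiag // /off_s /diag_s /off_t /diag_t /qdiff !qE.
have [ai|_] := eqVneq a i; last by rewrite mul1r subrr !(mulr0, mul0r) if_same addr0.
subst a.
have [bj|bj] := eqVneq b j.
  subst b; rewrite andbF addr0 eq_sym (negPf ij) add0r.
  have := R2 j; case: (ltngtP i j) => [lij|lji|eij];
    last by rewrite (ord_inj eij) eqxx in ij.
    have := ipar_lt lij.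
    case: (ipar i) (ipar j) => [] [] //= h1; try bad_parity;
    case/orP: hla => /eqP-> h; parity_cert h.
  have := ipar_lt lji.
  case: (ipar i) (ipar j) => [] [] //= h1; try bad_parity;
  case/orP: hla => /eqP-> h; parity_cert h.
have [bi|bi] := eqVneq b i.
  subst b; rewrite /= addr0.
  case: (ltngtP i j) => [lij|lji|eij]; last by rewrite (ord_inj eij) eqxx in ij.
    rewrite (R1 i j lij); have := ipar_lt lij.
    case: (ipar i) (ipar j) => [] [] //= h1; try bad_parity;
    case/orP: hla => /eqP->; parity_field.
  rewrite (R1 j i lji); have := ipar_lt lji.
  case: (ipar i) (ipar j) => [] [] //= h1; try bad_parity;
  case/orP: hla => /eqP->; parity_field.
rewrite add0r /=.
have pmon (k l : I) : (k < l)%N -> ipar k ==> ipar l by move=> kl; apply/implyP;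
  apply: ipar_lt.
case: (ltngtP i j) => [lij|lji|eij]; last by rewrite (ord_inj eij) eqxx in ij.
  case: (ltngtP b j) => [lbj|ljb|ebj]; last by rewrite (ord_inj ebj) eqxx in bj.
    rewrite (R1 b j lbj).
    case: (ltngtP i b) => [lib|lbi|eib]; last by rewrite (ord_inj eib) eqxx in bi.
      have := pmon _ _ lij; have := pmon _ _ lib; have := pmon _ _ lbj.
      case: (ipar i) (ipar b) (ipar j) => [] [] [] //= _ _ _;
      case/orP: hla => /eqP->; parity_field.
    have := pmon _ _ lij; have := pmon _ _ lbi; have := pmon _ _ lbj.
    case: (ipar i) (ipar b) (ipar j) => [] [] [] //= _ _ _;
    case/orP: hla => /eqP->; parity_field.
  rewrite (R1 j b ljb) (eF i b (ltn_trans lij ljb)) (ltn_trans lij ljb).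
  have := pmon _ _ lij; have := pmon _ _ ljb.
  case: (ipar i) (ipar b) (ipar j) => [] [] [] //= _ _;
  case/orP: hla => /eqP->; parity_field.
case: (ltngtP b j) => [lbj|ljb|ebj]; last by rewrite (ord_inj ebj) eqxx in bj.
  rewrite (R1 b j lbj) (eF b i (ltn_trans lbj lji)) (ltn_trans lbj lji).
  have := pmon _ _ lji; have := pmon _ _ lbj.
  case: (ipar i) (ipar b) (ipar j) => [] [] [] //= _ _;
  case/orP: hla => /eqP->; parity_field.
rewrite (R1 j b ljb).
case: (ltngtP i b) => [lib|lbi|eib]; last by rewrite (ord_inj eib) eqxx in bi.
  have := pmon _ _ lji; have := pmon _ _ lib; have := pmon _ _ ljb.
  case: (ipar i) (ipar b) (ipar j) => [] [] [] //= _ _ _;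
  case/orP: hla => /eqP->; parity_field.
have := pmon _ _ lji; have := pmon _ _ lbi; have := pmon _ _ ljb.
case: (ipar i) (ipar b) (ipar j) => [] [] [] //= _ _ _;
case/orP: hla => /eqP->; parity_field.
Qed.

End TwoSlots.

(** * Tensors in the first two factors *)

Section Slices.
Variables (F : fieldType) (M N : nat).
Local Notation I := 'I_(M + N).
Local Notation V := (spaceV M N).
Local Notation family := (Defs.family F M N).

(** Fixing the coordinate r in Y leaves a tensor in V ⊗ V, to which the Hecke
    relations apply. *)
Definition slice (Y : superspace) (u : 'rV[F]_(sdim (stens V (stens V Y))))
    (r : 'I_(sdim Y)) (a b : I) : F :=
  u 0 (@mxtens_index (sdim V) (sdim (stens V Y)) (a, mxtens_index (b, r))).

Lemma sotens_index X Y p (A : 'M[F]_(sdim X)) (B : 'M[F]_(sdim Y)) i j k l :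
  has_parity p B ->
  sotens A B (mxtens_index (i, j)) (mxtens_index (k, l)) =
  (-1) ^+ (p && parity k) * A i k * B j l.
Proof.
move=> hB; rewrite (sotensE _ hB) tensmxE mul_mx_diag !mxE; congr (_ * _).
by rewrite mulrC.
Qed.

Lemma coprod_index X Y (x : family X) (y : family Y) i j a b a' b' :
  has_parity_fam y ->
  coprod x y i j (mxtens_index (a, b)) (mxtens_index (a', b')) =
  \sum_k (-1) ^+ ((ipar i (+) ipar k) && (ipar k (+) ipar j)) *
    ((-1) ^+ ((ipar k (+) ipar j) && parity a') * x i k a a' * y k j b b').
Proof.
move=> hy; rewrite /coprod summxE; apply: eq_bigr => k _.
by rewrite mxE (sotens_index _ _ _ _ _ (hy k j)).
Qed.

Lemma coprod2_index (Y : superspace) (x y : family V) (w : family Y) i j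
    (a b a' b' : I) (r r' : 'I_(sdim Y)) :
  has_parity_fam x -> has_parity_fam y -> has_parity_fam w ->
  coprod x (coprod y w) i j
    (@mxtens_index (sdim V) (sdim (stens V Y)) (a, mxtens_index (b, r)))
    (@mxtens_index (sdim V) (sdim (stens V Y)) (a', mxtens_index (b', r'))) =
  \sum_l w l j r r' * (-1) ^+ ((ipar l (+) ipar j) && (ipar a (+) ipar b)) *
    \sum_k (-1) ^+ ((ipar i (+) ipar k) && (ipar k (+) ipar l)) *
      (x i k a a' * ((-1) ^+ ((ipar k (+) ipar l) && ipar a') * y k l b b')).
Proof.
move=> hx hy hw; rewrite coprod_index; last exact: has_parity_coprod.
under eq_bigr do rewrite coprod_index // !mulr_sumr.
rewrite exchange_big; apply: eq_bigr => l _; rewrite mulr_sumr.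
apply: eq_bigr => k _.
have [->|/hx] := eqVneq (x i k a a') 0; first by rewrite !(mulr0, mul0r).
have [->|/hy] := eqVneq (y k l b b') 0; first by rewrite !(mulr0, mul0r).
rewrite /=.
case: (ipar a) (ipar a') (ipar b) (ipar b') (ipar i) (ipar j) (ipar k) (ipar l)
  => [] [] [] [] [] [] [] [] //= _ _; rewrite ?(expr0, expr1); ring.
Qed.

Lemma sum_mxtens3 (Y : superspace) (f : 'I_(sdim (stens V (stens V Y))) -> F) :
  \sum_k f k = \sum_(a : I) \sum_(b : I) \sum_(r : 'I_(sdim Y))
    f (@mxtens_index (sdim V) (sdim (stens V Y)) (a, mxtens_index (b, r))).
Proof.
rewrite (@sum_mxtens_index F (sdim V) (sdim (stens V Y))); apply: eq_bigr => a _.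
by rewrite (@sum_mxtens_index F (sdim V) (sdim Y)).
Qed.

(** An iterated coproduct acts on the first two factors through [act2], up to
    signs that depend on a and b only through |a| + |b|, and mixes the slices
    linearly. *)
Lemma slice_coprod2 (Y : superspace) (x y : family V) (w : family Y) i j u r a b :
  has_parity_fam x -> has_parity_fam y -> has_parity_fam w ->
  slice (u *m (coprod x (coprod y w) i j)^T) r a b =
  \sum_l \sum_r' w l j r r' *
    (-1) ^+ ((ipar l (+) ipar j) && (ipar a (+) ipar b)) *
    act2 x y i l (slice u r') a b.
Proof.
move=> hx hy hw; rewrite /slice mxE sum_mxtens3.
under eq_bigr do under eq_bigr do under eq_bigr do rewrite mxE coprod2_index // mulr_sumr.
under eq_bigr do under eq_bigr do rewrite exchange_big.
under eq_bigr do rewrite exchange_big.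
rewrite exchange_big; apply: eq_bigr => l _.
under eq_bigr do rewrite exchange_big.
rewrite exchange_big; apply: eq_bigr => r' _.
rewrite /act2 mulr_sumr.
under eq_bigr do under eq_bigr do rewrite !mulr_sumr.
under eq_bigr do rewrite exchange_big.
rewrite exchange_big; apply: eq_bigr => k _.
rewrite !mulr_sumr; apply: eq_bigr => a' _.
rewrite !mulr_sumr; apply: eq_bigr => b' _.
by rewrite /slice; ring.
Qed.

End Slices.

(** * Submodules generated by a tensor power *)

Section Generated.
Variables (F : fieldType) (M N : nat).
Local Notation I := 'I_(M + N).
Local Notation V := (spaceV M N).
Local Notation family := (Defs.family F M N).

Lemma tr_scale m n c (A : 'M[F]_(m, n)) : (c *: A)^T = c *: A^T.
Proof. exact: linearZ. Qed.

Lemma tr_sum m n (K : Type) (r : seq K) (P : pred K) (A : K -> 'M[F]_(m, n)) :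
  (\sum_(k <- r | P k) A k)^T = \sum_(k <- r | P k) (A k)^T.
Proof. exact: raddf_sum. Qed.

(** A linear condition that holds for the generator and is preserved by the
    operators s_ij and t_ij holds on the whole submodule. *)
Lemma submod_ind X (s t : family X) v (Q : 'rV[F]_(sdim X) -> Prop) :
  Q 0 -> (forall u u', Q u -> Q u' -> Q (u + u')) ->
  Q v -> (forall c u, Q u -> Q (c *: u)) ->
  (forall i j u, Q u -> Q (u *m (s i j)^T)) ->
  (forall i j u, Q u -> Q (u *m (t i j)^T)) ->
  forall u, (u <= submod s t v)%MS -> Q u.
Proof.
move=> Q0 QD Qv QZ Qs Qt; rewrite /submod.
pose good m (A : 'M[F]_(m, sdim X)) := forall u : 'rV_(sdim X), (u <= A)%MS -> Q u.
have goodD m m' (A : 'M_(m, _)) (B : 'M_(m', _)) : good _ A -> good _ B -> good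
  _ (A + B)%MS.
  move=> gA gB u /sub_addsmxP[[u1 u2] /= ->].
  by apply: QD; [apply: gA | apply: gB]; apply: submxMl.
have good_sum (A : I -> 'M_(sdim X)) : (forall i, good _ (A i)) -> good _ (\sum_i A i)%MS.
  move=> gA u /sub_sumsmxP[w ->]; apply: (big_ind Q) => // i _.
  by apply: (gA i); apply: submxMl.
have goodM m (A : 'M_(m, _)) (B : 'M_(sdim X)) :
    (forall u, Q u -> Q (u *m B)) -> good _ A -> good _ (A *m B).
  by move=> QB gA u /submxP[D ->]; rewrite mulmxA; apply: QB; apply: gA; apply: submxMl.
suff main n : good _ (iter n (submod_step s t) <<v>>%MS) by exact: main.
elim: n => [|n IHn] /=.
  move=> u; rewrite genmxE => /submxP[D ->].
  by rewrite [D]mx11_scalar mul_scalar_mx; apply: QZ.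
apply: (goodD) => //; apply: (good_sum) => i; apply: good_sum => j.
by apply: goodD; apply: goodM => // u; [apply: Qs | apply: Qt].
Qed.

Variables (s t : family V) (v : 'rV[F]_(sdim V)).
Hypotheses (hs : has_parity_fam s) (ht : has_parity_fam t).
Let U n := submod (powfam s n) (powfam t n) (vpow v n).

(** The space V ⊗ U_n is stable under the coproducts and contains the generator
    of U_{n+1}. *)
Lemma submod_slice n : (U n.+1 <= tensmx (1%:M : 'M_(sdim V)) (U n))%MS.
Proof.
have [Uv Ust _] := submodP (powfam s n) (powfam t n) (vpow v n).
have [_ _ Umin] := submodP (powfam s n.+1) (powfam t n.+1) (vpow v n.+1).
have mon m m' (A : 'M[F]_(m, sdim V)) (C : 'M[F]_(m', sdim (spow V n))) :
    (C <= U n)%MS -> (tensmx A C <= tensmx (1%:M : 'M_(sdim V)) (U n))%MS.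
  by case/submxP=> D ->; rewrite -[A]mulmx1 -tensmx_mul submxMl.
have st (x : family V) i j : has_parity_fam x ->
    (forall k l, stablemx (U n) (powfam x n k l)^T) ->
    stablemx (tensmx (1%:M : 'M_(sdim V)) (U n)) (powfam x n.+1 i j)^T.
  move=> hx hU; rewrite -[powfam x n.+1 i j]/(coprod x (powfam x n) i j) /coprod.
  rewrite tr_sum mulmx_sumr; apply: summx_sub => k _.
  rewrite tr_scale -scalemxAr scalemx_sub //.
  have hpow := @has_parity_powfam _ _ _ _ _ n hx.
  by rewrite (tens_row_sotens _ _ _ (hpow k j)); apply: mon => //; apply: hU.
apply: Umin; first by split; apply: st => // k l; have [] := Ust k l.
exact: (mon 1%N 1%N v (vpow v n) Uv).
Qed.

Lemma parity_mx_stens X Y p : parity_mx F (stens X Y) p = tensmx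
  (parity_mx F X p) (parity_mx F Y p).
Proof.
apply/matrixP=> i j.
case: (mxtens_indexP i) => i1 i2; case: (mxtens_indexP j) => j1 j2.
rewrite tensmxE !mxE (can_eq (@mxtens_indexK _ _)) xpair_eqE parity_stens.
case: (i1 == j1); case: (i2 == j2); rewrite ?(mulr0n, mulr1n, mul0r, mulr0) //.
by rewrite -signr_addb; case: p.
Qed.

Lemma has_parity_tr X p (A : 'M[F]_(sdim X)) : has_parity p A -> has_parity p A^T.
Proof. by move=> hA i j; rewrite mxE addbC; apply: hA. Qed.

Variable c : F.
Hypothesis c2 : c * c = 1.
Hypothesis vc : v *m parity_mx F V true = c *: v.

Lemma vpow_parity n : vpow v n *m parity_mx F (spow V n) true = c ^+ n *: vpow v n.
Proof.
elim: n => [|n IHn].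
  by rewrite expr0 scale1r mul1mx; apply/matrixP=> i j; rewrite !mxE.
transitivity (tensmx (v *m parity_mx F V true) (vpow v n *m parity_mx F (spow V n) true)).
  by rewrite -tensmx_mul -parity_mx_stens.
rewrite IHn vc exprS -[vpow v n.+1]/(tensmx v (vpow v n)).
by apply/matrixP=> i j; rewrite !mxE; ring.
Qed.

(** The generator is homogeneous, so the submodule is graded: its image under the
    parity operator is a submodule that contains the generator. *)
Lemma submod_parity n : (U n *m parity_mx F (spow V n) true <= U n)%MS.
Proof.
have [Uv Ust Umin] := submodP (powfam s n) (powfam t n) (vpow v n).
set P := parity_mx _ _ _; suff: (U n <= U n *m P)%MS.
  by move/(submxMr P); rewrite -mulmxA parity_mxK mulmx1.
have st (x : family V) i j : has_parity_fam x -> stablemx (U n) (powfam x n i j)^T ->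
    stablemx (U n *m P) (powfam x n i j)^T.
  move=> hx hU; have hpow := @has_parity_powfam _ _ _ _ _ n hx i j.
  rewrite -mulmxA (parity_mxC _ (has_parity_tr hpow)) -scalemxAr scalemx_sub // mulmxA.
  exact: submxMr.
apply: Umin; first by move=> i j; have [? ?] := Ust i j; split; apply: st.
have -> : vpow v n = c ^+ n *: (vpow v n *m P).
  by rewrite vpow_parity scalerA -exprMn c2 expr1n scale1r.
by rewrite scalemx_sub // submxMr.
Qed.

(** Q is a linear condition on tensors of V ⊗ V, insensitive to signs that
    depend on the total parity, and stable under the coproduct action. *)
Variable Q : (I -> I -> F) -> Prop.
Hypothesis Qext : forall tau tau' : I -> I -> F,
  (forall a b, tau a b = tau' a b) -> Q tau' -> Q tau.
Hypothesis Qsum : forall (K : finType) (tau : K -> I -> I -> F),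
  (forall k, Q (tau k)) -> Q (fun a b => \sum_k tau k a b).
Hypothesis Qpar : forall (f : bool -> F) (tau : I -> I -> F),
  Q tau -> Q (fun a b => f (ipar a (+) ipar b) * tau a b).
Hypothesis Qv : Q (fun a b => v 0 a * v 0 b).
Hypothesis Qs : forall i j tau, Q tau -> Q (act2 s s i j tau).
Hypothesis Qt : forall i j tau, Q tau -> Q (act2 t t i j tau).

Lemma QZ f tau : Q tau -> Q (fun a b => f * tau a b).
Proof. exact: (Qpar (fun=> f)). Qed.

Lemma QD tau tau' : Q tau -> Q tau' -> Q (fun a b => tau a b + tau' a b).
Proof.
move=> q1 q2; apply: (Qext
  (tau' := fun a b => \sum_(k : bool) (if k then tau else tau') a b)).
  by move=> a b; rewrite big_bool.
by apply: (Qsum (tau := fun k : bool => if k then tau else tau')) => -[].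
Qed.

Lemma vpow_index n (a : 'I_(sdim V)) (r : 'I_(sdim (spow V n))) :
  vpow v n.+1 0 (mxtens_index (a, r)) = v 0 a * vpow v n 0 r.
Proof.
by rewrite -[vpow v n.+1]/(tensmx v (vpow v n)) mxE mxtens_indexK !ord1.
Qed.

(** The slices of the generator are multiples of v ⊗ v, and Q propagates from
    there by [slice_coprod2]. *)
Lemma submod_slots n u r : (u <= U n.+2)%MS -> Q (@slice F M N (spow V n) u r).
Proof.
move=> uU; move: r.
apply: (submod_ind (Q := fun u => forall r, Q (@slice F M N (spow V n) u r))) uU.
- move=> r; apply: Qext (QZ 0 Qv) => a b; rewrite /slice mxE; by rewrite mul0r.
- move=> u1 u2 q1 q2 r; apply: Qext (QD (q1 r) (q2 r)) => a b.
  by rewrite /slice mxE.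
- move=> r; apply: Qext (QZ (vpow v n 0 r) Qv) => a b.
  transitivity (v 0 a * (v 0 b * vpow v n 0 r)); last by ring.
  rewrite -(@vpow_index n b r); exact: (@vpow_index n.+1 a (mxtens_index (b, r))).
- move=> f u1 q1 r; apply: Qext (QZ f (q1 r)) => a b.
  by rewrite /slice mxE.
- move=> i j u1 q1 r; apply: Qext; first by move=> a b;
  apply: slice_coprod2 => //; apply: has_parity_powfam.
  apply: Qsum => l; apply: Qsum => r'; apply: Qext; first by move=> a b; rewrite -mulrA.
  by apply: QZ; apply: (Qpar (fun p => (-1) ^+ ((ipar l (+) ipar j) && p))); apply: Qs.
- move=> i j u1 q1 r; apply: Qext; first by move=> a b;
  apply: slice_coprod2 => //; apply: has_parity_powfam.
  apply: Qsum => l; apply: Qsum => r'; apply: Qext; first by move=> a b; rewrite -mulrA.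
  by apply: QZ; apply: (Qpar (fun p => (-1) ^+ ((ipar l (+) ipar j) && p))); apply: Qt.
Qed.

Lemma submod_kill n (x y : family V) (w : family (spow V n)) i j :
  has_parity_fam x -> has_parity_fam y -> has_parity_fam w ->
  (forall i j tau a b, Q tau -> act2 x y i j tau a b = 0) ->
  U n.+2 *m (coprod x (coprod y w) i j)^T = 0.
Proof.
move=> hx hy hw kill; apply/row_matrixP=> k; rewrite row_mul row0.
set u := row k _; have qu r : Q (@slice F M N (spow V n) u r).
  by apply: submod_slots; apply: row_sub.
apply/rowP=> l; case: (mxtens_indexP l) => a l'; case: (mxtens_indexP l') => b r.
rewrite [RHS]mxE; have := @slice_coprod2 F M N (spow V n) x y w i j u r a b hx hy hw.
rewrite {1}/slice => ->; rewrite big1 // => m _; rewrite big1 // => r' _.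
by rewrite kill ?mulr0.
Qed.

End Generated.

(** * Fusion on V_n^+ and V_n^- *)

Section PlusMinus.
Variables (F : fieldType) (M N : nat) (q : F).
Local Notation I := 'I_(M + N).
Local Notation V := (spaceV M N).
Local Notation family := (Defs.family F M N).
Hypothesis q0 : q != 0.
Hypothesis q2 : q ^+ 2 != 1.

Lemma has_parity_sV : has_parity_fam (sV q : family V).
Proof. by move=> i j; rewrite sVE; apply: has_parity_tri_fam. Qed.

Lemma has_parity_tV : has_parity_fam (tV q : family V).
Proof. by move=> i j; rewrite tVE //; apply: has_parity_tri_fam. Qed.

Lemma pencil_ext (X : superspace) z (x x' y y' : Defs.family F M N X) :
  (forall i j, x i j = x' i j) -> (forall i j, y i j = y' i j) ->
  forall i j, pencil z x y i j = pencil z x' y' i j.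
Proof. by move=> xx yy i j; rewrite /pencil xx yy. Qed.

(** The pull-back by Psi on generators: W carries the families pullW t and
    pullW s. *)
Definition pullW (x : family V) : family V := fun i j => eps F j i *: x j i.

Lemma has_parity_pullW x : has_parity_fam x -> has_parity_fam (pullW x).
Proof. by move=> hx i j; apply: has_parityZ; rewrite addbC; apply: hx. Qed.

(** The graded permutation of V ⊗ V, on coordinates. *)
Definition sflip (tau : I -> I -> F) (a b : I) : F :=
  (-1) ^+ (ipar a && ipar b) * tau b a.

(** The pull-back exchanges the two indices, so it reverses the order of factors in
    a coproduct; the graded permutation restores it. Statements on W ⊗ W become
    statements on V ⊗ V in this way. *)
Lemma act2_pullW (x y : family V) i j tau a b :
  has_parity_fam x -> has_parity_fam y ->
  sflip (act2 (pullW x) (pullW y) i j tau) a b =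
  eps F j i * act2 y x j i (sflip tau) a b.
Proof.
move=> hx hy; rewrite /sflip /act2 !mulr_sumr; apply: eq_bigr => k _.
rewrite !mulr_sumr.
under eq_bigr do rewrite !mulr_sumr.
under [RHS]eq_bigr do rewrite !mulr_sumr.
rewrite exchange_big; apply: eq_bigr => a' _; apply: eq_bigr => b' _.
rewrite /pullW !mxE.
have [->|/hx] := eqVneq (x k i b b') 0; first by rewrite !(mulr0, mul0r).
have [->|/hy] := eqVneq (y j k a a') 0; first by rewrite !(mulr0, mul0r).
rewrite /= /eps.
case: (ipar a) (ipar a') (ipar b) (ipar b') (ipar i) (ipar j) (ipar k)
  => [] [] [] [] [] [] [] //= _ _;
    rewrite ?(expr0, expr1, muln0, muln1, addn0, add0n, addn1); ring.
Qed.

Lemma sflip_inj tau tau' : (forall a b, sflip tau a b = sflip tau' a b) ->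
  forall a b, tau a b = tau' a b.
Proof.
move=> e a b; have := e b a;
  rewrite /sflip => /(congr1 ( *%R ((-1) ^+ (ipar b && ipar a)))).
by rewrite !mulrA -expr2 sqrr_sign !mul1r.
Qed.

Lemma parity_mx_basis (c : I) (v : 'rV[F]_(sdim V)) :
  (forall a, v 0 a != 0 -> a = c) ->
  v *m parity_mx F V true = (-1) ^+ (ipar c) *: v.
Proof.
move=> vc; apply/rowP=> a; rewrite mul_mx_diag !mxE /=.
by have [->|/vc->] := eqVneq (v 0 a) 0; rewrite ?mulr0 ?mul0r // mulrC.
Qed.

Lemma qrel_basis la (c : I) (v : 'rV[F]_(sdim V)) :
  (forall a, v 0 a != 0 -> a = c) ->
  (if ipar c then q else - q^-1) = la ->
  qrel q la (fun a b => v 0 a * v 0 b).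
Proof.
move=> vc hc; have v0 a b : a != b -> v 0 a * v 0 b = 0.
  move=> ab; have [->|/vc ea] := eqVneq (v 0 a) 0; first by rewrite mul0r.
  have [->|/vc eb] := eqVneq (v 0 b) 0; first by rewrite mulr0.
  by rewrite ea eb eqxx in ab.
split=> [a b ab|a].
  by rewrite !v0 ?mulr0 // -val_eqE neq_ltn ab ?orbT.
have [->|/vc ea] := eqVneq (v 0 a) 0; first by rewrite !mulr0.
by rewrite ea hc subrr mul0r.
Qed.

Lemma v_last_basis (c : I) : c.+1 = (M + N)%N ->
  forall a, v_last F M N 0 a != 0 -> a = c.
Proof.
move=> hc a; rewrite mxE; case: (a.+1 =P (M + N)%N) => [e _|];
  last by rewrite mulr0n eqxx.
by apply: ord_inj; apply: succn_inj; rewrite e.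
Qed.

Lemma w_first_basis (c : I) : c = 0%N :> nat ->
  forall a, w_first F M N 0 a != 0 -> a = c.
Proof.
move=> hc a; rewrite mxE; case: (nat_of_ord a =P 0%N) => [e _|];
  last by rewrite mulr0n eqxx.
by apply: ord_inj; rewrite e.
Qed.

Section Plus.
Variable c : I.
Hypothesis hc : c.+1 = (M + N)%N.
Hypothesis N0 : (0 < N)%N.

Let ipc : ipar c.
Proof. by rewrite /ipar -ltnS hc -[X in (X < _)%N]addn0 ltn_add2l. Qed.

Lemma Vplus_parity n :
  (Vplus M N q n *m parity_mx F (spow V n) true <= Vplus M N q n)%MS.
Proof.
apply: (submod_parity has_parity_sV has_parity_tV (c := -1));
  first by rewrite mulrNN mulr1.
by rewrite (parity_mx_basis (v_last_basis hc)) ipc.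
Qed.

Lemma Vplus_slice n :
  (Vplus M N q n.+1 <= tensmx (1%:M : 'M_(sdim V)) (Vplus M N q n))%MS.
Proof. exact: (submod_slice _ has_parity_sV has_parity_tV). Qed.

(** V^+ is generated by a tensor power of an odd vector v_kappa, on whose square
    T is q. *)
Lemma Vplus_kill n (w : Defs.family F M N (spow V n)) i j : has_parity_fam w ->
  Vplus M N q n.+2 *m (coprod (pencil 1 (sV q) (tV q))
     (coprod (pencil (q ^- 2) (sV q) (tV q)) w) i j)^T = 0.
Proof.
move=> hw.
have qq : (q == q) || (q == - q^-1) by rewrite eqxx.
apply: (submod_kill has_parity_sV has_parity_tV (v := v_last F M N)
  (Q := qrel q q)) => //.
- exact: qrel_ext.
- by move=> K tau h; apply: qrel_sum.
- exact: qrel_parity.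
- by apply: (qrel_basis (v_last_basis hc)); rewrite ipc.
- move=> k l tau h; apply: qrel_ext (act2_ext _ _ _ (sVE q) (sVE q)) _.
  exact: qrel_act2_s.
- move=> k l tau h; apply: qrel_ext (act2_ext _ _ _ (tVE q0) (tVE q0)) _.
  exact: qrel_act2_t.
- by apply: has_parity_pencil; [exact: has_parity_sV | exact: has_parity_tV].
- by apply: has_parity_pencil; [exact: has_parity_sV | exact: has_parity_tV].
- move=> k l tau a b h.
  rewrite (act2_ext _ _ _ (pencil_ext _ (sVE q) (tVE q0))
    (pencil_ext _ (sVE q) (tVE q0))).
  exact: act2_kill.
Qed.

Lemma Vplus_fusion n z i j :
  Vplus M N q n.+1 *m (tower (sV q) (tV q) (q ^- 2) n.+1 z i j)^T =
  \prod_(k < n) (1 - z * (q ^- 2) ^+ k) *: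
    (Vplus M N q n.+1 *m (pencil (z * (q ^- 2) ^+ n)
       (powfam (sV q) n.+1) (powfam (tV q) n.+1) i j)^T).
Proof.
apply: (fusion_last (al := 1)) => //.
- exact: has_parity_sV.
- exact: has_parity_tV.
- by rewrite eq_sym invr_eq1.
- exact: Vplus_slice.
- by move=> k w hw k' l; exact: Vplus_kill.
Qed.

End Plus.

Section Minus.
Variable c : I.
Hypothesis hc : c = 0%N :> nat.
Hypothesis M0 : (0 < M)%N.

Let ipc : ipar c = false.
Proof. by rewrite /ipar hc leqNgt M0. Qed.

Lemma has_parity_sW : has_parity_fam (sW q : family V).
Proof. exact: (has_parity_pullW has_parity_tV). Qed.

Lemma has_parity_tW : has_parity_fam (tW q : family V).
Proof. exact: (has_parity_pullW has_parity_sV). Qed.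

Lemma Vminus_slice n :
  (Vminus M N q n.+1 <= tensmx (1%:M : 'M_(sdim V)) (Vminus M N q n))%MS.
Proof. exact: (submod_slice _ has_parity_sW has_parity_tW). Qed.

Lemma qrelZ la f (tau : I -> I -> F) : qrel q la tau -> qrel q la
  (fun a b => f * tau a b).
Proof. exact: (qrel_parity (fun=> f)). Qed.

(** V^- is generated by a tensor power of the even vector w_1, on whose square T is
    -q^-1; the permutation in [act2_pullW] exchanges the two parameters. *)
Lemma Vminus_kill n (w : Defs.family F M N (spow V n)) i j : has_parity_fam w ->
  Vminus M N q n.+2 *m (coprod (pencil (q ^+ 2) (tW q) (sW q))
     (coprod (pencil 1 (tW q) (sW q)) w) i j)^T = 0.
Proof.
move=> hw; pose la := - q^-1.
have qq : (la == q) || (la == - q^-1) by rewrite eqxx orbT.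
apply: (submod_kill has_parity_sW has_parity_tW (v := w_first F M N)
          (Q := fun tau => qrel q la (sflip tau))) => //.
- by move=> tau tau' e; apply: qrel_ext => a b; rewrite /sflip e.
- move=> K tau h; apply: qrel_ext (fun a b => mulr_sumr _ _ _ _) _.
  by apply: qrel_sum => k _; exact: h.
- move=> f tau h; apply: qrel_ext (qrel_parity f h) => a b.
  by rewrite /sflip addbC mulrCA.
- have vb := w_first_basis hc.
  apply: qrel_ext (qrel_basis vb (la := la) _) => [a b|]; last by rewrite ipc.
  rewrite /sflip [in RHS]mulrC.
  have [->|/vb->] := eqVneq (w_first F M N 0 a) 0; first by rewrite !mulr0.
  by rewrite ipc mul1r.
- move=> k l tau h.
  apply: qrel_ext (fun a b => act2_pullW k l tau a b has_parity_tV has_parity_tV) _.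
  apply: qrelZ; apply: qrel_ext (act2_ext _ _ _ (tVE q0) (tVE q0)) _.
  exact: qrel_act2_t.
- move=> k l tau h.
  apply: qrel_ext (fun a b => act2_pullW k l tau a b has_parity_sV has_parity_sV) _.
  apply: qrelZ; apply: qrel_ext (act2_ext _ _ _ (sVE q) (sVE q)) _.
  exact: qrel_act2_s.
- by apply: has_parity_pencil; [exact: has_parity_tW | exact: has_parity_sW].
- by apply: has_parity_pencil; [exact: has_parity_tW | exact: has_parity_sW].
- move=> k l tau a b h.
  have pe z : forall i j, pencil z (tW q) (sW q) i j = pullW (pencil z (sV q) (tV q)) i j.
    move=> i1 j1; rewrite /pencil /tW /sW /pullW scalerBr !scalerA.
    by rewrite [z * _]mulrC.
  apply: (sflip_inj (tau' := fun _ _ => 0)) => a1 b1.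
  transitivity (sflip (act2 (pullW (pencil (q ^+ 2) (sV q) (tV q)))
                  (pullW (pencil 1 (sV q) (tV q))) k l tau) a1 b1).
    by rewrite /sflip (act2_ext _ _ _ (pe _) (pe _)).
  have hp z : has_parity_fam (pencil z (sV q) (tV q) : family V).
    by apply: has_parity_pencil; [exact: has_parity_sV | exact: has_parity_tV].
  rewrite act2_pullW // /sflip mulr0.
  rewrite (act2_ext _ _ _ (pencil_ext _ (sVE q) (tVE q0))
    (pencil_ext _ (sVE q) (tVE q0))).
  have -> : q ^+ 2 = la ^- 2 by rewrite /la sqrrN exprVn invrK.
  by rewrite act2_kill ?mulr0.
Qed.

Lemma Vminus_fusion n z i j :
  Vminus M N q n.+1 *m (tower (tW q) (sW q) (q ^- 2) n.+1 z i j)^T =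
  \prod_(k < n) (1 - z * (q ^- 2) ^+ k.+1) *:
    (Vminus M N q n.+1 *m
      (pencil z (powfam (tW q) n.+1) (powfam (sW q) n.+1) i j)^T).
Proof.
apply: (fusion_first (al := q ^+ 2) (be := 1)) => //.
- exact: has_parity_tW.
- exact: has_parity_sW.
- exact: Vminus_slice.
- by move=> k w hw k' l; exact: Vminus_kill.
- by rewrite mulfV // expf_eq0.
Qed.

End Minus.
End PlusMinus.

(** * Contractions with matrix units *)

Section Monodromy.
Variables (F : fieldType) (M N : nat).
Local Notation I := 'I_(M + N).
Local Notation V := (spaceV M N).
Local Notation family := (Defs.family F M N).
Variable d : nat.
Implicit Types (X : superspace) (y : I -> I -> 'M[F]_d).

(** The operators y a b play the role of elements of another tensor factor: they
    supercommute with the image of rho. *)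
Definition superrep X (rho : 'M[F]_(sdim X) -> 'M[F]_d) y : Prop :=
  [/\ rho 1%:M = 1%:M,
      forall A B, rho (A *m B) = rho A *m rho B,
      forall A B, rho (A + B) = rho A + rho B,
      forall c A, rho (c *: A) = c *: rho A
    & forall p A a b, has_parity p A ->
        y a b *m rho A = (-1) ^+ (p && (ipar a (+) ipar b)) *: (rho A *m y a b)].

(** The operator of which the z a b are the matrix coefficients and the y a b the
    matrix units. *)
Definition Phi X (rho : 'M[F]_(sdim X) -> 'M[F]_d) y (z : family X) : 'M[F]_d :=
  \sum_a \sum_b rho (z a b) *m y a b.

Section Rep.
Variables (X : superspace) (rho : 'M[F]_(sdim X) -> 'M[F]_d).
Variable y : I -> I -> 'M[F]_d.
Hypothesis hr : superrep rho y.

Lemma rho0 : rho 0 = 0.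
Proof. by case: hr => _ _ _ hZ _; rewrite -(scale0r 0) hZ scale0r. Qed.

Lemma rho_sum (K : Type) (r : seq K) (P : pred K) (A : K -> 'M[F]_(sdim X)) :
  rho (\sum_(k <- r | P k) A k) = \sum_(k <- r | P k) rho (A k).
Proof. by case: hr => _ _ hD _ _; apply: (big_morph rho hD rho0). Qed.

Lemma Phi_pencil z (x x' : family X) :
  Phi rho y (pencil z x x') = Phi rho y x - z *: Phi rho y x'.
Proof.
case: hr => _ _ hD hZ _.
rewrite /Phi scaler_sumr -sumrB; apply: eq_bigr => a _.
rewrite scaler_sumr -sumrB; apply: eq_bigr => b _.
by rewrite /pencil -scaleNr hD hZ mulmxDl -scalemxAl scaleNr.
Qed.

End Rep.

Section Product.
Variables (X1 X2 : superspace) (rho : 'M[F]_(sdim (stens X1 X2)) -> 'M[F]_d).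
Variable y : I -> I -> 'M[F]_d.
Hypothesis hr : superrep rho y.

Definition rhol (A : 'M[F]_(sdim X1)) := rho (sotens A 1%:M).
Definition rhor (B : 'M[F]_(sdim X2)) := rho (sotens 1%:M B).

Lemma superrep_l : superrep rhol y.
Proof.
case: hr => h1 hM hD hZ hC; split; rewrite /rhol.
- by rewrite sotens11.
- by move=> A B; rewrite -hM sotens_mul1.
- by move=> A B; rewrite -hD sotensDl.
- by move=> c A; rewrite -hZ sotensZl.
- by move=> p A a b hA; apply: hC; rewrite -[p]addbF;
  apply: has_parity_sotens => //; apply: has_parity1.
Qed.

Lemma superrep_r : superrep rhor y.
Proof.
case: hr => h1 hM hD hZ hC; split; rewrite /rhor.
- by rewrite sotens11.
- by move=> A B; rewrite -hM sotens1_mul.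
- by move=> A B; rewrite -hD sotensDr.
- by move=> c A; rewrite -hZ sotensZr.
- by move=> p A a b hA; apply: hC; rewrite -[p]addFb;
  apply: has_parity_sotens => //; apply: has_parity1.
Qed.

Variables (x : family X1) (w : family X2).
Hypotheses (hx : has_parity_fam x) (hw : has_parity_fam w).

Lemma rho_coprod a c : rho (coprod x w a c) =
  \sum_b (-1) ^+ ((ipar a (+) ipar b) && (ipar b (+) ipar c)) *:
    (rhol (x a b) *m rhor (w b c)).
Proof.
case: (hr) => h1 hM hD hZ hC; rewrite (rho_sum hr); apply: eq_bigr => b _.
rewrite hZ; congr (_ *: _); rewrite -hM; congr rho.
by rewrite (sotens_mul _ _ (@has_parity1 _ _) (@has_parity1 _ _)) scale1r mulmx1 mul1mx.
Qed.

(** The coproduct of matrix coefficients is the product of matrices, when the y a b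
    multiply like matrix units; the sign in the coproduct is the one needed to move
    y past the second factor. *)
Lemma Phi_coprodV :
  (forall a b c e, y a b *m y c e = (b == c)%:R *: y a e) ->
  Phi rho y (coprod x w) = Phi rhol y x *m Phi rhor y w.
Proof.
move=> hy; case: superrep_r => _ _ _ _ hC.
rewrite /Phi mulmx_suml; apply: eq_bigr => a _.
rewrite mulmx_suml; under eq_bigr do rewrite rho_coprod mulmx_suml.
rewrite exchange_big; apply: eq_bigr => b _; rewrite mulmx_sumr.
rewrite [RHS](bigD1 b) //= [X in _ + X]big1 ?addr0.
  rewrite mulmx_sumr; apply: eq_bigr => c _.
  rewrite mulmxA -[_ *m y a b *m _]mulmxA (hC _ _ _ _ (@hw b c)).
  rewrite -scalemxAr -scalemxAl andbC -scalemxAl; congr (_ *: _).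
  by rewrite -!mulmxA hy eqxx scale1r.
move=> c cb; rewrite mulmx_sumr big1 // => e _.
rewrite mulmxA -[_ *m y a b *m _]mulmxA (hC _ _ _ _ (@hw c e)).
rewrite -scalemxAr -scalemxAl -!mulmxA hy eq_sym (negPf cb).
by rewrite scale0r !mulmx0 scaler0.
Qed.

(** When the y a b multiply like the matrix units of the opposite superalgebra, the
    contraction reverses products. This is the situation for the pencils on W, whose
    auxiliary space is V with transposed matrix units. *)
Lemma Phi_coprodW :
  (forall a b c e, y a b *m y c e =
     ((a == e)%:R * (-1) ^+ ((ipar a (+) ipar b) && (ipar c (+) ipar a))) *: y c b) ->
  Phi rho y (coprod x w) = Phi rhor y w *m Phi rhol y x.
Proof.
move=> hy; case: superrep_l => _ _ _ _ hC.
have hrl : forall a b c e, rhor (w a b) *m rhol (x c e) =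
    (-1) ^+ ((ipar a (+) ipar b) && (ipar c (+) ipar e))
      *: (rhol (x c e) *m rhor (w a b)).
  move=> a b c e; case: (hr) => _ hM _ hZ _; rewrite /rhor /rhol -!hM -hZ; congr rho.
  rewrite (sotens_mul _ _ (@hw a b) (@hx c e)).
  by rewrite (sotens_mul _ _ (@has_parity1 _ _) (@has_parity1 _ _)) scale1r
    !mulmx1 !mul1mx.
rewrite /Phi; under eq_bigr do under eq_bigr do rewrite rho_coprod mulmx_suml.
under eq_bigr do rewrite exchange_big.
rewrite exchange_big mulmx_suml; apply: eq_bigr => b _.
rewrite exchange_big mulmx_suml; apply: eq_bigr => a _.
rewrite mulmx_sumr; apply: eq_bigr => c _.
rewrite mulmx_sumr [RHS](bigD1 b) //= [X in _ + X]big1 ?addr0.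
  rewrite mulmxA -[_ *m y b a *m _]mulmxA (hC _ _ _ _ (@hx c b)).
  rewrite -scalemxAr -scalemxAl mulmxA hrl -!scalemxAl scalerA -!mulmxA hy eqxx mul1r.
  rewrite -!scalemxAr !scalerA; congr (_ *: _).
  case: (ipar a) (ipar b) (ipar c) => [] [] [] /=; rewrite ?(expr0, expr1); ring.
move=> e eb; rewrite mulmxA -[_ *m y b a *m _]mulmxA (hC _ _ _ _ (@hx c e)).
rewrite -scalemxAr -scalemxAl -!mulmxA hy eq_sym (negPf eb) mul0r.
by rewrite scale0r !mulmx0 scaler0.
Qed.

End Product.

Lemma prod_scale n k (c : 'I_k -> F) (A : 'I_k -> 'M[F]_n) :
  \prod_l (c l *: A l) = (\prod_l c l) *: \prod_l A l.
Proof.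
elim: k c A => [|k IHk] c A; first by rewrite !big_ord0 scale1r.
by rewrite !big_ord_recl IHk -!mulmxE -scalemxAl -scalemxAr scalerA.
Qed.

Section Towers.
Variables (x x' : family V) (r : F) (y : I -> I -> 'M[F]_d).
Hypotheses (hx : has_parity_fam x) (hx' : has_parity_fam x').

Lemma Phi_counit (rho : 'M[F]_(sdim sunit) -> 'M[F]_d) :
  superrep rho y -> \sum_a y a a = 1%:M -> Phi rho y (@counit F M N) = 1%:M.
Proof.
move=> hr <-; case: (hr) => h1 _ _ _ _; apply: eq_bigr => a _.
rewrite (bigD1 a) //= /counit eqxx h1 mul1mx big1 ?addr0 // => b.
by rewrite eq_sym => /negPf->; rewrite mulr0n raddf0 (rho0 hr) mul0mx.
Qed.

Lemma Phi_towerV n (rho : 'M[F]_(sdim (spow V n)) -> 'M[F]_d) z :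
  superrep rho y ->
  (forall a b c e, y a b *m y c e = (b == c)%:R *: y a e) ->
  \sum_a y a a = 1%:M ->
  Phi rho y (tower x x' r n z) =
  \prod_(l < n) Phi (fun A => rho (at_factor n l A)) y (pencil (z * r ^+ l) x x').
Proof.
move=> + hy y1; elim: n rho z => [|n IHn] rho z hr.
  by rewrite big_ord0 -[RHS]/(1%:M); apply: Phi_counit.
rewrite big_ord_recl expr0 mulr1 -mulmxE.
rewrite -[tower _ _ _ _ _]/(coprod (pencil z x x') (tower x x' r n (z * r))).
rewrite (Phi_coprodV hr) //; last exact: has_parity_tower.
congr (_ *m _); rewrite IHn //; last exact: superrep_r hr.
by apply: eq_bigr => l _; rewrite lift0 exprS mulrA.
Qed.

Lemma Phi_towerW n (rho : 'M[F]_(sdim (spow V n)) -> 'M[F]_d) z :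
  superrep rho y ->
  (forall a b c e, y a b *m y c e =
     ((a == e)%:R * (-1) ^+ ((ipar a (+) ipar b) && (ipar c (+) ipar a))) *: y c b) ->
  \sum_a y a a = 1%:M ->
  Phi rho y (tower x x' r n z) =
  \prod_(l < n) Phi (fun A => rho (at_factor n (rev_ord l) A)) y
                  (pencil (z * r ^+ rev_ord l) x x').
Proof.
move=> + hy y1; elim: n rho z => [|n IHn] rho z hr.
  by rewrite big_ord0 -[RHS]/(1%:M); apply: Phi_counit.
rewrite -[tower _ _ _ _ _]/(coprod (pencil z x x') (tower x x' r n (z * r))).
rewrite (Phi_coprodW hr) //; [|exact: has_parity_pencil|exact: has_parity_tower].
rewrite IHn //; last exact: superrep_r hr.
rewrite big_ord_recr /= -mulmxE subnn expr0 mulr1; congr (_ *m _).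
apply: eq_bigr => l _.
have e : (n.+1 - l.+1 = (n - l.+1).+1)%N by rewrite subSS subnSK.
by rewrite /= e exprS mulrA.
Qed.

End Towers.

Section Invariant.
Variables (m : nat) (U : 'M[F]_(m, d)) (X : superspace).
Variables (rho : 'M[F]_(sdim X) -> 'M[F]_d) (y : I -> I -> 'M[F]_d).
Hypothesis Uy : forall a b, stablemx U (y a b)^T.

(** If U is stable under the y a b, then contractions on U can be computed with
    any family that agrees on U with the given one. *)
Lemma Phi_congr (z z' : family X) :
  (forall a b, U *m (rho (z a b))^T = U *m (rho (z' a b))^T) ->
  U *m (Phi rho y z)^T = U *m (Phi rho y z')^T.
Proof.
move=> zz; rewrite /Phi !tr_sum !mulmx_sumr; apply: eq_bigr => a _.
rewrite !tr_sum !mulmx_sumr; apply: eq_bigr => b _.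
rewrite !trmx_mul !mulmxA; case/submxP: (Uy a b) => D ->.
by rewrite -!mulmxA zz.
Qed.

Lemma Phi_stable (z : family X) :
  (forall a b, stablemx U (rho (z a b))^T) -> stablemx U (Phi rho y z)^T.
Proof.
move=> zz; rewrite /Phi tr_sum mulmx_sumr; apply: summx_sub => a _.
rewrite tr_sum mulmx_sumr; apply: summx_sub => b _.
rewrite trmx_mul; exact: stablemxM.
Qed.

End Invariant.

(** Factors that agree with multiples of the L l on U can be replaced one after the
    other, since the L l preserve U. *)
Lemma prod_invariant m (U : 'M[F]_(m, d)) k (c : 'I_k -> F) (A L : 'I_k -> 'M[F]_d) :
  (forall l, U *m (A l)^T = c l *: (U *m (L l)^T)) ->
  (forall l, stablemx U (L l)^T) ->
  U *m (\prod_l A l)^T = (\prod_l c l) *: (U *m (\prod_l L l)^T) /\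
  stablemx U (\prod_l L l)^T.
Proof.
elim: k c A L => [|k IHk] c A L hA hL.
  by rewrite !big_ord0 scale1r trmx1 mulmx1.
rewrite !big_ord_recl -!mulmxE !trmx_mul !mulmxA.
have [-> st] := IHk (fun l => c (lift ord0 l)) (fun l => A (lift ord0 l))
   (fun l => L (lift ord0 l)) (fun l => hA _) (fun l => hL _).
split; last by rewrite -mulmxA; apply: stablemxM.
case/submxP: st => D e; rewrite e -scalemxAl -!mulmxA hA -!scalemxAr !scalerA.
by rewrite mulrC.
Qed.

End Monodromy.

(** * The R-matrix as a contraction *)

Section RMatrix.
Variables (F : fieldType) (M N : nat) (q : F).
Local Notation I := 'I_(M + N).
Local Notation V := (spaceV M N).
Local Notation family := (Defs.family F M N).
Hypothesis q0 : q != 0.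

Lemma qdiff_sign (i j : I) : (-1) ^+ (ipar i (+) ipar j) * qdiff q i = qdiff q j.
Proof.
rewrite /qdiff /qi; case: (ipar i) (ipar j) => [] [] /=;
  by rewrite ?(expr0, expr1, invrK); ring.
Qed.

(** Multiplication by 1 - a / b turns the coefficients of R^{+-} into those of the
    pencil on V. The sign compensates for q_j - q_j^-1 in the coefficient of
    E_ij ⊗ E_ij where the pencil has q_i - q_i^-1. *)
Lemma Rpm_pencil d (L : 'M[F]_(sdim V) -> 'M[F]_d) (f : I -> I -> 'M[F]_d) (a b : F) :
  (forall A B, L (A + B) = L A + L B) -> (forall c A, L (c *: A) = c *: L A) ->
  b != 0 -> b - a != 0 ->
  \sum_i \sum_j L (pencil (a / b) (sV q) (tV q) i j) *m
     ((-1) ^+ (ipar i (+) ipar j) *: f i j) =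
  (1 - a / b) *: Rpm q a b (fun i j => L (delta_mx i j)) f.
Proof.
move=> LD LZ b0 ba0; set e := fun i j : I => L (delta_mx i j).
have L0 : L 0 = 0 by rewrite -(scale0r 0) LZ scale0r.
have Lsum := big_morph L LD L0.
pose D (i k : I) := diag_s q i k - a / b * diag_t q i k.
have Lp i j : L (pencil (a / b) (sV q) (tV q) i j) =
    if i == j then \sum_k D i k *: e k k else
      (off_s q i j - a / b * off_t q i j) *: e i j.
  rewrite (pencil_ext _ (sVE q) (tVE q0)) pencil_tri_fam /tri_fam.
  case: ifP => _; last exact: LZ.
  rewrite diag_mx_sum_delta Lsum; apply: eq_bigr => k _.
  by rewrite mxE LZ.
transitivity (\sum_(i : I) \sum_(k : I | i != k) (1 - a / b) *: (e i i *m f k k) +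
   \sum_(i : I) (qi q i - a / b * (qi q i)^-1) *: (e i i *m f i i) +
   \sum_(i : I) \sum_(j : I | (i < j)%N) (a / b * qdiff q j) *: (e j i *m f j i) +
   \sum_(i : I) \sum_(j : I | (j < i)%N) qdiff q i *: (e j i *m f j i)); last first.
  rewrite /Rpm !scalerDr; congr (_ + _ + _ + _).
  - rewrite scaler_sumr; apply: eq_bigr => i _.
    by rewrite scaler_sumr; apply: eq_bigr.
  - rewrite scaler_sumr; apply: eq_bigr => i _.
    rewrite scalerA; congr (_ *: _); have := qi_neq0 q0 i; move: (qi q i) => x x0.
    by field; rewrite ?x0 ?ba0 ?b0.
  - rewrite scaler_sumr; apply: eq_bigr => i _.
    rewrite scaler_sumr; apply: eq_bigr => j _.
    by rewrite scalerA -/(qdiff q j); congr (_ *: _); field; rewrite ?ba0 ?b0.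
  - rewrite scaler_sumr; apply: eq_bigr => i _.
    rewrite scaler_sumr; apply: eq_bigr => j _.
    by rewrite scalerA -/(qdiff q i); congr (_ *: _); field; rewrite ?ba0 ?b0.
transitivity (\sum_(i : I) (\sum_(k : I) D i k *: (e k k *m f i i)) +
   \sum_(i : I) \sum_(j : I | j != i) ((-1) ^+ (ipar i (+) ipar j) *
     (off_s q i j - a / b * off_t q i j)) *: (e i j *m f i j)).
  rewrite -big_split; apply: eq_bigr => i _; rewrite (bigD1 i) //=; congr (_ + _).
    rewrite Lp eqxx mulmx_suml addbb scale1r; apply: eq_bigr => k _.
    by rewrite -scalemxAl.
  apply: eq_bigr => j ji; rewrite Lp eq_sym (negPf ji).
  by rewrite -scalemxAl -scalemxAr scalerA mulrC.
have -> : \sum_(i : I) \sum_(k : I) D i k *: (e k k *m f i i) =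
   \sum_(i : I) \sum_(k : I | i != k) (1 - a / b) *: (e i i *m f k k) +
   \sum_(i : I) (qi q i - a / b * (qi q i)^-1) *: (e i i *m f i i).
  rewrite exchange_big -big_split; apply: eq_bigr => i _ /=.
  rewrite (bigD1 i) //= /D /diag_s /diag_t eqxx addrC; congr (_ + _).
  apply: eq_big => [k|k ki]; first by rewrite eq_sym.
  by rewrite eq_sym (negPf ki) mulr1.
rewrite -!addrA; congr (_ + (_ + _)).
rewrite [in RHS](exchange_big_dep xpredT) //=
  [X in _ = _ + X](exchange_big_dep xpredT) //=.
rewrite -big_split; apply: eq_bigr => i _ /=.
rewrite (bigID (fun j : I => (j < i)%N)) /=; congr (_ + _).
  apply: eq_big => [j|j /andP[_ ji]].
    by case: (ltnP j i) => [ji|]; rewrite ?andbF // andbT -val_eqE neq_ltn ji.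
  rewrite /off_s /off_t ji ltnNge (ltnW ji) /=.
  have -> : 0 - a / b * - qdiff q j = a / b * qdiff q j by ring.
  by rewrite mulrCA addbC qdiff_sign.
apply: eq_big => [j|j /andP[ji]].
  by rewrite -leqNgt -val_eqE neq_ltn; case: (ltngtP i j).
move=> nji; have ij : (i < j)%N.
  by rewrite ltn_neqAle leqNgt nji andbT val_eqE eq_sym.
by rewrite /off_s /off_t ij ltnNge (ltnW ij) mulr0 subr0 qdiff_sign.
Qed.

Variables s t : nat.
Let d := sdim (powVW M N s t).
Definition repV (A : 'M[F]_(sdim (spow V s))) : 'M[F]_d := sotens A 1%:M.
Definition repW (B : 'M[F]_(sdim (spow V t))) : 'M[F]_d := sotens 1%:M B.
(** The matrix units of the j-th factor W, with the signs that [Rpm_pencil]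
    requires; they still multiply like matrix units. *)
Definition yV (j : nat) (a b : I) : 'M[F]_d :=
  (-1) ^+ (ipar a (+) ipar b) *: EW F s t j a b.
(** The transposed matrix units of the l-th factor V; the signs make them multiply
    as in [Phi_coprodW]. *)
Definition yW (l : nat) (a b : I) : 'M[F]_d := eps F b a *: EV F s t l b a.

Lemma has_parity_unit n k (a b : I) : (k < n)%N ->
  has_parity (ipar a (+) ipar b)
    (at_factor n k (delta_mx a b : 'M[F]_(sdim V))).
Proof. by move=> kn; apply: has_parity_at_factor => //;
  apply: (@has_parity_delta F V). Qed.

Lemma unit_mul n k (a b c e : I) : (k < n)%N ->
  at_factor n k (delta_mx a b : 'M[F]_(sdim V)) *m at_factor n k
    (delta_mx c e : 'M[F]_(sdim V)) =
  (b == c)%:R *: at_factor n k (delta_mx a e : 'M[F]_(sdim V)).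
Proof.
move=> kn; rewrite -at_factor_mul mul_delta_mx_cond -at_factorZ //.
by rewrite scaler_nat.
Qed.

Lemma unit_sum n k : (k < n)%N ->
  \sum_a at_factor n k (delta_mx a a : 'M[F]_(sdim V)) = 1%:M.
Proof.
move=> kn; rewrite -at_factor_sum // -(at_factor1 _ _ n k); congr at_factor.
rewrite -diag_const_mx diag_mx_sum_delta; apply: eq_bigr => i _.
by rewrite mxE scale1r.
Qed.

Lemma superrep_V j : (j < t)%N -> superrep repV (yV j).
Proof.
move=> jt; split; rewrite /repV.
- exact: sotens11.
- by move=> A B; rewrite sotens_mul1.
- by move=> A B; rewrite sotensDl.
- by move=> c A; rewrite sotensZl.
- move=> p A a b hA; rewrite /yV /EW -scalemxAl -scalemxAr.
  rewrite (sotens_mul _ _ (@has_parity_unit _ _ a b jt) hA).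
  rewrite (sotens_mul _ _ (@has_parity1 _ _) (@has_parity1 _ _)) scale1r !mulmx1 !mul1mx.
  by rewrite !scalerA mulrC andbC.
Qed.

Lemma superrep_W l : (l < s)%N -> superrep repW (yW l).
Proof.
move=> ls; split; rewrite /repW.
- exact: sotens11.
- by move=> A B; rewrite sotens1_mul.
- by move=> A B; rewrite sotensDr.
- by move=> c A; rewrite sotensZr.
- move=> p A a b hA; rewrite /yW /EV -scalemxAl -scalemxAr.
  rewrite (sotens_mul _ _ hA (@has_parity_unit _ _ b a ls)).
  rewrite (sotens_mul _ _ (@has_parity1 _ _) (@has_parity1 _ _)) scale1r !mulmx1 !mul1mx.
  rewrite !scalerA addbC mulrAC -signr_addb addbb mul1r //.
Qed.

Lemma yV_mul j : (j < t)%N ->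
  forall a b c e, yV j a b *m yV j c e = (b == c)%:R *: yV j a e.
Proof.
move=> jt a b c e; rewrite /yV /EW -scalemxAl -scalemxAr sotens1_mul unit_mul //.
rewrite sotensZr !scalerA; have [->|_] := eqVneq b c; last by rewrite !(mulr0, mul0r).
rewrite mulr1 mul1r -signr_addb; congr (_ ^+ _ *: _).
by rewrite addbA addbK.
Qed.

Lemma yW_mul l : (l < s)%N -> forall a b c e, yW l a b *m yW l c e =
  ((a == e)%:R * (-1) ^+ ((ipar a (+) ipar b) && (ipar c (+) ipar a))) *: yW l c b.
Proof.
move=> ls a b c e; rewrite /yW /EV -scalemxAl -scalemxAr sotens_mul1 unit_mul //.
rewrite sotensZl !scalerA; have [<-|_] := eqVneq a e; last by rewrite !(mulr0, mul0r).
rewrite mulr1 mul1r; congr (_ *: _); rewrite /eps.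
by case: (ipar a) (ipar b) (ipar c) => [] [] [] //=;
  rewrite ?(expr0, expr1, muln0, muln1, addn0, add0n, addn1, muln0); ring.
Qed.

Lemma yV_sum j : (j < t)%N -> \sum_a yV j a a = 1%:M.
Proof.
move=> jt; rewrite /yV /EW; under eq_bigr do rewrite addbb scale1r.
by rewrite -sotens_sumr unit_sum // sotens11.
Qed.

Lemma yW_sum l : (l < s)%N -> \sum_a yW l a a = 1%:M.
Proof.
move=> ls; rewrite /yW /EV.
rewrite -[RHS](@sotens11 F) -(unit_sum ls) sotens_suml; apply: eq_bigr => a _.
by rewrite /eps; case: (ipar a); rewrite /= ?expr0 ?sqrrN ?expr1n scale1r.
Qed.

Lemma Rpm_V (a b : F) l j : (l < s)%N -> b != 0 -> b - a != 0 ->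
  @Rpm F M N q _ a b (@EV F M N s t l) (@EW F M N s t j) =
  (1 - a / b)^-1 *: Phi (fun A => repV (at_factor s l A)) (@yV j)
     (pencil (a / b) (sV q) (tV q)).
Proof.
move=> ls b0 ba0; rewrite /Phi /yV.
have := @Rpm_pencil d (fun A => repV (at_factor s l A)) (EW F s t j) a b.
move=> ->//; last 2 first.
- by move=> A B; rewrite at_factorD // /repV sotensDl.
- by move=> c A; rewrite at_factorZ // /repV sotensZl.
rewrite scalerA mulVf ?scale1r //.
by rewrite -[1](divff b0) -mulrBl mulf_neq0 ?invr_eq0.
Qed.

Lemma EVW l j (a b c e : I) : (l < s)%N -> (j < t)%N ->
  EW F s t j c e *m EV F s t l a b =
  (-1) ^+ ((ipar a (+) ipar b) && (ipar c (+) ipar e))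
    *: (EV F s t l a b *m EW F s t j c e).
Proof.
move=> ls jt; rewrite /EV /EW
  (sotens_mul _ _ (@has_parity_unit _ _ c e jt) (@has_parity_unit _ _ a b ls)).
by rewrite (sotens_mul _ _ (@has_parity1 _ _) (@has_parity1 _ _)) scale1r
  !mulmx1 !mul1mx andbC.
Qed.

(** The formula for R^{+-} is symmetric in V and W up to the signs from moving
    the matrix units of W past those of V; these signs become the eps in the
    definition of W. *)
Lemma Rpm_W (a b : F) l j : (l < s)%N -> (j < t)%N -> b != 0 -> b - a != 0 ->
  @Rpm F M N q _ a b (@EV F M N s t l) (@EW F M N s t j) =
  (1 - a / b)^-1 *: Phi (fun A => repW (at_factor t j A)) (yW l)
     (pencil (a / b) (tW q) (sW q)).
Proof.
move=> ls jt b0 ba0.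
have -> : @Rpm F M N q _ a b (@EV F M N s t l) (@EW F M N s t j) =
  @Rpm F M N q _ a b (@EW F M N s t j)
    (fun i k => (-1) ^+ (ipar i (+) ipar k) *: EV F s t l i k).
  rewrite /Rpm; congr (_ + _ + _ + _).
  - rewrite (exchange_big_dep xpredT) //=; apply: eq_bigr => i _;
    apply: eq_big => [k|k _].
      by rewrite eq_sym.
    by rewrite addbb scale1r EVW // addbb scale1r.
  - by apply: eq_bigr => i _; rewrite addbb scale1r EVW // addbb scale1r.
  - apply: eq_bigr => i _; apply: eq_bigr => k _; congr (_ *: _).
    by rewrite -scalemxAr EVW // andbb scalerA -signr_addb addbb scale1r.
  - apply: eq_bigr => i _; apply: eq_bigr => k _; congr (_ *: _).
    by rewrite -scalemxAr EVW // andbb scalerA -signr_addb addbb scale1r.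
have LD A B : repW (at_factor t j (A + B)) = repW (at_factor t j A) + repW
  (at_factor t j B).
  by rewrite at_factorD // /repW sotensDr.
have LZ c A : repW (at_factor t j (c *: A)) = c *: repW (at_factor t j A).
  by rewrite at_factorZ // /repW sotensZr.
have R := @Rpm_pencil d (fun A => repW (at_factor t j A))
  (fun i k => (-1) ^+ (ipar i (+) ipar k) *: EV F s t l i k) a b LD LZ b0 ba0.
have z1 : 1 - a / b != 0.
  by rewrite -[1](divff b0) -mulrBl mulf_neq0 ?invr_eq0.
apply: (scalerI z1); rewrite scalerA mulfV // scale1r.
rewrite -[LHS]R /Phi exchange_big; apply: eq_bigr => i _; apply: eq_bigr => k _ /=.
rewrite scalerA -signr_addb addbb scale1r /yW.
have -> : pencil (a / b) (tW q) (sW q) i k =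
   eps F k i *: pencil (a / b) (sV q) (tV q) k i :> 'M[F]_(sdim V).
  by rewrite /pencil /tW /sW scalerBr !scalerA [a / b * _]mulrC.
rewrite LZ -scalemxAl -scalemxAr scalerA.
by rewrite /eps -expr2 sqrr_sign scale1r.
Qed.

Lemma yV_comm j j' a b c e : (j < t)%N -> (j' < t)%N -> j != j' ->
  yV j a b *m yV j' c e =
  (-1) ^+ ((ipar a (+) ipar b) && (ipar c (+) ipar e)) *: (yV j' c e *m yV j a b).
Proof.
move=> jt j't jj'; rewrite /yV /EW -!scalemxAl -!scalemxAr !sotens1_mul.
rewrite (at_factor_comm jt j't jj' (@has_parity_delta F V a b)
  (@has_parity_delta F V c e)).
by rewrite sotensZr !scalerA; congr (_ *: _); rewrite /=; ring.
Qed.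

(** Operators in disjoint pairs of factors commute; the contractions are even, so
    all signs cancel. *)
Lemma Phi_comm j j' l l' (x x' : family V) :
  (j < t)%N -> (j' < t)%N -> j != j' -> (l < s)%N -> (l' < s)%N -> l != l' ->
  has_parity_fam x -> has_parity_fam x' ->
  Phi (fun A => repV (at_factor s l A)) (yV j) x *m
    Phi (fun A => repV (at_factor s l' A)) (yV j') x' =
  Phi (fun A => repV (at_factor s l' A)) (yV j') x' *m
    Phi (fun A => repV (at_factor s l A)) (yV j) x.
Proof.
move=> jt j't jj' ls l's ll' hx hx'; rewrite /Phi.
rewrite mulmx_suml; under eq_bigr do rewrite mulmx_suml.
under eq_bigr do under eq_bigr do rewrite mulmx_sumr.
under eq_bigr do under eq_bigr do under eq_bigr do rewrite mulmx_sumr.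
rewrite mulmx_sumr; under [RHS]eq_bigr do rewrite mulmx_sumr.
under [RHS]eq_bigr do under eq_bigr do rewrite mulmx_suml.
under [RHS]eq_bigr do under eq_bigr do under eq_bigr do rewrite mulmx_suml.
apply: eq_bigr => a _; apply: eq_bigr => b _; apply: eq_bigr => c _;
  apply: eq_bigr => e _.
have [_ _ _ _ hC] := superrep_V jt; have [_ _ _ _ hC'] := superrep_V j't.
have hxl := has_parity_at_factor ls (hx a b);
  have hxl' := has_parity_at_factor l's (hx' c e).
set X := repV _; set X' := repV _.
have hXX : X *m X' =
    (-1) ^+ ((ipar a (+) ipar b) && (ipar c (+) ipar e)) *: (X' *m X).
  by rewrite /X /X' /repV !sotens_mul1
    (at_factor_comm ls l's ll' (hx a b) (hx' c e)) sotensZl.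
have h1 := hC _ _ a b hxl'; have h2 := hC' _ _ c e hxl.
have h3 := yV_comm a b c e jt j't jj'.
rewrite -/X' in h1; rewrite -/X in h2.
move: (yV j a b) (yV j' c e) h1 h2 h3 => ya yc h1 h2 h3.
move: X X' hXX h1 h2 => X X' hXX h1 h2.
rewrite mulmxA -[X *m _ *m X']mulmxA h1 -scalemxAr [X *m (_ *m _)]mulmxA hXX -!scalemxAl.
rewrite -!mulmxA h3 -!scalemxAr.
rewrite [yc *m (_ *m _)]mulmxA h2 -scalemxAl -scalemxAr.
rewrite !scalerA !mulmxA; congr (_ *: _).
by rewrite -!signr_addb andbC addbb.
Qed.

End RMatrix.

(** * Products over a grid *)

Section Exchange.
Variables (F : fieldType) (d : nat).

Lemma prod_mul_comm n (A B : 'I_n -> 'M[F]_d) :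
  (forall i j, i != j -> GRing.comm (B i) (A j)) ->
  \prod_i (A i * B i) = (\prod_i A i) * \prod_i B i.
Proof.
elim: n A B => [|n IHn] A B AB; first by rewrite !big_ord0 mulr1.
rewrite !big_ord_recl IHn; last first.
  by move=> i j ij; apply: AB; rewrite (inj_eq lift_inj).
rewrite !mulrA; congr (_ * _); rewrite -!mulrA; congr (_ * _).
by apply/esym/commr_sym; apply: commr_prod => j _; apply: AB.
Qed.

(** Moving from row order to column order only permutes factors that differ in both
    indices. *)
Lemma prod_exchange n m (A : 'I_n -> 'I_m -> 'M[F]_d) :
  (forall i i' j j', i != i' -> j != j' -> GRing.comm (A i j) (A i' j')) ->
  \prod_i \prod_j A i j = \prod_j \prod_i A i j.
Proof.
elim: n A => [|n IHn] A hA.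
  by rewrite big_ord0 big1 // => j _; rewrite big_ord0.
rewrite big_ord_recl IHn; last first.
  by move=> i i' j j' ii' jj'; apply: hA; rewrite ?(inj_eq lift_inj).
under [RHS]eq_bigr do rewrite big_ord_recl.
rewrite prod_mul_comm // => j j' jj'; apply: commr_sym.
by apply: commr_prod => i _; apply: hA => //; rewrite eq_sym.
Qed.

End Exchange.

(** * Towers on powers of a vector *)

Section VectorPowers.
Variables (F : fieldType) (M N : nat).
Local Notation I := 'I_(M + N).
Local Notation V := (spaceV M N).
Local Notation family := (Defs.family F M N).

Lemma coprod_ext X Y (x x' : Defs.family F M N X) (y y' : Defs.family F M N Y) :
  (forall i j, x i j = x' i j) -> (forall i j, y i j = y' i j) ->
  forall i j, coprod x y i j = coprod x' y' i j.
Proof. by move=> xx yy i j; apply: eq_bigr => k _; rewrite xx yy. Qed.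

(** At z = 0 a tower is a coproduct power, which makes the computation of matrix
    coefficients of towers apply to coproduct powers. *)
Lemma tower0 X (x y : Defs.family F M N X) r n i j :
  tower x y r n 0 i j = powfam x n i j.
Proof.
elim: n i j => [|n IHn] i j //.
rewrite -[tower _ _ _ _ _]/(coprod (pencil 0 x y) (tower x y r n (0 * r))).
by apply: coprod_ext => [a b|a b]; rewrite /pencil ?scale0r ?subr0 // mul0r IHn.
Qed.

Variables (x y : family V) (r : F).
Hypotheses (hx : has_parity_fam x) (hy : has_parity_fam y).

Lemma tensmxZl m n p p' (c : F) (A : 'M[F]_(m, n)) (B : 'M[F]_(p, p')) :
  tensmx (c *: A) B = c *: tensmx A B.
Proof. by apply/matrixP=> i j; rewrite !mxE mulrA. Qed.

Lemma vpow_sotens (v : 'rV[F]_(sdim V)) n p (A : 'M[F]_(sdim V))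
  (B : 'M[F]_(sdim (spow V n))) :
  has_parity p B ->
  vpow v n.+1 *m sotens A B = tensmx (v *m A *m parity_mx F V p) (vpow v n *m B).
Proof. by move=> hB; rewrite -(tens_sotens v (vpow v n) A hB). Qed.

(** If v is an eigenvector of the pencil in row c, with no other terms in that row,
    then only the index c occurs in the iterated coproduct. *)
Lemma vpow_tower_row (v : 'rV[F]_(sdim V)) c (g : F -> F) n z :
  (forall w k, v *m pencil w x y c k = (k == c)%:R *: (g w *: v)) ->
  forall k, vpow v n *m tower x y r n z c k =
    (k == c)%:R *: ((\prod_(l < n) g (z * r ^+ l)) *: vpow v n).
Proof.
move=> hv; elim: n z => [|n IHn] z k.
  rewrite big_ord0 scale1r /= /counit eq_sym; case: (k == c).
    by rewrite scale1r mulmx1.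
  by rewrite mulr0n scale0r raddf0 mulmx0.
rewrite -[tower _ _ _ _ _]/(coprod (pencil z x y) (tower x y r n (z * r))).
have ht := @has_parity_tower F M N _ x y r n (z * r) hx hy.
rewrite /coprod mulmx_sumr (bigD1 c) //= big1 => [|b bc]; last first.
  rewrite -scalemxAr (vpow_sotens _ _ (ht b k)) hv (negPf bc) scale0r mul0mx.
  by rewrite tens0mx scaler0.
rewrite addbb scale1r addr0 (vpow_sotens _ _ (ht c k)) hv eqxx scale1r IHn.
have [->|kc] := eqVneq k c; last first.
  by rewrite !scale0r tensmx0.
rewrite !scale1r addbb parity_mx0 mulmx1 big_ord_recl expr0 mulr1.
have -> : \prod_(l < n) g (z * r ^+ lift ord0 l) = \prod_(l < n) g (z * r * r ^+ l).
  by apply: eq_bigr => l _; rewrite lift0 exprS mulrA.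
by apply/matrixP=> i j; rewrite !mxE; ring.
Qed.

(** The same for diagonal matrix coefficients: it is enough that the coefficient of
    the pencil at v vanishes off the column c. *)
Lemma vpow_tower_diag (v : 'rV[F]_(sdim V)) c (g : F -> F) e n z :
  v *m parity_mx F V true = e *: v ->
  (forall w k, v *m pencil w x y c k *m v^T = (k == c)%:R *: (g w)%:M) ->
  forall k, vpow v n *m tower x y r n z c k *m (vpow v n)^T =
    (k == c)%:R *: (\prod_(l < n) g (z * r ^+ l))%:M.
Proof.
move=> ve hv; elim: n z => [|n IHn] z k.
  rewrite big_ord0 /= trmx1 mulmx1 /counit eq_sym; case: (k == c).
    by rewrite scale1r mulmx1.
  by rewrite mulr0n scale0r raddf0 mulmx0.
rewrite -[tower _ _ _ _ _]/(coprod (pencil z x y) (tower x y r n (z * r))).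
have ht := @has_parity_tower F M N _ x y r n (z * r) hx hy.
have hp p : parity_mx F V p *m v^T = (if p then e else 1) *: v^T.
  by case: p; rewrite ?parity_mx0 ?mul1mx ?scale1r // -(tr_parity_mx _ V)
    -trmx_mul ve tr_scale.
have main b : vpow v n.+1 *m sotens (pencil z x y c b) (tower x y r n (z * r) b k) *m
    (vpow v n.+1)^T =
    (@tensmx F 1 1 1 1 ((b == c)%:R *: ((if ipar b (+) ipar k then e else 1) *: (g z)%:M))
      (vpow v n *m tower x y r n (z * r) b k *m (vpow v n)^T) : 'M_1).
  transitivity (tensmx v (vpow v n) *m
      sotens (pencil z x y c b) (tower x y r n (z * r) b k) *m tensmx v^T (vpow v n)^T).
    by rewrite -trmx_tens.
  rewrite (tens_sotens v (vpow v n) _ (ht b k)) tensmx_mul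
    -[v *m _ *m _ *m _]mulmxA hp -scalemxAr hv !scalerA.
  by rewrite [X in X *: _]mulrC.
rewrite /coprod mulmx_sumr mulmx_suml (bigD1 c) //= big1 => [|b bc]; last first.
  rewrite -scalemxAr -scalemxAl main (negPf bc) scale0r.
  by rewrite tens0mx scaler0.
rewrite addbb scale1r addr0 main eqxx scale1r IHn.
have [->|kc] := eqVneq k c; last first.
  by rewrite !scale0r tensmx0.
rewrite !scale1r addbb scale1r big_ord_recl expr0 mulr1.
have -> : \prod_(l < n) g (z * r ^+ lift ord0 l) = \prod_(l < n) g (z * r * r ^+ l).
  by apply: eq_bigr => l _; rewrite lift0 exprS mulrA.
by apply/matrixP=> i j; rewrite !mxE !ord1 eqxx !mulr1n.
Qed.

(** For a = c and b != c the matrix unit would map v to another basis vector, and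
    v^n would no longer be an eigenvector. *)
Lemma vpow_unit (v : 'rV[F]_(sdim V)) (c : I) n k (a b : I) :
  v = delta_mx 0 c -> (k < n)%N -> (a == c) && (b == c) || (a != c) ->
  vpow v n *m at_factor n k (delta_mx a b : 'M[F]_(sdim V)) = (a == c)%:R *: vpow v n.
Proof.
move=> ev kn hab.
have hv : v *m (delta_mx a b : 'M[F]_(sdim V)) = (a == c)%:R *: v.
  rewrite ev mul_delta_mx_cond eq_sym scaler_nat.
  by case: (a =P c) hab => _; rewrite ?mulr0n //= orbF => /eqP->.
elim: n k kn => [|n IHn] [|k] //= kn.
  rewrite (vpow_sotens _ _ (@has_parity1 F _)) hv parity_mx0 !mulmx1.
  by apply/matrixP=> i j; rewrite !mxE mulrA.
have hu : has_parity (ipar a (+) ipar b) (at_factor n k (delta_mx a b : 'M[F]_(sdim V))).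
  by apply: has_parity_unit.
rewrite (vpow_sotens _ _ hu) mulmx1 IHn //.
have [ac|ac] := eqVneq a c; last first.
  by rewrite !scale0r tensmx0.
move: hab; rewrite ac eqxx orbF => /eqP->.
by rewrite addbb parity_mx0 mulmx1 !scale1r.
Qed.

End VectorPowers.

(** * Poles of the restricted R-matrix *)

Section RestrictedRMatrix.
Variables (F : fieldType) (M N : nat) (q : F).
Local Notation I := 'I_(M + N).
Local Notation V := (spaceV M N).
Hypothesis q0 : q != 0.
Hypothesis q2 : q ^+ 2 != 1.
Hypothesis M0 : (0 < M)%N.
Hypothesis N0 : (0 < N)%N.
Variables s' t' : nat.
Let s := s'.+1.
Let t := t'.+1.
Variables a b : F.
Hypothesis b0 : b != 0.
Let z := a / b.
Let r := q ^- 2.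
Hypothesis pole_neq0 : forall m, 1 - z * r ^+ m != 0.

Let A l := a * q ^- (2 * l.+1).
Let B j := b * q ^+ (2 * j.+1).

Lemma ratioE l j : A l / B j = z * r ^+ (l + j + 2).
Proof.
rewrite /A /B /z /r !exprM invfM -!exprVn mulrACA -exprD; congr (_ * _ ^+ _).
by rewrite addSn !addnS addn0.
Qed.

Lemma B_neq0 j : B j != 0.
Proof. by rewrite mulf_neq0 // expf_neq0. Qed.

Lemma BA_neq0 l j : B j - A l != 0.
Proof.
have -> : B j - A l = B j * (1 - A l / B j) by have := B_neq0 j => Bj; field.
by rewrite mulf_neq0 ?B_neq0 // ratioE pole_neq0.
Qed.

(* By [ratioE] the pole of this factor of the grid is at z r^(l+j+2) = 1. *)
Let Rlj (l j : nat) := Rpm q (A l) (B j) (@EV F M N s t l) (@EW F M N s t j).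

Lemma RljV l j w : (l < s)%N -> z * r ^+ (l + j + 2) = w -> Rlj l j = (1 - w)^-1 *:
   Phi (fun X => @repV F M N s t (at_factor s l X)) (@yV F M N s t j)
       (pencil w (sV q) (tV q)).
Proof.
move=> ls <-; rewrite -ratioE.
exact: (@Rpm_V F M N q q0 s t (A l) (B j) l j ls (B_neq0 j) (BA_neq0 l j)).
Qed.

Lemma RljW l j w : (l < s)%N -> (j < t)%N -> z * r ^+ (l + j + 2) = w ->
  Rlj l j = (1 - w)^-1 *:
   Phi (fun X => @repW F M N s t (at_factor t j X)) (@yW F M N s t l)
       (pencil w (tW q) (sW q)).
Proof.
move=> ls jt <-; rewrite -ratioE.
exact: (@Rpm_W F M N q q0 s t (A l) (B j) l j ls jt (B_neq0 j) (BA_neq0 l j)).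
Qed.

Lemma has_parity_pencilV w : has_parity_fam
  (pencil w (sV q) (tV q) : Defs.family F M N V).
Proof. by apply: has_parity_pencil; [exact: has_parity_sV | exact: has_parity_tV]. Qed.

Lemma Rst_exchange : Rst M N q s t a b = \prod_(l < s) \prod_(j < t) Rlj l (rev_ord j).
Proof.
rewrite /Rst /Rfactor -/s -/t.
rewrite (prod_exchange (A := fun (j : 'I_t) (l : 'I_s) => Rlj l (rev_ord j))) //.
move=> j j' l l' jj' ll'; rewrite !(RljV (ltn_ord _) erefl) /GRing.comm -!mulmxE.
rewrite -!scalemxAl -!scalemxAr !scalerA mulrC; congr (_ *: _).
apply: Phi_comm => //; try exact: has_parity_pencilV.
by apply: contra jj' => /eqP/ord_inj/rev_ord_inj->.
Qed.

(** The two ambient subspaces whose intersection is V_s^+ ⊗ V_t^-. *)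
Definition Vplus_tens := tensmx (Vplus M N q s) (1%:M : 'M_(sdim (spow V t))).
Definition tens_Vminus := tensmx (1%:M : 'M_(sdim (spow V s))) (Vminus M N q t).

(** What fusion leaves of column j on V_s^+ ⊗ W^t, without its denominator. *)
Definition Lplus (j : nat) : 'M[F]_(sdim (powVW M N s t)) :=
  Phi (@repV F M N s t) (@yV F M N s t j) (powfam (sV q) s)
  - (z * r ^+ (j + s' + 2)) *:
    Phi (@repV F M N s t) (@yV F M N s t j) (powfam (tV q) s).
(** What fusion leaves of row l on V^s ⊗ V_t^-, without its denominator. *)
Definition Lminus (l : nat) : 'M[F]_(sdim (powVW M N s t)) :=
  Phi (@repW F M N s t) (@yW F M N s t l) (powfam (tW q) t)
  - (z * r ^+ (l + 2)) *:
    Phi (@repW F M N s t) (@yW F M N s t l) (powfam (sW q) t).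

Lemma kappa_gt0 : (0 < M + N)%N. Proof. by rewrite addn_gt0 M0. Qed.

Lemma last_proof : ((M + N).-1 < M + N)%N. Proof. by rewrite ltn_predL kappa_gt0. Qed.
Definition last_index : I := Ordinal last_proof.
Definition first_index : I := Ordinal kappa_gt0.

Lemma last_indexE : last_index.+1 = (M + N)%N. Proof. by rewrite /= prednK
  ?kappa_gt0. Qed.

Lemma Vplus_tens_y j a1 b1 : (j < t)%N -> stablemx Vplus_tens (@yV F M N s t j a1 b1)^T.
Proof.
move=> jt; rewrite /yV tr_scale -scalemxAr scalemx_sub // /EW /Vplus_tens.
rewrite (tens_row_sotens _ _ _ (@has_parity_unit F M N _ _ a1 b1 jt)) trmx1 mulmx1.
have: (Vplus M N q s *m parity_mx F (spow V s) (ipar a1 (+) ipar b1) <= Vplus M N q s)%MS.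
  case: (_ (+) _); last by rewrite parity_mx0 mulmx1.
  exact: (Vplus_parity q0 last_indexE N0).
case/submxP=> D ->; rewrite mul1mx.
by rewrite -[X in tensmx _ X]mulmx1 -tensmx_mul submxMl.
Qed.

Lemma Vplus_tens_rho X : Vplus_tens *m (@repV F M N s t X)^T =
  tensmx (Vplus M N q s *m X^T) (1%:M : 'M_(sdim (spow V t))).
Proof.
rewrite /repV /Vplus_tens (tens_row_sotens _ _ _ (@has_parity1 F (spow V t))).
by rewrite parity_mx0 mulmx1 trmx1 mulmx1.
Qed.

Lemma tens_Vminus_y l a1 b1 : (l < s)%N -> stablemx tens_Vminus (@yW F M N s t l a1 b1)^T.
Proof.
move=> ls; rewrite /yW tr_scale -scalemxAr scalemx_sub // /EV /tens_Vminus.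
rewrite (tens_row_sotens _ _ _ (@has_parity1 F (spow V t))) trmx1 mulmx1.
rewrite parity_mx0 mulmx1 mul1mx -[X in tensmx X _]mulmx1 -[X in tensmx _ X]mul1mx.
by rewrite -tensmx_mul submxMl.
Qed.

Lemma tens_Vminus_rho p X : has_parity p X -> tens_Vminus *m (@repW F M N s t X)^T =
  tensmx (parity_mx F (spow V s) p) (Vminus M N q t *m X^T).
Proof.
by move=> hX; rewrite /repW /tens_Vminus (tens_row_sotens _ _ _ hX) trmx1 mulmx1 mul1mx.
Qed.

Lemma Phi_scale X (rho : 'M[F]_(sdim X) -> 'M_(sdim (powVW M N s t))) y c
    (w : Defs.family F M N X) : superrep rho y ->
  Phi rho y (fun i j => c *: w i j) = c *: Phi rho y w.
Proof.
case=> _ _ _ hZ _; rewrite /Phi scaler_sumr; apply: eq_bigr => i _.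
by rewrite scaler_sumr; apply: eq_bigr => j _; rewrite hZ scalemxAl.
Qed.

Lemma inv_prod (k : nat) (f : nat -> F) : (forall i, f i != 0) ->
  (\prod_(i < k.+1) (f i)^-1) * \prod_(i < k) f i = (f k)^-1.
Proof.
move=> f0; rewrite big_ord_recr /= mulrAC -big_split /= big1 ?mul1r // => i _.
by rewrite mulVf.
Qed.

Lemma inv_prodS (k : nat) (f : nat -> F) : (forall i, f i != 0) ->
  (\prod_(i < k.+1) (f i)^-1) * \prod_(i < k) f i.+1 = (f 0)^-1.
Proof.
move=> f0; rewrite big_ord_recl /= -mulrA -big_split /= big1 ?mulr1 // => i _.
by rewrite /bump leq0n add1n mulVf.
Qed.

Lemma column_tower j : (j < t)%N ->
  \prod_(l < s) Rlj l j = (\prod_(l < s) (1 - z * r ^+ (j + 2) * r ^+ l)^-1) *: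
    Phi (@repV F M N s t) (@yV F M N s t j)
      (tower (sV q) (tV q) r s (z * r ^+ (j + 2))).
Proof.
move=> jt; have hr := @superrep_V F M N s t j jt.
set w := z * r ^+ (j + 2).
have ew l : z * r ^+ (l + j + 2) = w * r ^+ l.
  by rewrite /w -mulrA -exprD; congr (_ * _ ^+ _); lia.
rewrite (eq_bigr _ (fun (l : 'I_s) _ => RljV (ltn_ord l) (ew l))).
by rewrite prod_scale -(Phi_towerV _ (@has_parity_sV F M N q)
  (@has_parity_tV F M N q q0) _ hr (@yV_mul F M N s t j jt) (@yV_sum F M N s t j jt)).
Qed.

(** The scalar from [Vplus_fusion] cancels the denominators of all rows of the
    column but the last. *)
Lemma Vplus_tens_column j : (j < t)%N ->
  Vplus_tens *m (\prod_(l < s) Rlj l j)^T = (1 - z * r ^+ (j + s' + 2))^-1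
    *: (Vplus_tens *m (Lplus j)^T).
Proof.
move=> jt; have hr := @superrep_V F M N s t j jt.
rewrite column_tower //; set w := z * r ^+ (j + 2).
have ew l : z * r ^+ (l + j + 2) = w * r ^+ l.
  by rewrite /w -mulrA -exprD; congr (_ * _ ^+ _); lia.
rewrite tr_scale -scalemxAr.
have -> : Vplus_tens *m (Phi (@repV F M N s t) (@yV F M N s t j)
  (tower (sV q) (tV q) r s w))^T =
   \prod_(k < s') (1 - w * r ^+ k) *: (Vplus_tens *m (Lplus j)^T).
  rewrite (@Phi_congr _ _ _ _ _ _ _ _ _ _ _
    (fun i k => \prod_(k < s') (1 - w * r ^+ k) *: pencil (w * r ^+ s')
      (powfam (sV q) s) (powfam (tV q) s) i k)).
  - rewrite (Phi_scale _ _ hr) (Phi_pencil hr) tr_scale -scalemxAr.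
    by rewrite /Lplus -ew [(s' + j)%N]addnC.
  - by move=> a1 b1; apply: Vplus_tens_y.
  - move=> a1 b1; rewrite !Vplus_tens_rho (Vplus_fusion q0 q2 last_indexE N0) tr_scale.
    by rewrite -scalemxAr.
rewrite scalerA; congr (_ *: _).
have -> : z * r ^+ (j + s' + 2) = w * r ^+ s' by rewrite -ew [(s' + j)%N]addnC.
rewrite -(inv_prod s' (f := fun k => 1 - w * r ^+ k)) // => k.
by rewrite -ew.
Qed.

(** The scalar from [Vminus_fusion] cancels the denominators of all columns of the
    row but the first. *)
Lemma tens_Vminus_row l : (l < s)%N ->
  tens_Vminus *m (\prod_(j < t) Rlj l (rev_ord j))^T =
  (1 - z * r ^+ (l + 2))^-1 *: (tens_Vminus *m (Lminus l)^T).
Proof.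
move=> ls; have hr := @superrep_W F M N s t l ls.
set w := z * r ^+ (l + 2).
have ew j : z * r ^+ (l + j + 2) = w * r ^+ j.
  by rewrite /w -mulrA -exprD addnAC.
rewrite (eq_bigr _ (fun (j : 'I_t) _ => RljW ls (ltn_ord (rev_ord j)) (ew (rev_ord j)))).
rewrite prod_scale -(Phi_towerW _ (@has_parity_tW F M N q)
  (@has_parity_sW F M N q q0) _ hr (@yW_mul F M N s t l ls) (@yW_sum F M N s t l ls)).
rewrite tr_scale -scalemxAr.
have -> : tens_Vminus *m (Phi (@repW F M N s t) (@yW F M N s t l)
  (tower (tW q) (sW q) r t w))^T =
   \prod_(k < t') (1 - w * r ^+ k.+1) *: (tens_Vminus *m (Lminus l)^T).
  rewrite (@Phi_congr _ _ _ _ _ _ _ _ _ _ _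
    (fun i k => \prod_(k < t') (1 - w * r ^+ k.+1) *: pencil w (powfam (tW q) t)
      (powfam (sW q) t) i k)).
  - by rewrite (Phi_scale _ _ hr) (Phi_pencil hr) tr_scale -scalemxAr.
  - by move=> a1 b1; apply: tens_Vminus_y.
  - move=> a1 b1.
    have h1 : has_parity_fam (tower (tW q) (sW q) r t w : Defs.family F M N _).
      by apply: has_parity_tower; [exact: has_parity_tW | exact: has_parity_sW].
    have h2 : has_parity_fam (pencil w (powfam (tW q) t) (powfam (sW q) t)
      : Defs.family F M N _).
      by apply: has_parity_pencil; apply: has_parity_powfam;
        [exact: has_parity_tW | exact: has_parity_sW].
    rewrite (tens_Vminus_rho (h1 a1 b1))
      (tens_Vminus_rho (@has_parityZ _ _ _ _ _ (h2 a1 b1))).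
    rewrite (@Vminus_fusion F M N q q0 q2 first_index erefl M0) tr_scale.
    by rewrite -scalemxAr.
rewrite scalerA; congr (_ *: _).
rewrite (reindex_inj rev_ord_inj).
under eq_bigr do rewrite rev_ordK.
rewrite -[w in RHS]mulr1 -[1 in RHS](expr0 r).
rewrite -(inv_prodS t' (f := fun k => 1 - w * r ^+ k)) // => k.
by rewrite -ew.
Qed.

Lemma Lplus_stable j : (j < t)%N -> stablemx Vplus_tens (Lplus j)^T.
Proof.
move=> jt; have [_ Ust _] := submodP (powfam (sV q) s) (powfam (tV q) s)
  (vpow (v_last F M N) s).
have mon m (C : 'M[F]_(m, _)) : (C <= Vplus M N q s)%MS ->
    (tensmx C (1%:M : 'M_(sdim (spow V t))) <= Vplus_tens)%MS.
  by case/submxP=> D ->; rewrite -[X in tensmx _ X]mulmx1 -tensmx_mul submxMl.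
rewrite /Lplus linearB /= tr_scale; apply: stablemxD; last first.
  rewrite -scaleNr -scalemxAr scalemx_sub //;
    apply: Phi_stable => [a1 b1|a1 b1]; first exact: Vplus_tens_y.
  by rewrite Vplus_tens_rho; apply: mon; have [] := Ust a1 b1.
apply: Phi_stable => [a1 b1|a1 b1]; first exact: Vplus_tens_y.
by rewrite Vplus_tens_rho; apply: mon; have [] := Ust a1 b1.
Qed.

Lemma Lminus_stable l : (l < s)%N -> stablemx tens_Vminus (Lminus l)^T.
Proof.
move=> ls; have [_ Ust _] := submodP (powfam (sW q) t) (powfam (tW q) t)
  (vpow (w_first F M N) t).
have mon m (D' : 'M[F]_(m, _)) m' (C : 'M[F]_(m', _)) : (C <= Vminus M N q t)%MS ->
    (tensmx D' C <= tens_Vminus)%MS.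
  by case/submxP=> D ->; rewrite -[D']mulmx1 -tensmx_mul submxMl.
rewrite /Lminus linearB /= tr_scale; apply: stablemxD; last first.
  rewrite -scaleNr -scalemxAr scalemx_sub //;
    apply: Phi_stable => [a1 b1|a1 b1]; first exact: tens_Vminus_y.
  rewrite (tens_Vminus_rho (@has_parity_powfam _ _ _ _ _ t
    (@has_parity_sW F M N q q0) a1 b1)); apply: mon; by have [] := Ust a1 b1.
apply: Phi_stable => [a1 b1|a1 b1]; first exact: tens_Vminus_y.
by rewrite (tens_Vminus_rho
  (@has_parity_powfam _ _ _ _ _ t (@has_parity_tW F M N q) a1 b1)); apply: mon;
    have [] := Ust a1 b1.
Qed.

Lemma Rst_Vplus_tens :
  Vplus_tens *m (Rst M N q s t a b)^T =
    (\prod_(j < t) (1 - z * r ^+ (rev_ord j + s' + 2))^-1) *: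
      (Vplus_tens *m (\prod_(j < t) Lplus (rev_ord j))^T) /\
  stablemx Vplus_tens (\prod_(j < t) Lplus (rev_ord j))^T.
Proof.
apply: prod_invariant => [j|j]; last exact: Lplus_stable.
by rewrite -Vplus_tens_column.
Qed.

Lemma Rst_tens_Vminus :
  tens_Vminus *m (Rst M N q s t a b)^T =
    (\prod_(l < s) (1 - z * r ^+ (l + 2))^-1)
      *: (tens_Vminus *m (\prod_(l < s) Lminus l)^T) /\
  stablemx tens_Vminus (\prod_(l < s) Lminus l)^T.
Proof.
rewrite Rst_exchange.
apply: prod_invariant => [l|l]; last exact: Lminus_stable.
by rewrite -tens_Vminus_row.
Qed.

Lemma v_lastE : v_last F M N = delta_mx 0 last_index.
Proof.
apply/rowP=> i; rewrite !mxE eqxx /=; congr (_%:R); congr nat_of_bool.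
by rewrite -val_eqE -[X in _.+1 == X]last_indexE eqSS.
Qed.

Lemma w_firstE : w_first F M N = delta_mx 0 first_index.
Proof. by apply/rowP=> i; rewrite !mxE eqxx. Qed.

Lemma first_neq_last : first_index == last_index = false.
Proof.
rewrite -val_eqE /=; have: (1 < M + N)%N by rewrite -addn1 leq_add.
by case: (M + N)%N => [|[|m]].
Qed.

Lemma delta_tri_fam (c i k : I) (D g : I -> I -> F) :
  delta_mx 0 c *m (tri_fam D g i k : 'M[F]_(sdim V)) =
  if i == k then D i c *: delta_mx 0 c else (c == i)%:R
    *: (g i k *: (delta_mx 0 k : 'rV[F]_(sdim V))).
Proof.
rewrite /tri_fam; case: ifP => _.
  rewrite -rowE; apply/rowP=> x; rewrite !mxE eqxx /=.
  by have [->|_] := eqVneq c x; rewrite ?mulr1n ?mulr1 // mulr0n mulr0.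
by rewrite -scalemxAr mul_delta_mx_cond -scaler_nat !scalerA mulrC.
Qed.

Lemma row_pencil w k : v_last F M N *m pencil w (sV q) (tV q) first_index k =
  (k == first_index)%:R *: ((1 - w) *: v_last F M N).
Proof.
rewrite (pencil_ext _ (sVE q) (tVE q0)) pencil_tri_fam v_lastE delta_tri_fam.
rewrite [k == first_index]eq_sym [last_index == first_index]eq_sym first_neq_last scale0r.
case: ifP => _; last by rewrite scale0r.
by rewrite scale1r /diag_s /diag_t eq_sym first_neq_last mulr1.
Qed.

Lemma diag_pencil w k :
  v_last F M N *m pencil w (sV q) (tV q) last_index k *m (v_last F M N)^T =
  (k == last_index)%:R *: (q^-1 - w * q)%:M.
Proof.
rewrite (pencil_ext _ (sVE q) (tVE q0)) pencil_tri_fam v_lastE delta_tri_fam.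
have ipk : ipar last_index by rewrite /ipar /= -ltnS prednK ?kappa_gt0 // -addn1
  leq_add2l.
have [_|kk] := eqVneq last_index k.
  rewrite /diag_s /diag_t eqxx /qi ipk invrK scale1r -scalemxAl trmx_delta mul_delta_mx.
  by apply/matrixP=> i j; rewrite !mxE !ord1 !eqxx mulr1.
rewrite eqxx scale1r -scalemxAl trmx_delta mul_delta_mx_0 ?scaler0 ?scale0r //.
by rewrite eq_sym.
Qed.

Definition covec_W : 'rV[F]_(sdim (spow V t)) :=
  tensmx (v_last F M N) (vpow (w_first F M N) t').
(** The first factor W carries v_last, that is w_kappa, and not w_1: with w_1
    everywhere R^{s|t} would act as the identity, as in [covec_column]. *)
Definition covec := tensmx (vpow (v_last F M N) s) covec_W.

Lemma covec_term j a1 b1 (Z : 'M[F]_(sdim (spow V s))) : (j < t)%N ->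
  covec *m (@repV F M N s t Z *m @yV F M N s t j a1 b1) =
  (-1) ^+ (ipar a1 (+) ipar b1) *:
    tensmx (vpow (v_last F M N) s *m Z *m parity_mx F (spow V s) (ipar a1 (+) ipar b1))
      (covec_W *m at_factor t j (delta_mx a1 b1 : 'M[F]_(sdim V))).
Proof.
move=> jt; rewrite /yV /EW -!scalemxAr; congr (_ *: _).
rewrite /repV (sotens_mul _ _ (@has_parity1 F _) (@has_parity1 F _)) scale1r
  mulmx1 mul1mx.
by rewrite /covec (tens_sotens _ _ _ (@has_parity_unit F M N _ _ a1 b1 jt)).
Qed.

(** A factor W that carries w_1 selects the row of index 1 of the monodromy matrix.
    On v_kappa this row is diagonal with the entry 1 - w, which is the denominator
    of R^{+-}; so the column acts as the identity. *)
Lemma covec_column j : (0 < j < t)%N -> covec *m \prod_(l < s) Rlj l j = covec.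
Proof.
case/andP=> j0 jt; rewrite column_tower // -scalemxAr; set w := z * r ^+ (j + 2).
have hw l : 1 - w * r ^+ l != 0.
  by rewrite /w -mulrA -exprD pole_neq0.
have cW a1 b1 : (a1 == first_index) && (b1 == first_index) || (a1 != first_index) ->
    covec_W *m at_factor t j (delta_mx a1 b1 : 'M[F]_(sdim V)) =
    (a1 == first_index)%:R *:
      (tensmx (v_last F M N) (vpow (w_first F M N) t') : 'rV_(sdim (spow V t))).
  move=> h; case: j j0 jt {w hw} => // j _ jt.
  have hu : has_parity (ipar a1 (+) ipar b1)
    (at_factor t' j (delta_mx a1 b1 : 'M[F]_(sdim V))).
    by apply: has_parity_unit.
  rewrite /covec_W -[at_factor t j.+1 _]/(sotens 1%:M
    (at_factor t' j (delta_mx a1 b1 : 'M[F]_(sdim V)))).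
  rewrite (tens_sotens (v_last F M N) (vpow (w_first F M N) t') _ hu).
  rewrite mulmx1 (@vpow_unit F M N _ first_index t' j a1 b1 w_firstE jt h).
  have [ac|ac] := eqVneq a1 first_index; last by rewrite !scale0r tensmx0.
  by move: h; rewrite ac eqxx orbF => /eqP->; rewrite addbb parity_mx0 mulmx1 !scale1r.
have row k := vpow_tower_row r (@has_parity_sV F M N q)
  (@has_parity_tV F M N q q0) s w row_pencil k.
rewrite /Phi mulmx_sumr (bigD1 first_index) //= [X in _ + X]big1 ?addr0; last first.
  move=> a1 a1n; rewrite mulmx_sumr big1 // => b1 _.
  by rewrite covec_term // cW ?a1n ?orbT // (negPf a1n) scale0r tensmx0 scaler0.
rewrite mulmx_sumr (bigD1 first_index) //= [X in _ + X]big1 ?addr0; last first.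
  move=> b1 b1n; rewrite covec_term // row (negPf b1n) scale0r mul0mx.
  by rewrite tens0mx scaler0.
rewrite covec_term // row cW ?eqxx // addbb !scale1r parity_mx0 mulmx1.
rewrite /covec /covec_W; set c := \prod_(l < s) (1 - _).
rewrite tensmxZl scalerA /c -big_split /= big1 ?scale1r // => l _.
by rewrite mulVf.
Qed.

(** The factor W that carries w_kappa selects the row of index kappa; against
    v_kappa^s on the other side only the diagonal entry q_kappa - w q_kappa^-1
    contributes, and q_kappa = q^-1. *)
Lemma covec_column0 (y : 'rV[F]_(sdim (spow V t))) :
  covec *m (\prod_(l < s) Rlj l 0) *m (tensmx (vpow (v_last F M N) s) y)^T =
  (\prod_(l < s) ((q^-1 - z * r ^+ 2 * r ^+ l * q) / (1 - z * r ^+ 2 * r ^+ l))) *: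
    tensmx (1%:M : 'M[F]_1) (covec_W *m y^T).
Proof.
rewrite column_tower // -scalemxAr -scalemxAl; set w := z * r ^+ (0 + 2).
have vp := parity_mx_basis (@v_last_basis F M N _ last_indexE).
have vs := vpow_parity vp s.
set e := _ ^+ s in vs.
have diag k := vpow_tower_diag r (@has_parity_sV F M N q)
  (@has_parity_tV F M N q q0) s w vp diag_pencil k.
have hp p : parity_mx F (spow V s) p *m (vpow (v_last F M N) s)^T =
    (if p then e else 1) *: (vpow (v_last F M N) s)^T.
  by case: p; rewrite ?parity_mx0 ?mul1mx ?scale1r //
    -(tr_parity_mx _ (spow V s)) -trmx_mul vs tr_scale.
have cW a1 b1 : covec_W *m at_factor t 0 (delta_mx a1 b1 : 'M[F]_(sdim V)) =
    (last_index == a1)%:R *: (tensmx (delta_mx 0 b1 : 'rV_(sdim V))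
      (vpow (w_first F M N) t') : 'rV_(sdim (spow V t))).
  rewrite /covec_W -[at_factor t 0 _]/(sotens (delta_mx a1 b1 : 'M[F]_(sdim V)) 1%:M).
  rewrite (tens_sotens (v_last F M N) (vpow (w_first F M N) t') _ (@has_parity1 F _)).
  rewrite parity_mx0 !mulmx1 v_lastE mul_delta_mx_cond.
  by case: eqP => _; rewrite ?mulr1n ?scale1r // mulr0n scale0r tens0mx.
have term a1 b1 Z : covec *m (@repV F M N s t Z *m @yV F M N s t 0 a1 b1) *m
     (tensmx (vpow (v_last F M N) s) y)^T =
  (-1) ^+ (ipar a1 (+) ipar b1) *: ((if ipar a1 (+) ipar b1 then e else 1) *:
   tensmx (vpow (v_last F M N) s *m Z *m (vpow (v_last F M N) s)^T)
    (covec_W *m at_factor t 0 (delta_mx a1 b1 : 'M[F]_(sdim V)) *m y^T)).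
  rewrite covec_term // -scalemxAl; congr (_ *: _).
  rewrite trmx_tens tensmx_mul -[_ *m parity_mx _ _ _ *m _]mulmxA hp -scalemxAr.
  by rewrite tensmxZl.
rewrite /Phi mulmx_sumr mulmx_suml (bigD1 last_index) //= [X in _ + X]big1
  ?addr0; last first.
  move=> a1 a1n; rewrite mulmx_sumr mulmx_suml big1 // => b1 _.
  by rewrite term cW eq_sym (negPf a1n) scale0r mul0mx tensmx0 !scaler0.
rewrite mulmx_sumr mulmx_suml (bigD1 last_index) //= [X in _ + X]big1 ?addr0; last first.
  by move=> b1 b1n; rewrite term diag (negPf b1n) scale0r tens0mx !scaler0.
rewrite term diag cW !eqxx addbb !scale1r -v_lastE -/covec_W.
set c := \prod_(l < s) (_ - _); set A1 := covec_W *m _.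
have -> : tensmx (c%:M : 'M[F]_1) A1 = c *: tensmx (1%:M : 'M[F]_1) A1.
  by apply/matrixP=> i j; rewrite !mxE !ord1 eqxx !mulr1n mul1r.
rewrite scalerA -big_split /=; congr (_ *: _).
by apply: eq_bigr => l _; rewrite mulrC.
Qed.

Lemma telescope_prod (f : nat -> F) k : (forall i, f i != 0) ->
  \prod_(l < k) (f l / f l.+1) * f k = f 0.
Proof.
move=> f0; elim: k => [|k IHk]; first by rewrite big_ord0 mul1r.
by rewrite big_ord_recr /= -IHk -!mulrA mulVf // mulr1.
Qed.

(** The product in [covec_column0] telescopes, as q^-1 - z r^(l+2) q =
    q^-1 (1 - z r^(l+1)). What remains of it has the pole. *)
Lemma covec_Rst (y : 'rV[F]_(sdim (spow V t))) :
  (1 - z * r ^+ s.+1) *: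
    (covec *m Rst M N q s t a b *m (tensmx (vpow (v_last F M N) s) y)^T) =
  (q ^- s * (1 - z * r)) *: tensmx (1%:M : 'M[F]_1) (covec_W *m y^T).
Proof.
have -> : Rst M N q s t a b =
    (\prod_(j < t') \prod_(l < s) Rlj l (rev_ord (widen_ord (leqnSn t') j))) *m
    (\prod_(l < s) Rlj l 0).
  rewrite /Rst big_ord_recr /= mulmxE; congr (_ * _).
  by rewrite subnn.
rewrite mulmxA; have -> : covec *m
   (\prod_(j < t') \prod_(l < s) Rlj l (rev_ord (widen_ord (leqnSn t') j))) = covec.
  apply: (big_ind (fun A => covec *m A = covec)) => [|A1 A2 h1 h2|j _].
  - by rewrite mulmx1.
  - by rewrite -mulmxE mulmxA h1 h2.
  - by apply: covec_column; rewrite /= subSS subn_gt0 ltn_ord /= ltnS leq_subr.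
rewrite covec_column0 scalerA; congr (_ *: _).
have -> : 1 - z * r = 1 - z * r ^+ 1 by rewrite expr1.
have <- := telescope_prod (f := fun k => 1 - z * r ^+ k.+1) s (fun k => pole_neq0 k.+1).
rewrite [RHS]mulrA [LHS]mulrC; congr (_ * _).
have -> : q ^- s = \prod_(l < s) q^-1 by rewrite prodr_const card_ord exprVn.
rewrite -big_split /=.
apply: eq_bigr => l _.
have -> : z * r ^+ 2 * r ^+ l = z * r ^+ l.+2 by rewrite -mulrA -exprD add2n.
rewrite [RHS]mulrA; congr (_ / _); rewrite mulrBr mulr1 exprS; congr (_ - _).
by rewrite /r; move: (_ ^+ l.+1) => x; field.
Qed.

(** A vector of V_t^- whose coordinate at w_kappa ⊗ w_1^(t-1) is not 0. *)
Definition wvec : 'rV[F]_(sdim (spow V t)) :=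
  vpow (w_first F M N) t *m (powfam (sW q) t first_index last_index)^T.

Lemma wvec_sub : (wvec <= Vminus M N q t)%MS.
Proof.
have [Uv Ust _] := submodP (powfam (sW q) t) (powfam (tW q) t) (vpow (w_first F M N) t).
have [st _] := Ust first_index last_index.
by apply: submx_trans st; apply: submxMr.
Qed.

(** In the coproduct that defines [wvec] only the intermediate index kappa moves the
    first factor from w_1 to w_kappa; the other factors then contribute 1. *)
Lemma covec_wvec : exists2 c : F, c != 0 & covec_W *m wvec^T = c%:M.
Proof.
pose w := w_first F M N.
have ip1 : ipar first_index = false by rewrite /ipar /= leqNgt M0.
have ipk : ipar last_index by rewrite /ipar /= -ltnS prednK ?kappa_gt0 // -addn1
  leq_add2l.
have wP : w *m parity_mx F V true = 1 *: w.
  by rewrite (parity_mx_basis (@w_first_basis F M N first_index erefl)) ip1.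
have hp p : parity_mx F V p *m w^T = w^T.
  by case: p; rewrite ?parity_mx0 ?mul1mx // -(tr_parity_mx _ V) -trmx_mul wP scale1r.
have hd z' k : w *m pencil z' (sW q) (sW q) last_index k *m w^T =
  (k == last_index)%:R *: (1 - z')%:M.
  have -> : pencil z' (sW q) (sW q) last_index k =
    ((1 - z') * eps F k last_index) *: tV q k last_index :> 'M[F]_(sdim V).
    by rewrite /pencil /sW -scalerA scalerBl scale1r.
  rewrite (tVE q0) -scalemxAr -scalemxAl /w w_firstE delta_tri_fam /diag_t.
  have [->|kk] := eqVneq k last_index.
    rewrite first_neq_last !scale1r trmx_delta mul_delta_mx /eps ipk /= addn1
      sqrrN expr1n mulr1.
    by apply/matrixP=> i j; rewrite !mxE !ord1 !eqxx mulr1.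
  rewrite -scalemxAl -scalemxAl trmx_delta mul_delta_mx_0 ?scaler0 ?scale0r //.
  by rewrite eq_sym first_neq_last.
have dg := vpow_tower_diag q (@has_parity_sW F M N q q0)
  (@has_parity_sW F M N q q0) t' 0 wP hd last_index.
have {}dg : vpow w t' *m powfam (sW q) t' last_index last_index *m (vpow w t')^T = 1%:M.
  move: dg; rewrite tower0 eqxx scale1r => ->; congr (_%:M).
  by rewrite big1 // => l _; rewrite mul0r subr0.
have hpow := @has_parity_powfam F M N _ (sW q) t' (@has_parity_sW F M N q q0).
have term k : covec_W *m sotens (sW q first_index k)
  (powfam (sW q) t' k last_index) *m (vpow w t)^T =
   (@tensmx F 1 1 1 1 (v_last F M N *m sW q first_index k *m w^T)
     (vpow w t' *m powfam (sW q) t' k last_index *m (vpow w t')^T) : 'M_1).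
  transitivity (tensmx (v_last F M N) (vpow w t') *m
     sotens (sW q first_index k) (powfam (sW q) t' k last_index) *m
     tensmx w^T (vpow w t')^T); first by rewrite -trmx_tens.
  rewrite (tens_sotens (v_last F M N) (vpow w t') _ (hpow k last_index)) tensmx_mul.
  by rewrite -[_ *m parity_mx _ _ _ *m _]mulmxA hp.
have vsw k : v_last F M N *m sW q first_index k *m w^T =
    (k == last_index)%:R *: (eps F last_index first_index * - qdiff q first_index)%:M.
  rewrite /sW (tVE q0) -scalemxAr -scalemxAl v_lastE delta_tri_fam.
  rewrite /w w_firstE [last_index == k]eq_sym.
  have [->|kk] := eqVneq k first_index.
    by rewrite first_neq_last scale0r -scalemxAl trmx_delta mul_delta_mx_0
      ?scaler0 // eq_sym first_neq_last.
  have [->|_] := eqVneq k last_index; last by rewrite scale0r mul0mx scaler0 scale0r.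
  have -> : off_t q last_index first_index = - qdiff q first_index.
    rewrite /off_t; case: ifP => //; have := first_neq_last;
      rewrite -val_eqE /= => /negbT.
    by case: (M + N).-1.
  rewrite !scale1r -scalemxAl trmx_delta mul_delta_mx scalerA.
  by apply/matrixP=> i j; rewrite !mxE !ord1 !eqxx mulr1.
exists (eps F last_index first_index * - qdiff q first_index).
  rewrite mulf_neq0 ?oppr_eq0 //; first by rewrite /eps signr_eq0.
  rewrite /qdiff /qi ip1 subr_eq0; apply: contra q2 => /eqP e.
  by rewrite expr2 {1}e mulVf.
rewrite /wvec trmx_mul trmxK mulmxA.
rewrite -[powfam _ _ _ _]/(coprod (sW q) (powfam (sW q) t') first_index
  last_index) /coprod.
rewrite mulmx_sumr mulmx_suml (bigD1 last_index) //= [X in _ + X]big1 ?addr0; last first.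
  by move=> k kk; rewrite -scalemxAr -scalemxAl term vsw (negPf kk) scale0r
    tens0mx scaler0.
rewrite addbb andbF scale1r term vsw eqxx scale1r dg.
by apply/matrixP=> i j; rewrite !mxE !ord1 eqxx !mulr1n mulr1.
Qed.

End RestrictedRMatrix.

(** * Tensor products of subspaces *)

Section Meet.
Variable F : fieldType.

Lemma tensmxS m1 m2 m3 m4 n1 n2 (A : 'M[F]_(m1, n1)) (A' : 'M_(m2, n1))
    (D : 'M[F]_(m3, n2)) (D' : 'M_(m4, n2)) :
  (A <= A')%MS -> (D <= D')%MS -> (tensmx A D <= tensmx A' D')%MS.
Proof. by case/submxP=> x ->; case/submxP=> y ->; rewrite -tensmx_mul submxMl. Qed.

Lemma tensmx_subl m1 m2 n1 n2 (A : 'M[F]_(m1, n1)) (D : 'M[F]_(m2, n2)) :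
  (tensmx A D <= tensmx A (1%:M : 'M_n2))%MS.
Proof. by apply: tensmxS => //; apply: submx1. Qed.

Lemma tensmx_subr m1 m2 n1 n2 (A : 'M[F]_(m1, n1)) (D : 'M[F]_(m2, n2)) :
  (tensmx A D <= tensmx (1%:M : 'M_n1) D)%MS.
Proof. by apply: tensmxS => //; apply: submx1. Qed.

(** (V ⊗ 1) ∩ (1 ⊗ W) = V ⊗ W: compose the two partial projections. *)
Lemma meet_tensmx m m1 m2 n1 n2 (B : 'M[F]_(m, n1 * n2)) (V : 'M[F]_(m1, n1))
    (W : 'M[F]_(m2, n2)) :
  (B <= tensmx V (1%:M : 'M_n2))%MS -> (B <= tensmx (1%:M : 'M_n1) W)%MS ->
  (B <= tensmx V W)%MS.
Proof.
move=> BV BW.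
have -> : B = B *m tensmx (pinvmx V *m V) (pinvmx W *m W).
  have -> : tensmx (pinvmx V *m V) (pinvmx W *m W) =
      tensmx (pinvmx V *m V) 1%:M *m tensmx 1%:M (pinvmx W *m W).
    by rewrite tensmx_mul mulmx1 mul1mx.
  have B1 : B *m tensmx (pinvmx V *m V) 1%:M = B.
    case/submxP: BV => D ->; rewrite -mulmxA tensmx_mul mulmx1 mulmxA.
    by rewrite mulmxKpV.
  have B2 : B *m tensmx 1%:M (pinvmx W *m W) = B.
    case/submxP: BW => D ->; rewrite -mulmxA tensmx_mul mulmx1 mulmxA.
    by rewrite mulmxKpV.
  by rewrite mulmxA B1 B2.
by rewrite -tensmx_mul mulmxA submxMl.
Qed.

End Meet.

(** * Extension of scalars *)

(** V_s^+ and V_t^- are generated over C, whereas R^{s|t} has coefficients in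
    the field of rational functions; all constructions commute with field
    morphisms. *)
Section MapField.
Variables (F1 F2 : fieldType) (f : {rmorphism F1 -> F2}) (M N : nat).
Local Notation I := 'I_(M + N).
Local Notation V := (spaceV M N).
Local Notation "A ^f" := (map_mx f A) : ring_scope.

Lemma map_sotens X Y (A : 'M[F1]_(sdim X)) (B : 'M[F1]_(sdim Y)) :
  (sotens A B)^f = sotens A^f B^f.
Proof.
apply/matrixP=> i j; rewrite !mxE.
case: (mxtens_unindex i) (mxtens_unindex j) => ? ? [] ? ?.
by rewrite !mxE !rmorphM rmorph_sign.
Qed.

Lemma map_at_factor X n k (A : 'M[F1]_(sdim X)) :
  (at_factor n k A)^f = at_factor n k A^f.
Proof.
elim: n k => [|n IHn] [|k] /=; rewrite ?map_mx1 //.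
  by rewrite map_sotens map_mx1.
by rewrite map_sotens map_mx1 IHn.
Qed.

Lemma map_coprod X Y (x : Defs.family F1 M N X) (y : Defs.family F1 M N Y) i j :
  (coprod x y i j)^f = coprod (fun i j => (x i j)^f) (fun i j => (y i j)^f) i j.
Proof.
rewrite /coprod raddf_sum; apply: eq_bigr => k _.
by rewrite /= map_mxZ rmorph_sign map_sotens.
Qed.

Lemma map_powfam X (x : Defs.family F1 M N X) n i j :
  (powfam x n i j)^f = powfam (fun i j => (x i j)^f) n i j.
Proof.
elim: n i j => [|n IHn] i j.
  by rewrite /= map_scalar_mx rmorph_nat.
rewrite -[powfam x n.+1 i j]/(coprod x (powfam x n) i j) map_coprod.
exact: coprod_ext.
Qed.

Lemma powfam_ext X (x y : Defs.family F2 M N X) n :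
  (forall i j, x i j = y i j) -> forall i j, powfam x n i j = powfam y n i j.
Proof. by move=> xy; elim: n => [|n IHn] i j //; apply: coprod_ext. Qed.

Lemma map_qi q (i : I) : f (qi q i) = qi (f q) i.
Proof. by rewrite /qi; case: ifP => _; rewrite ?fmorphV. Qed.

Lemma map_sV q (i j : I) : (sV q i j)^f = sV (f q) i j.
Proof.
rewrite /sV; case: ifP => _.
  by rewrite map_mxZ map_delta_mx rmorphB fmorphV map_qi.
case: ifP => _; last by rewrite map_mx0.
rewrite map_mxD map_mxZ map_delta_mx map_qi raddf_sum; congr (_ + _).
by apply: eq_bigr => k _; rewrite /= map_delta_mx.
Qed.

Lemma map_tV q (i j : I) : (tV q i j)^f = tV (f q) i j.
Proof.
rewrite /tV; case: ifP => _.
  by rewrite map_mxZ map_delta_mx rmorphN rmorphB fmorphV map_qi.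
case: ifP => _; last by rewrite map_mx0.
by rewrite map_invmx map_sV.
Qed.

Lemma map_eps (i j : I) : f (eps F1 i j) = eps F2 i j.
Proof. by rewrite /eps rmorphXn rmorphN1. Qed.

Lemma map_sW q (i j : I) : (sW q i j)^f = sW (f q) i j.
Proof. by rewrite /sW map_mxZ map_eps map_tV. Qed.

Lemma map_tW q (i j : I) : (tW q i j)^f = tW (f q) i j.
Proof. by rewrite /tW map_mxZ map_eps map_sV. Qed.

Lemma map_vpow (X : superspace) (v : 'rV[F1]_(sdim X)) n : (vpow v n)^f = vpow v^f n.
Proof.
elim: n => [|n IHn] /=; first by rewrite map_mx1.
by apply/matrixP=> i j; rewrite -IHn !mxE rmorphM.
Qed.

Lemma submod_ext (X : superspace) (s s' t t' : Defs.family F2 M N X) v :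
  (forall i j, s i j = s' i j) -> (forall i j, t i j = t' i j) ->
  (submod s t v <= submod s' t' v)%MS.
Proof.
move=> ss tt; have [Uv Ust _] := submodP s' t' v; have [_ _ Umin] := submodP s t v.
by apply: Umin => // i j; rewrite ss tt.
Qed.

(** Both sides are the least submodule that contains the image of v: each step of the
    saturation is mapped into any such submodule, and the image of a submodule is
    stable. *)
Lemma map_submod (X : superspace) (s t : Defs.family F1 M N X) v :
  ((submod s t v)^f :=: submod (fun i j => (s i j)^f) (fun i j => (t i j)^f) v^f)%MS.
Proof.
apply/eqmxP/andP; split.
  set U := submod _ _ v^f; have [Uv Ust _] := submodP (fun i j => (s i j)^f)
    (fun i j => (t i j)^f) v^f.
  have /= : forall n, ((iter n (submod_step s t) <<v>>%MS)^f <= U)%MS; last by apply.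
  elim=> [|n IHn] /=; first by rewrite map_genmx genmxE.
  have sumP (K : finType) (A : K -> 'M[F1]_(sdim X)) :
      (forall k, ((A k)^f <= U)%MS) -> ((\sum_k A k)%MS^f <= U)%MS.
    move=> AU; apply: (big_ind (fun A => (A^f <= U)%MS)) => //.
      by rewrite map_mx0 sub0mx.
    by move=> A1 A2 h1 h2; rewrite map_addsmx addsmx_sub h1.
  rewrite /submod_step map_addsmx addsmx_sub IHn /=; apply: (sumP) => i; apply: sumP => j.
  rewrite map_addsmx addsmx_sub !map_mxM -!map_trmx.
  have [As At] := Ust i j.
  by rewrite (submx_trans (submxMr _ IHn) As) (submx_trans (submxMr _ IHn) At).
have [Uv Ust _] := submodP s t v.
have [_ _ Umin] := submodP (fun i j => (s i j)^f) (fun i j => (t i j)^f) v^f.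
apply: Umin; last by rewrite map_submx.
by move=> i j; have [As At] := Ust i j; rewrite !map_trmx -!map_mxM !map_submx.
Qed.

Lemma map_v_last : (v_last F1 M N)^f = v_last F2 M N.
Proof. by apply/matrixP=> i j; rewrite !mxE rmorph_nat. Qed.

Lemma map_w_first : (w_first F1 M N)^f = w_first F2 M N.
Proof. by apply/matrixP=> i j; rewrite !mxE rmorph_nat. Qed.

Lemma submod_map_ext (X : superspace) (s t : Defs.family F1 M N X)
  (s' t' : Defs.family F2 M N X) v :
  (forall i j, (s i j)^f = s' i j) -> (forall i j, (t i j)^f = t' i j) ->
  ((submod s t v)^f :=: submod s' t' v^f)%MS.
Proof.
move=> ss tt; apply: eqmx_trans (map_submod s t v) _.
by apply/eqmxP/andP; split; apply: submod_ext => i j; rewrite ?ss ?tt.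
Qed.

Lemma map_Vplus q n : ((Vplus M N q n)^f :=: Vplus M N (f q) n)%MS.
Proof.
rewrite /Vplus -map_v_last -map_vpow; apply: submod_map_ext => i j.
  by rewrite map_powfam; apply: powfam_ext; apply: map_sV.
by rewrite map_powfam; apply: powfam_ext; apply: map_tV.
Qed.

Lemma map_Vminus q n : ((Vminus M N q n)^f :=: Vminus M N (f q) n)%MS.
Proof.
rewrite /Vminus -map_w_first -map_vpow; apply: submod_map_ext => i j.
  by rewrite map_powfam; apply: powfam_ext; apply: map_sW.
by rewrite map_powfam; apply: powfam_ext; apply: map_tW.
Qed.

Lemma map_Phi_V s t j (x : Defs.family F1 M N (spow V s))
  (x' : Defs.family F2 M N (spow V s)) :
  (forall a b, (x a b)^f = x' a b) ->
  (Phi (@repV F1 M N s t) (@yV F1 M N s t j) x)^f =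
  Phi (@repV F2 M N s t) (@yV F2 M N s t j) x'.
Proof.
move=> xx; rewrite /Phi raddf_sum; apply: eq_bigr => a _; rewrite raddf_sum.
apply: eq_bigr => b _; rewrite /= map_mxM /repV /yV /EW map_mxZ !map_sotens xx.
by rewrite rmorph_sign !map_mx1 map_at_factor map_delta_mx.
Qed.

Lemma map_Phi_W s t l (x : Defs.family F1 M N (spow V t))
  (x' : Defs.family F2 M N (spow V t)) :
  (forall a b, (x a b)^f = x' a b) ->
  (Phi (@repW F1 M N s t) (@yW F1 M N s t l) x)^f =
  Phi (@repW F2 M N s t) (@yW F2 M N s t l) x'.
Proof.
move=> xx; rewrite /Phi raddf_sum; apply: eq_bigr => a _; rewrite raddf_sum.
apply: eq_bigr => b _; rewrite /= map_mxM /repW /yW /EV map_mxZ !map_sotens xx.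
by rewrite map_eps !map_mx1 map_at_factor map_delta_mx.
Qed.

End MapField.

(** * Rational functions of a / b *)

Section RationalFunctions.
Variable C : fieldType.
Local Notation K := {fraction {mpoly C[2]}}.
Local Notation ta := (tofrac (va C)).
Local Notation tb := (tofrac (vb C)).

Definition cst_morph : {rmorphism C -> K} := (@tofrac _ \o @mpolyC 2 C)%FUN.

Definition ratio : K := ta / tb.

(** The embedding of C[z] into the rational functions given by z := a / b. *)
Definition ev (p : {poly C}) : K := (map_poly cst_morph p).[ratio].

Lemma evM p p' : ev (p * p') = ev p * ev p'.
Proof. by rewrite /ev rmorphM hornerM. Qed.

Lemma evD p p' : ev (p + p') = ev p + ev p'.
Proof. by rewrite /ev rmorphD hornerD. Qed.

Lemma evC c : ev c%:P = cst_morph c.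
Proof. by rewrite /ev map_polyC hornerC. Qed.

Lemma evX : ev 'X = ratio.
Proof. by rewrite /ev map_polyX hornerX. Qed.

Lemma ev0 : ev 0 = 0. Proof. by rewrite evC rmorph0. Qed.
Lemma ev1 : ev 1 = 1. Proof. by rewrite evC rmorph1. Qed.

Lemma ev_sum (I : Type) (r : seq I) (P : pred I) (p : I -> {poly C}) :
  ev (\sum_(i <- r | P i) p i) = \sum_(i <- r | P i) ev (p i).
Proof. by apply: (big_morph ev evD ev0). Qed.

Lemma ev_prod (I : Type) (r : seq I) (P : pred I) (p : I -> {poly C}) :
  ev (\prod_(i <- r | P i) p i) = \prod_(i <- r | P i) ev (p i).
Proof. by apply: (big_morph ev evM ev1). Qed.

Lemma tb_neq0 : tb != 0.
Proof.
rewrite tofrac_eq0; apply/eqP => /(congr1 (mcoeff U_(1 : 'I_2)%MM)).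
by rewrite mcoeffX eqxx mcoeff0 => /eqP; rewrite oner_eq0.
Qed.

(** a / b is transcendental over C. Clearing denominators with b^n gives a form in
    a and b, and b = 1 recovers the polynomial. *)
Lemma ev_eq0 p : ev p = 0 -> p = 0.
Proof.
move=> p0; pose n := size p.
pose P : {mpoly C[2]} := \sum_(i < n) (p`_i)%:MP * (va C ^+ i * vb C ^+ (n - i)).
have evP : tofrac P = ev p * tb ^+ n.
  rewrite /ev horner_coef size_map_poly mulr_suml raddf_sum /=.
  apply: eq_bigr => i _; rewrite coef_map /= !rmorphM /= !rmorphXn /=.
  rewrite -mulrA; congr (_ * _); rewrite /ratio expr_div_n -mulrA; congr (_ * _).
  have -> : tb ^+ n = tb ^+ (n - i) * tb ^+ i by rewrite -exprD subnK // ltnW.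
  by rewrite mulrC mulfK // expf_neq0 // tb_neq0.
have P0 : P = 0 by apply/eqP; rewrite -tofrac_eq0 evP p0 mul0r.
(* The substitution a := X, b := 1. *)
pose sg := mmap (@polyC C) (fun i : 'I_2 => if i == 0 then 'X else 1 : {poly C}).
have sa : sg (va C) = 'X by rewrite /sg mmapX mmap1U.
have sb : sg (vb C) = 1 by rewrite /sg mmapX mmap1U.
have : sg P = 0 by rewrite P0 /sg mmap0.
rewrite /sg raddf_sum /= => <-; rewrite -[LHS]coefK poly_def -/n.
apply: eq_bigr => i _; rewrite !rmorphM /= !rmorphXn /= -/sg sa sb expr1n mulr1.
by rewrite /sg mmapC mul_polyC.
Qed.

Lemma ev_inj p p' : ev p = ev p' -> p = p'.
Proof.
move=> e; apply/eqP; rewrite -subr_eq0; apply/eqP/ev_eq0.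
by rewrite evD -scaleN1r -mul_polyC evM evC rmorphN1 mulN1r e subrr.
Qed.

(** The denominator with a simple pole at a / b = 1 / c. *)
Definition pole_factor (c : C) : {poly C} := 1 - c *: 'X.

Lemma ev_pole_factor c : ev (pole_factor c) = 1 - ratio * cst_morph c.
Proof.
by rewrite /pole_factor evD ev1 -scaleNr -mul_polyC evM evC evX rmorphN mulNr mulrC.
Qed.

Lemma size_pole_factor c : c != 0 -> size (pole_factor c) = 2.
Proof.
by move=> c0; rewrite /pole_factor addrC size_polyDl ?size_polyN ?size_scale
  ?size_polyX ?size_poly1.
Qed.

Lemma pole_factor_neq0 c : pole_factor c != 0.
Proof.
apply/eqP => /(congr1 (fun p : {poly C} => p.[0])).
by rewrite /pole_factor !hornerE ?mulr0 ?subr0 => /eqP; rewrite oner_eq0.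
Qed.

Lemma coprime_pole_factor c c' : c != c' -> coprimep (pole_factor c) (pole_factor c').
Proof.
move=> cc; apply/Bezout_coprimepP;
  exists ((c' / (c' - c))%:P, (- (c / (c' - c)))%:P) => /=.
have d0 : c' - c != 0 by rewrite subr_eq0 eq_sym.
suff -> : (c' / (c' - c))%:P * pole_factor c + (- (c / (c' - c)))%:P *
  pole_factor c' = 1 by exact: eqpxx.
rewrite /pole_factor -!mul_polyC polyCN !polyCM.
transitivity (c'%:P * ((c' - c)^-1)%:P - c%:P * ((c' - c)^-1)%:P); first by ring.
by rewrite -!polyCM -polyCB -mulrBl mulfV.
Qed.

Lemma size_prod_pole_factor n (c : 'I_n -> C) : (forall i, c i != 0) ->
  size (\prod_i pole_factor (c i)) = n.+1.
Proof.
elim: n c => [|n IHn] c c0; first by rewrite big_ord0 size_poly1.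
rewrite big_ord_recl size_mul ?pole_factor_neq0 //; last first.
  by rewrite -size_poly_gt0 IHn // => i; apply: c0.
by rewrite size_pole_factor // IHn // => i; apply: c0.
Qed.

Lemma coprime_prod_pole_factor n m (c : 'I_n -> C) (c' : 'I_m -> C) :
  (forall i j, c i != c' j) -> coprimep (\prod_i pole_factor (c i))
    (\prod_j pole_factor (c' j)).
Proof.
move=> cc; apply: (big_ind (fun p => coprimep p _)); first exact: coprime1p.
  by move=> p p' h h'; rewrite coprimepMl h.
move=> i _; apply: (big_ind (coprimep _)); first exact: coprimep1.
  by move=> p p' h h'; rewrite coprimepMr h.
by move=> j _; apply: coprime_pole_factor.
Qed.

(** Both products P1 and P2 clear the remaining denominators of d e; as they are
    coprime, no denominator remains. The degree of f1 bounds that of the result. *)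
Lemma pole_cancel (e d : K) (P1 P2 f1 f2 : {poly C}) :
  coprimep P1 P2 -> P1 != 0 -> P2 != 0 ->
  (size f1 <= (size P1).+1)%N ->
  d * ev P1 * e = ev f1 -> d * ev P2 * e = ev f2 ->
  exists2 h : {poly C}, (size h <= 2)%N & d * e = ev h.
Proof.
move=> co P10 P20 sf e1 e2.
have e12 : f1 * P2 = f2 * P1.
  apply: ev_inj; rewrite !evM -e1 -e2; ring.
have : P1 %| f1 by rewrite -(Gauss_dvdpl _ co) e12 dvdp_mull.
case/dvdpP=> h hE; exists h; last first.
  apply: (mulIf (x := ev P1)).
    by apply: contra P10 => /eqP/ev_eq0 ->.
  by rewrite -evM -hE -e1 mulrAC.
have [->|h0] := eqVneq h 0; first by rewrite size_poly0.
move: sf; rewrite hE size_mul // -[X in (X <= _)%N -> _]/((size h + size P1).-1)%N.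
have : (0 < size P1)%N by rewrite size_poly_gt0.
lia.
Qed.

Definition poly_in_ratio n m k (A : 'M[K]_(m, k)) : Prop :=
  exists2 P : 'M[{poly C}]_(m, k),
    forall i j, (size (P i j) <= n.+1)%N & A = \matrix_(i, j) ev (P i j).

Lemma poly_in_ratio_const m k (A : 'M[C]_(m, k)) : poly_in_ratio 0 (map_mx cst_morph A).
Proof.
exists (map_mx polyC A) => [i j|]; first by rewrite mxE size_polyC_leq1.
by apply/matrixP=> i j; rewrite !mxE evC.
Qed.

Lemma poly_in_ratio_mul n n' m k l (A : 'M[K]_(m, k)) (B : 'M[K]_(k, l)) :
  poly_in_ratio n A -> poly_in_ratio n' B -> poly_in_ratio (n + n') (A *m B).
Proof.
case=> P sP -> [Q sQ ->]; exists (P *m Q) => [i j|].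
  rewrite mxE; apply: leq_trans (size_sum _ _ _) _; apply/bigmax_leqP => x _.
  apply: leq_trans (size_polyMleq _ _) _.
  move: (size (P i x)) (size (Q x j)) (sP i x) (sQ x j) => u v hu hv.
  by lia.
apply/matrixP=> i j; rewrite !mxE ev_sum; apply: eq_bigr => x _.
by rewrite !mxE evM.
Qed.

Lemma poly_in_ratio_pencil m k c (A B : 'M[C]_(m, k)) :
  poly_in_ratio 1 (map_mx cst_morph A - (ratio * cst_morph c) *: map_mx cst_morph B).
Proof.
exists (\matrix_(i, j) ((A i j)%:P - (c * B i j) *: 'X)) => [i j|].
  rewrite mxE; apply: leq_trans (size_polyD _ _) _.
  rewrite geq_max size_polyN (leq_trans (size_polyC_leq1 _)) //=.
  by apply: leq_trans (size_scale_leq _ _) _; rewrite size_polyX.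
apply/matrixP=> i j; rewrite !mxE evD evC -scaleNr -mul_polyC evM evC evX.
by rewrite rmorphN rmorphM /= mulNr; congr (_ - _); ring.
Qed.

Lemma poly_in_ratio_prod n m (A : 'I_n -> 'M[K]_m) :
  (forall i, poly_in_ratio 1 (A i)) -> poly_in_ratio n (\prod_i A i).
Proof.
elim: n A => [|n IHn] A hA.
  by rewrite big_ord0 -[1]/(1%:M) -(map_mx1 cst_morph); apply: poly_in_ratio_const.
rewrite big_ord_recl -mulmxE; apply: (@poly_in_ratio_mul 1 n) => //.
exact: IHn.
Qed.

Lemma poly_in_ratio_tr n m k (A : 'M[K]_(m, k)) : poly_in_ratio n A ->
  poly_in_ratio n A^T.
Proof.
case=> P sP ->; exists P^T => [i j|]; first by rewrite mxE.
by apply/matrixP=> i j; rewrite !mxE.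
Qed.

End RationalFunctions.

(** * The denominator *)

Section Denominator.
Variables (C : fieldType) (M N : nat) (q : C).
Hypothesis q0 : q != 0.
Hypothesis q_not_root : forall n : nat, (0 < n)%N -> q ^+ n != 1.
Hypothesis M0 : (0 < M)%N.
Hypothesis N0 : (0 < N)%N.
Variables s' t' : nat.
Local Notation s := s'.+1.
Local Notation t := t'.+1.
Local Notation V := (spaceV M N).
Local Notation K := {fraction {mpoly C[2]}}.
Local Notation ta := (tofrac (va C)).
Local Notation tb := (tofrac (vb C)).
Local Notation f := (cst_morph C).
Let Q : K := f q.
Let r0 := q ^- 2.
Let r : K := Q ^- 2.

Lemma f_r m : f (r0 ^+ m) = r ^+ m.
Proof. by rewrite rmorphXn /r0 /r fmorphV rmorphXn. Qed.

Lemma r0_neq0 m : r0 ^+ m != 0.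
Proof. by rewrite expf_neq0 // invr_eq0 expf_neq0. Qed.

(** As q is not a root of unity, different factors of the grid have poles at
    different values of a / b, unless l + j is the same. *)
Lemma r0_inj m n : r0 ^+ m = r0 ^+ n -> m = n.
Proof.
wlog mn : m n / (m <= n)%N.
  by move=> h; case: (leqP m n) => [|/ltnW] mn e; [|symmetry]; apply: h.
move/eqP; rewrite -(subnK mn) exprD -subr_eq0 -[X in X - _]mul1r -mulrBl.
rewrite mulf_eq0 (negPf (r0_neq0 m)) orbF subr_eq0 eq_sym /r0 exprVn invr_eq1 -exprM.
case: (posnP (2 * (n - m))) => [e _|/q_not_root/negPf-> //].
lia.
Qed.

Lemma pole_neq0 m : 1 - ratio C * r ^+ m != 0.
Proof.
rewrite -f_r -ev_pole_factor; apply: contra (pole_factor_neq0 (r0 ^+ m)) => /eqP e.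
by rewrite (ev_eq0 e).
Qed.

Lemma Q_neq0 : Q != 0. Proof. by rewrite fmorph_eq0. Qed.

Lemma Q2_neq1 : Q ^+ 2 != 1.
Proof. by rewrite -rmorphXn fmorph_eq1 q_not_root. Qed.

Let Rab := Rst M N Q s t ta tb.
Let U0 := tensmx (Vplus M N q s) (Vminus M N q t).
Let Ubase := map_mx f (row_base U0).

Lemma Ubase_sub : (Ubase <= tensmx (Vplus M N Q s) (Vminus M N Q t))%MS.
Proof.
apply: (@submx_trans _ _ _ _ _ _ (map_mx f U0));
  first by rewrite /Ubase map_submx eq_row_base.
rewrite /U0 (map_mxT f); apply: tensmxS.
  by rewrite (map_Vplus f).
by rewrite (map_Vminus f).
Qed.

Lemma sub_Ubase (m : nat) (x : 'M[K]_(m, _)) :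
  (x <= tensmx (Vplus M N Q s) (Vminus M N Q t))%MS -> (x <= Ubase)%MS.
Proof.
move=> hx; apply: (@submx_trans _ _ _ _ _ _ (map_mx f U0)); last first.
  by rewrite /Ubase map_submx eq_row_base.
apply: submx_trans hx _; rewrite /U0 (map_mxT f); apply: tensmxS.
  by rewrite (map_Vplus f).
by rewrite (map_Vminus f).
Qed.

Lemma Ubase_Vplus_tens : (Ubase <= @Vplus_tens K M N Q s' t')%MS.
Proof.
by apply: submx_trans Ubase_sub _; apply: tensmx_subl.
Qed.

Lemma Ubase_tens_Vminus : (Ubase <= @tens_Vminus K M N Q s' t')%MS.
Proof.
by apply: submx_trans Ubase_sub _; apply: tensmx_subr.
Qed.

Lemma Ubase_R_V : Ubase *m Rab^T =
   (\prod_(j < t) (1 - ratio C * r ^+ (rev_ord j + s' + 2))^-1) *: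
      (Ubase *m (\prod_(j < t) @Lplus K M N Q s' t' ta tb (rev_ord j))^T).
Proof.
have [e _] := @Rst_Vplus_tens K M N Q Q_neq0 Q2_neq1 M0 N0 s' t' ta tb
  (tb_neq0 C) pole_neq0.
by case/submxP: Ubase_Vplus_tens => D ->; rewrite -!mulmxA /Rab e -scalemxAr.
Qed.

Lemma Ubase_R_W : Ubase *m Rab^T =
   (\prod_(l < s) (1 - ratio C * r ^+ (l + 2))^-1) *:
      (Ubase *m (\prod_(l < s) @Lminus K M N Q s' t' ta tb l)^T).
Proof.
have [e _] := @Rst_tens_Vminus K M N Q Q_neq0 Q2_neq1 M0 s' t' ta tb (tb_neq0 C)
  pole_neq0.
by case/submxP: Ubase_tens_Vminus => D ->; rewrite -!mulmxA /Rab e -scalemxAr.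
Qed.

Lemma Ubase_stable : stablemx Ubase Rab^T.
Proof.
apply: sub_Ubase; apply: meet_tensmx.
  have [e st] := @Rst_Vplus_tens K M N Q Q_neq0 Q2_neq1 M0 N0 s' t' ta tb
    (tb_neq0 C) pole_neq0.
  apply: submx_trans (submxMr _ Ubase_Vplus_tens) _.
  by rewrite /Rab e scalemx_sub.
have [e st] := @Rst_tens_Vminus K M N Q Q_neq0 Q2_neq1 M0 s' t' ta tb
  (tb_neq0 C) pole_neq0.
apply: submx_trans (submxMr _ Ubase_tens_Vminus) _.
by rewrite /Rab e scalemx_sub.
Qed.

Lemma Lplus_poly_in_ratio j : poly_in_ratio 1 (@Lplus K M N Q s' t' ta tb j).
Proof.
have ex a b : map_mx f (powfam (sV q) s a b : 'M_(sdim (spow V s))) = powfam (sV Q) s a b.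
  by rewrite map_powfam; apply: powfam_ext; apply: map_sV.
have ey a b : map_mx f (powfam (tV q) s a b : 'M_(sdim (spow V s))) = powfam (tV Q) s a b.
  by rewrite map_powfam; apply: powfam_ext; apply: map_tV.
have eX := @map_Phi_V C K f M N s t j _ _ ex.
have eY := @map_Phi_V C K f M N s t j _ _ ey.
rewrite /Lplus -f_r -[X in X - _]eX -[X in _ *: X]eY; exact: poly_in_ratio_pencil.
Qed.

Lemma Lminus_poly_in_ratio l : poly_in_ratio 1 (@Lminus K M N Q s' t' ta tb l).
Proof.
have ex a b : map_mx f (powfam (tW q) t a b : 'M_(sdim (spow V t))) = powfam (tW Q) t a b.
  by rewrite map_powfam; apply: powfam_ext; apply: map_tW.
have ey a b : map_mx f (powfam (sW q) t a b : 'M_(sdim (spow V t))) = powfam (sW Q) t a b.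
  by rewrite map_powfam; apply: powfam_ext; apply: map_sW.
have eX := @map_Phi_W C K f M N s t l _ _ ex.
have eY := @map_Phi_W C K f M N s t l _ _ ey.
rewrite /Lminus -f_r -[X in X - _]eX -[X in _ *: X]eY; exact: poly_in_ratio_pencil.
Qed.

(** The matrix has the poles of the column grouping and, by the row grouping, also
    only the poles of the latter; the single common one is that of l = s - 1 and
    j = 0. The two remaining lists of poles are disjoint. *)
Lemma entry_poly i k : exists2 h : {poly C}, (size h <= 2)%N &
  (1 - ratio C * r ^+ (s' + 2)) * (Ubase *m Rab^T) i k = ev h.
Proof.
have [P1 sP1 e1] : poly_in_ratio (0 + t)
  (Ubase *m (\prod_(j < t) @Lplus K M N Q s' t' ta tb (rev_ord j))^T).
  apply: poly_in_ratio_mul; first exact: poly_in_ratio_const.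
  by apply: poly_in_ratio_tr; apply: poly_in_ratio_prod => j; exact: Lplus_poly_in_ratio.
have [P2 sP2 e2] : poly_in_ratio (0 + s)
  (Ubase *m (\prod_(l < s) @Lminus K M N Q s' t' ta tb l)^T).
  apply: poly_in_ratio_mul; first exact: poly_in_ratio_const.
  by apply: poly_in_ratio_tr; apply: poly_in_ratio_prod => j; exact: Lminus_poly_in_ratio.
(* The exponents j + s + 1 (columns, j >= 1) exceed the exponents l + 2
   (rows, l <= s - 2). *)
pose c1 (j : 'I_t') := r0 ^+ (j + s' + 3).
pose c2 (l : 'I_s') := r0 ^+ (l + 2).
apply: (@pole_cancel C _ _ (\prod_j pole_factor (c1 j))
  (\prod_l pole_factor (c2 l)) (P1 i k) (P2 i k)).
- apply: coprime_prod_pole_factor => j l; apply/eqP => /r0_inj.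
  by have := ltn_ord l; lia.
- by apply/prodf_neq0 => j _; exact: pole_factor_neq0.
- by apply/prodf_neq0 => j _; exact: pole_factor_neq0.
- rewrite size_prod_pole_factor => [|j]; last exact: r0_neq0.
  exact: sP1.
- rewrite Ubase_R_V e1 mxE mxE [\prod_(j < t) _](reindex_inj rev_ord_inj).
  under [\prod_(j < t) _]eq_bigr do rewrite rev_ordK.
  rewrite prodfV big_ord_recl add0n mulrA ev_prod.
  rewrite (eq_bigr (fun j : 'I_t' => 1 - ratio C * r ^+
    (lift ord0 j + s' + 2))); last first.
    move=> j _; rewrite ev_pole_factor /c1 f_r lift0; congr (_ - _ * _ ^+ _); lia.
  rewrite mulfV ?mul1r // mulf_neq0 ?pole_neq0 //.
  by apply/prodf_neq0 => j _; exact: pole_neq0.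
- rewrite Ubase_R_W e2 mxE mxE prodfV big_ord_recr /= mulrA ev_prod.
  rewrite (eq_bigr (fun l : 'I_s' => 1 - ratio C * r ^+ (l + 2))); last first.
    by move=> l _; rewrite ev_pole_factor /c2 f_r.
  rewrite [X in X / _]mulrC mulfV ?mul1r // mulf_neq0 ?pole_neq0 //.
  by apply/prodf_neq0 => j _; exact: pole_neq0.
Qed.

Definition pole_form : {mpoly C[2]} := q ^+ 2 *: vb C - q ^- (2 * s) *: va C.

Lemma tofracZ (c : C) (p : {mpoly C[2]}) : tofrac (c *: p) = f c * tofrac p.
Proof. by rewrite -mul_mpolyC rmorphM. Qed.

Lemma q2r0 m : q ^+ 2 * r0 ^+ m.+1 = r0 ^+ m.
Proof. by rewrite [r0 ^+ m.+1]exprS mulrA /r0 mulfV ?mul1r // expf_neq0. Qed.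

Lemma tofrac_pole_form : tofrac pole_form = f (q ^+ 2) * tb *
  (1 - ratio C * r ^+ (s' + 2)).
Proof.
rewrite /pole_form rmorphB /= !tofracZ mulrBr mulr1; congr (_ - _).
have -> : q ^- (2 * s) = q ^+ 2 * r0 ^+ (s' + 2) by rewrite addn2 q2r0 /r0 exprVn exprM.
rewrite (rmorphM f) f_r -!mulrA; congr (_ * _).
by rewrite /ratio !mulrA [tb * ta]mulrC mulfK ?tb_neq0 // mulrC.
Qed.

Definition cleared m k (A : 'M[K]_(m, k)) : Prop :=
  exists P : 'M[{mpoly C[2]}]_(m, k), A = map_mx (@tofrac _) P.

Lemma cleared_mulr m k l (A : 'M[K]_(m, k)) (X : 'M[C]_(k, l)) :
  cleared A -> cleared (A *m map_mx f X).
Proof.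
case=> P ->; exists (P *m map_mx (@mpolyC 2 C) X).
by rewrite map_mxM; congr (_ *m _); apply/matrixP=> i j; rewrite !mxE.
Qed.

Lemma cleared_mull m k l (A : 'M[K]_(m, k)) (X : 'M[C]_(l, m)) :
  cleared A -> cleared (map_mx f X *m A).
Proof.
case=> P ->; exists (map_mx (@mpolyC 2 C) X *m P).
by rewrite map_mxM; congr (_ *m _); apply/matrixP=> i j; rewrite !mxE.
Qed.

Lemma cleared_tr m k (A : 'M[K]_(m, k)) : cleared A -> cleared A^T.
Proof. by case=> P ->; exists P^T; rewrite map_trmx. Qed.

Lemma Rst_restrE : Rst_restr M N q s t = (Ubase *m Rab^T *m pinvmx Ubase)^T.
Proof. by []. Qed.

(** By [entry_poly] the entries become polynomials of degree at most 1 in a / b;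
    multiplication by b makes them forms in a and b. *)
Lemma cleared_pole_form : cleared (tofrac pole_form *: (Ubase *m Rab^T)).
Proof.
have entry i : forall k, exists p : {mpoly C[2]},
  (tofrac pole_form *: (Ubase *m Rab^T)) i k = tofrac p.
  move=> k; case: (entry_poly i k) => h sh eh.
  exists (q ^+ 2 *: (h`_0 *: vb C + h`_1 *: va C)).
  rewrite mxE tofrac_pole_form -[LHS]mulrA eh tofracZ rmorphD /= !tofracZ
    -mulrA; congr (_ * _).
  rewrite /ev (@horner_coef_wide _ 2) ?size_map_poly // !big_ord_recl big_ord0.
  rewrite !coef_map /= expr0 mulr1 addr0 expr1 mulrDr mulrC; congr (_ + _).
  by rewrite mulrCA /ratio [tb * _]mulrC divfK ?tb_neq0.
have [P hP] := fin_all_exists (fun i => fin_all_exists (entry i)).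
by exists (\matrix_(i, k) P i k); apply/matrixP=> i k; rewrite hP !mxE.
Qed.

Lemma clears_pole_form : clears pole_form (Rst_restr M N q s t).
Proof.
suff [P hP] : cleared (tofrac pole_form *: Rst_restr M N q s t) by exists P.
rewrite Rst_restrE -linearZ /=; apply: cleared_tr.
rewrite scalemxAl /Ubase -map_pinvmx; apply: cleared_mulr; exact: cleared_pole_form.
Qed.

(** A point of the line b q^2 = a q^(-2s) outside the line b q^2 = a, on which
    the numerator 1 - z r in [covec_Rst] would vanish. *)
Definition pole_point (i : 'I_2) : C := if i == 0 then q ^+ (2 * s.+1) else 1.

(** D times the matrix coefficient in [covec_Rst] is a polynomial p, so
    D (b - r a) = p (b - r^(s+1) a) up to a nonzero constant; evaluation at
    [pole_point] gives D = 0. *)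
Lemma clears_vanish D : clears D (Rst_restr M N q s t) -> D.@[pole_point] = 0.
Proof.
case=> P hP; have {P hP}hD : cleared (tofrac D *: Rst_restr M N q s t) by exists P.
have q2 : q ^+ 2 != 1 by exact: q_not_root.
pose w := wvec N q M0 t'.
pose u := tensmx (vpow (v_last C M N) s) w.
have uU : (u <= U0)%MS.
  apply: tensmxS; last exact: wvec_sub.
  by have [] := submodP (powfam (sV q) s) (powfam (tV q) s) (vpow (v_last C M N) s).
have [X uX] : exists X, u = X *m row_base U0.
  by apply/submxP; rewrite eq_row_base.
have wQ : map_mx f w = wvec N Q M0 t'.
  rewrite /w /wvec map_mxM map_vpow map_w_first -map_trmx; congr (_ *m _^T).
  by rewrite map_powfam; apply: powfam_ext; apply: map_sW.
have uQ : map_mx f u = tensmx (vpow (v_last K M N) s) (wvec N Q M0 t').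
  by rewrite /u (map_mxT f) map_vpow map_v_last wQ.
have cWQ : map_mx f (covec_W C M N t') = covec_W K M N t'.
  have e : map_mx f (tensmx (v_last C M N) (vpow (w_first C M N) t')) =
      tensmx (v_last K M N) (vpow (w_first K M N) t').
    by rewrite (map_mxT f) map_v_last map_vpow map_w_first.
  exact: e.
have cQ : map_mx f (covec C M N s' t') = covec K M N s' t'.
  by rewrite /covec (map_mxT f) map_vpow map_v_last cWQ.
have [c0 c00 ec] := covec_wvec q0 q2 M0 N0 t'.
have ecQ : covec_W K M N t' *m (wvec N Q M0 t')^T = (f c0)%:M.
  by rewrite -wQ -cWQ map_trmx -map_mxM ec map_scalar_mx.
have := @covec_Rst K M N Q Q_neq0 Q2_neq1 M0 N0 s' t' ta tb (tb_neq0 C)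
  pole_neq0 (wvec N Q M0 t').
rewrite ecQ -uQ => eR.
have [p hp] : cleared (tofrac D *: (covec K M N s' t' *m Rab *m (map_mx f u)^T)).
  have e1 : tofrac D *: (covec K M N s' t' *m Rab *m (map_mx f u)^T) =
      (map_mx f X *m (tofrac D *: Rst_restr M N q s t)^T *m map_mx f (row_base U0) *m
        (map_mx f (covec C M N s' t'))^T)^T.
    have e2 : Ubase *m Rab^T *m pinvmx Ubase *m Ubase = Ubase *m Rab^T :=
      mulmxKpV Ubase_stable.
    have -> : map_mx f u = map_mx f X *m Ubase by rewrite uX map_mxM.
    rewrite tr_scale Rst_restrE trmxK -/Ubase -scalemxAr -!scalemxAl tr_scale cQ.
    rewrite -[map_mx f X *m _ *m Ubase]mulmxA e2; congr (_ *: _).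
    by apply: trmx_inj; rewrite !trmx_mul !trmxK !mulmxA.
  rewrite e1; apply: cleared_tr; rewrite map_trmx; apply: cleared_mulr.
  by apply: cleared_mulr; apply: cleared_mull; apply: cleared_tr.
pose e := (covec K M N s' t' *m Rab *m (map_mx f u)^T) 0 0.
have {}eR : (1 - ratio C * r ^+ s.+1) * e = Q ^- s * (1 - ratio C * r) * f c0.
  move: eR => /(congr1 (fun A : 'M[K]_(1 * 1) => A 0 0)).
  rewrite [LHS]mxE [RHS]mxE => ->; congr (_ * _).
  by rewrite !mxE !ord1 !eqxx mul1r mulr1n.
have {}hp : tofrac D * e = tofrac (p 0 0).
  by have /matrixP/(_ 0 0) := hp; rewrite [LHS]mxE [RHS]mxE.
have tz m : tb * (1 - ratio C * r ^+ m) = tofrac (vb C - r0 ^+ m *: va C).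
  rewrite rmorphB /= tofracZ f_r mulrBr mulr1 /ratio mulrA [tb * (ta / tb)]mulrC.
  by rewrite divfK ?tb_neq0 // mulrC.
have eD : D * ((q ^- s * c0) *: (vb C - r0 ^+ 1 *: va C)) = p 0 0 *
  (vb C - r0 ^+ s.+1 *: va C).
  apply/eqP; rewrite -tofrac_eq !rmorphM /= tofracZ -!tz -hp expr1; apply/eqP.
  transitivity (tofrac D * tb * ((1 - ratio C * r ^+ s.+1) * e)); last by ring.
  rewrite eR (rmorphM f) fmorphV (rmorphXn f) -/Q; ring.
have := congr1 (meval pole_point) eD.
have er m : r0 ^+ m * q ^+ (2 * m) = 1.
  by rewrite /r0 exprVn -exprM mulVf // expf_neq0.
rewrite !mevalM mevalZ !mevalB !mevalZ !mevalXU /pole_point /= er subrr mulr0.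
move/eqP; rewrite mulf_eq0 => /orP[/eqP //|].
rewrite !mulf_eq0 (negPf c00) invr_eq0 expf_eq0 (negPf q0) andbF /=.
have e1 := er 1%N; rewrite muln1 in e1.
have -> : r0 ^+ 1 * q ^+ (2 * s'.+2) = q ^+ (2 * s).
  by rewrite mulnS exprD mulrA e1 mul1r.
by rewrite subr_eq0 eq_sym (negPf (q_not_root _)).
Qed.

Lemma msize_pole_form : (msize pole_form <= 2)%N.
Proof.
apply: leq_trans (msizeD_le _ _) _; rewrite geq_max msizeN.
by rewrite !(leq_trans (msizeZ_le _ _)) // msizeX mdeg1.
Qed.

Lemma homog_pole_form : pole_form \is 1.-homog.
Proof.
by apply: rpredB; apply: rpredZ; rewrite dhomogX /= mdeg1.
Qed.

Lemma pole_form_neq0 : pole_form != 0.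
Proof.
rewrite -tofrac_eq0 tofrac_pole_form !mulf_neq0 ?pole_neq0 ?tb_neq0 //.
by rewrite fmorph_eq0 expf_neq0.
Qed.

Lemma admissible_pole_form c : c != 0 -> admissible (Rst_restr M N q s t)
  (c *: pole_form).
Proof.
move=> c0; split.
- by rewrite scaler_eq0 negb_or c0 pole_form_neq0.
- by exists 1%N; apply: rpredZ; exact: homog_pole_form.
- have [P hP] := clears_pole_form; exists (map_mx (fun p => c *: p) P).
  rewrite tofracZ -scalerA hP; apply/matrixP=> i j.
  by rewrite !mxE tofracZ.
Qed.

Lemma admissible_msize D :
  admissible (Rst_restr M N q s t) D -> (2 <= msize D)%N.
Proof.
case=> D_neq0 _ /clears_vanish D0v; rewrite ltnNge; apply/negP => /msize1_polyC eD.
move: D0v D_neq0; rewrite eD mevalC => ->.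
by rewrite mpolyC0 eqxx.
Qed.

(** All monomials have the degree of the leading one, which is 1, so only the two
    variables occur. *)
Lemma linear_form (D : {mpoly C[2]}) : (exists d, D \is d.-homog) -> msize D = 2 ->
  D = D@_U_(0 : 'I_2) *: va C + D@_U_(1 : 'I_2) *: vb C.
Proof.
case=> d hd sD.
have [m mD md] : exists2 m, m \in msupp D & mdeg m = 1%N.
  have D_neq0 : D != 0 by apply/eqP => D_eq0; rewrite D_eq0 msize0 in sD.
  exists (mlead D); first exact: mlead_supp.
  by have := mlead_deg D_neq0; rewrite sD => -[].
have d1 : d = 1%N by rewrite -md; have /dhomogP/(_ _ mD) := hd.
apply/mpolyP => m'; rewrite mcoeffD !mcoeffZ !mcoeffX.
have [m'1|m'1] := eqVneq (mdeg m') 1%N; last first.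
  have -> : D@_m' = 0 by apply: dhomog_nemf_coeff hd _; rewrite d1.
  have n0 i : (U_(i : 'I_2)%MM == m') = false.
    by apply/negP => /eqP e; rewrite -e mdeg1 in m'1.
  by rewrite !n0 !mulr0 addr0.
have /mdeg1P[i /eqP ->] : mdeg m' == 1%N by rewrite m'1.
rewrite !eq_mnm1; case: i => [[|[|//]] li].
  have -> : Ordinal li = 0 by apply: val_inj.
  by rewrite eqxx mulr1 mulr0 addr0.
have -> : Ordinal li = 1 by apply: val_inj.
by rewrite eqxx mulr1 mulr0 add0r.
Qed.

Lemma denominator (D : {mpoly C[2]}) :
  is_denominator (Rst_restr M N q s t) D <-> exists2 c : C, c != 0 & D = c *: pole_form.
Proof.
split=> [[hD minD]|[c c0 ->]]; last first.
  split=> [|D' hD']; first exact: admissible_pole_form.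
  rewrite (leq_trans (msizeZ_le _ _)) // (leq_trans msize_pole_form) //.
  exact: admissible_msize.
have D0a : admissible (Rst_restr M N q s t) pole_form.
  by rewrite -[pole_form]scale1r; apply: admissible_pole_form; exact: oner_neq0.
have sD : msize D = 2.
  by apply/eqP; rewrite eqn_leq (leq_trans (minD _ D0a) msize_pole_form) admissible_msize.
have [D_neq0 homD /clears_vanish Dv] := hD.
have eD := linear_form homD sD.
move: (D@_U_(0 : 'I_2)) (D@_U_(1 : 'I_2)) eD => al be eD.
have eb : be = - (al * q ^+ (2 * s.+1)).
  move: Dv; rewrite eD mevalD !mevalZ !mevalXU /pole_point /= mulr1.
  by move/eqP; rewrite addrC addr_eq0 => /eqP.
have qs0 : q ^+ (2 * s) != 0 by rewrite expf_neq0.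
have De : D = (- (al * q ^+ (2 * s))) *: pole_form.
  rewrite eD eb /pole_form scalerBr !scalerA addrC; congr (_ + _).
    by rewrite mulNr -mulrA -exprD mulnS addnC.
  by rewrite mulNr scaleNr opprK mulfK.
exists (- (al * q ^+ (2 * s))) => //.
by apply: contra D_neq0 => /eqP e; rewrite De e scale0r.
Qed.

End Denominator.

Theorem theorem4p1 (R : realType) (M N : nat) (q : R[i])
    (hM : (1 <= M)%N) (hN : (1 <= N)%N)
    (q_neq0 : q != 0)
    (q_not_root : forall n : nat, (0 < n)%N -> q ^+ n != 1)
    (s t : nat) (hs : (1 <= s <= M)%N) (ht : (1 <= t <= N)%N)
    (D : {mpoly R[i][2]}) :
  is_denominator (Rst_restr M N q s t) D <->
  exists2 c : R[i], c != 0 &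
    D = c *: (q ^+ 2 *: vb R[i] - q ^- (2 * s) *: va R[i]).
Proof.
case: s t hs ht => [|s] [|t] //= _ _.
exact: denominator.
Qed.
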